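(* Let $0<p<\infty$, let $a\subset\mathbb{D}$ be a subset of the unit disk, and let $\mu$ be the measure on $a$ given by $\mu(E):=\sum_{z\in E}(1-|z|^2)$ for $E\subset a$. (1) If $\lambda_1(NT(a))>0$, then $H^p(\mathbb{D})\cap L^p(\mu)=\{0\}$; that is, if $f\in H^p(\mathbb{D})$ and $\sum_{z\in a}(1-|z|^2)|f(z)|^p<\infty$, then $f=0$. (2) The set $a$ is $H^p(\mathbb{D})$-thick if and only if $H^p(\mathbb{D})\cap L^p(\mu)=\{0\}$.
   Context: $\mathbb{D}$ is the open unit disk in $\mathbb{C}$ and $\lambda_1$ is the one-dimensional Lebesgue measure on the unit circle $\partial\mathbb{D}$. For $0<p<\infty$, $H^p(\mathbb{D})$ is the set of holomorphic functions $f$ on $\mathbb{D}$ with $\|f\|_p:=\left(\sup_{r<1}\int_0^{2\pi}|f(re^{i\theta})|^p\,\frac{d\theta}{2\pi}\right)^{1/p}<\infty$. For $\alpha>0$, the Stolz angle with vertex $e^{i\theta}$ is $\Gamma_\alpha(e^{i\theta}):=\{z\in\mathbb{D}:\frac{|e^{i\theta}-z|}{1-|z|}<1+\alpha\}$. $NT(a)$ is the set of nontangential limit points of $a$, i.e. of those $e^{i\theta}\in\partial\mathbb{D}$ that lie in the closure of $\Gamma_\alpha(e^{i\theta})\cap a$ for some $\alpha>0$. $H^p(\mathbb{D})\cap L^p(\mu)$ denotes the set of $f\in H^p(\mathbb{D})$ with $\sum_{z\in a}(1-|z|^2)|f(z)|^p<\infty$. The set $a$ is $H^p(\mathbb{D})$-thick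 iff there exists a constant $C>0$ such that for every $f\in H^p(\mathbb{D})$, $$\left(\sum_{z\in a}(1-|z|^2)|f(z)|^p\right)^{1/p}\ge C\|f\|_p,$$ where the left-hand side is allowed to be $+\infty$. *)

(* Defs.v *)
From HB Require Import structures.
From mathcomp Require Import all_boot all_order all_algebra.
From mathcomp Require Import complex.
From mathcomp Require Import all_classical all_reals all_analysis.

Set Implicit Arguments.
Unset Strict Implicit.
Unset Printing Implicit Defensive.

Import Order.TTheory GRing.Theory Num.Theory.
Import numFieldNormedType.Exports.

Local Open Scope classical_set_scope.
Local Open Scope complex_scope.
Local Open Scope ring_scope.

(* The norm `|z| of R[i] takes its values in R[i]; this is its real part,
   as an element of R. *)
Definition cmod (R : realType) (z : R[i]) : R := complex.Re `|z|.

Definition cis (R : realType) (t : R) : R[i] := cos t +i* sin t.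

Definition disk (R : realType) : set R[i] := [set z | cmod z < 1].

Definition unit_circle (R : realType) : set R[i] := [set w | cmod w = 1].

Arguments disk R : clear implicits.
Arguments unit_circle R : clear implicits.

(* Arc length.  lebesgue_measure is Lebesgue outer measure on arbitrary sets,
   so this is defined for every E. *)
Definition circle_measure (R : realType) (E : set R[i]) : \bar R :=
  lebesgue_measure ((`[0, 2 * pi[ : set R) `&` @cis R @^-1` E).

(* Complex differentiability at every point of U, meant for U open.  The
   alias R[i]^o carries the topology and the normed module structure of R[i]
   over itself, so this is the derivative along complex increments. *)
Definition holomorphic_on (R : realType) (U : set R[i]) (f : R[i] -> R[i]) :=
  forall z, U z -> derivable (f : R[i]^o -> R[i]^o) z 1.

(* \int_0^(2 pi) |f(r e^(i t))|^p dt / (2 pi) *)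
Definition circle_mean (R : realType) (p : R) (f : R[i] -> R[i]) (r : R)
    : \bar R :=
  (((2 * pi)^-1)%:E *
   \int[lebesgue_measure]_(t in (`[0%R, (2 * pi)%R] : set R))
     (cmod (f (r%:C * cis t)%R) `^ p)%:E)%E.

Definition hardy_norm (R : realType) (p : R) (f : R[i] -> R[i]) : \bar R :=
  (ereal_sup [set circle_mean p f r | r in [set r : R | (0 <= r < 1)%R]]
    `^ p^-1)%E.

(* Functions on the disk are represented by total functions, of which only the
   values on the disk are used. *)
Definition hardy_space (R : realType) (p : R) : set (R[i] -> R[i]) :=
  [set f | holomorphic_on (disk R) f /\ (hardy_norm p f < +oo)%E].

Definition stolz (R : realType) (alpha : R) (w : R[i]) : set R[i] :=
  [set z | disk R z /\ cmod (w - z) / (1 - cmod z) < 1 + alpha].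

Definition NT (R : realType) (a : set R[i]) : set R[i] :=
  [set w | unit_circle R w /\
     exists2 alpha : R, 0 < alpha &
       closure (stolz alpha w `&` a : set R[i]^o) w].

(* The integral of |f|^p against the measure mu on a with
   mu(E) = \sum_(z in E) (1 - |z|^2).  The sum is unconditional, in [0, +oo],
   and a may be uncountable. *)
Definition weighted_sum (R : realType) (p : R) (a : set R[i])
    (f : R[i] -> R[i]) : \bar R :=
  (\esum_(z in a) ((1 - cmod z ^+ 2) * cmod (f z) `^ p)%:E)%R.

Definition hardy_Lp (R : realType) (p : R) (a : set R[i]) :
    set (R[i] -> R[i]) :=
  [set f | hardy_space p f /\ (weighted_sum p a f < +oo)%E].

(* The set {0} of functions on the disk, see hardy_space. *)
Definition zero_on_disk (R : realType) : set (R[i] -> R[i]) :=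
  [set f | forall z, disk R z -> f z = 0].

Arguments zero_on_disk R : clear implicits.

Definition thick (R : realType) (p : R) (a : set R[i]) : Prop :=
  exists2 C : R, 0 < C & forall f, hardy_space p f ->
    (C%:E * hardy_norm p f <= weighted_sum p a f `^ p^-1)%E.

(* Main.v *)
(* Both parts replace f by polynomials Q with no zero on the unit circle such that
Q(z) z^m is close to f(s z), s -> 1, and |Q(0)| is bounded below.

Multiplying f by z^n makes the weighted sum arbitrarily small, but only scales
the mean over |z| = r by r^(n p).  If a is thick, the circle means of f therefore
tend to 0, which contradicts Jensen's inequality for Q.

For nontangential limits, Jensen's inequality bounds the integral of ln^-|Q| and
the sum of 1 - |b| over the roots b of Q in the disk, uniformly in Q.  By the
Poisson-Jensen formula and the Hardy-Littlewood maximal inequality, outside a set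
of vertices of measure O(1/lam), |Q| >= e^(-lam) at the points of the Stolz angle
that are away from the roots; and K well separated points of a Stolz angle are
all close to roots only when the vertex lies under K roots, hence for a set of
vertices of measure O(1/K).  So, given lam and K, there is delta > 0 such that up
to measure O(1/lam + 1/K) no vertex is the limit of points z of its Stolz angle
with |f(z)| < delta.  The points of a with |f(z)| >= delta have a finite sum of
1 - |z|, so they cluster nontangentially only on a null set. *)
Require Import Defs.
From mathcomp Require Import all_boot all_order all_algebra.
From mathcomp Require Import complex.
From mathcomp Require Import all_classical all_reals all_analysis.
From mathcomp Require Import measurable_realfun.
From mathcomp Require Import ring lra.

Set Implicit Arguments.
Unset Strict Implicit.
Unset Printing Implicit Defensive.

Import Order.TTheory GRing.Theory Num.Theory.
Import numFieldNormedType.Exports.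

Local Open Scope classical_set_scope.
Local Open Scope complex_scope.
Local Open Scope ring_scope.

(** Polynomials replace the boundary theory of Hardy spaces: with finitely many roots, none on the
    circle, ln |Q| is continuous there, Poisson-Jensen is a finite identity, and neither radial
    limits nor Blaschke products occur. The price is that every estimate must be uniform in Q. The
    obstacle in (1) is that roots of Q may lie close to the points of a Stolz angle. The sum of 1 -
    |b| over the roots is bounded but not small, so the vertices below some root need not form a
    small set; those below K roots do, by Chebyshev's inequality. A nontangential limit point
    supplies as many separated points as desired, so K is free. The bad set of vertices depends on
    Q. A vertex that is bad for f is bad for all late members of a sequence of Q, from an index on
    that depends on the vertex; such vertices form a lower limit of bad sets, which inherits their
    measure bound. Vertices are angles at distance at least k from 0 and 2 pi, so that arc and chord
    are comparable without identifying the two ends; a countable union over k then recovers all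
    angles but 0. *)

Section Cmod.
Variable R : realType.
Implicit Types (x y z w : R[i]) (t s : R).

Lemma cmodE z : cmod z = Num.sqrt (complex.Re z ^+ 2 + complex.Im z ^+ 2).
Proof. by rewrite /cmod normc_def. Qed.

Lemma cmodC z : (cmod z)%:C = `|z|.
Proof. by rewrite cmodE normc_def. Qed.

Lemma cmod_ge0 z : 0 <= cmod z.
Proof. by rewrite cmodE sqrtr_ge0. Qed.

Lemma cmodM x y : cmod (x * y) = cmod x * cmod y.
Proof. by apply: (@complexI R); rewrite rmorphM /= !cmodC normrM. Qed.

Lemma cmodV x : cmod x^-1 = (cmod x)^-1.
Proof. by apply: (@complexI R); rewrite fmorphV /= !cmodC normfV. Qed.

Lemma cmodX x n : cmod (x ^+ n) = cmod x ^+ n.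
Proof. by apply: (@complexI R); rewrite rmorphXn /= !cmodC normrX. Qed.

Lemma cmodN x : cmod (- x) = cmod x.
Proof. by apply: (@complexI R); rewrite !cmodC normrN. Qed.

Lemma cmodB x y : cmod (x - y) = cmod (y - x).
Proof. by rewrite -cmodN opprB. Qed.

Lemma cmod0 : cmod (0 : R[i]) = 0.
Proof. by apply: (@complexI R); rewrite !cmodC normr0. Qed.

Lemma cmod1 : cmod (1 : R[i]) = 1.
Proof. by apply: (@complexI R); rewrite !cmodC normr1. Qed.

Lemma cmod_eq0 x : (cmod x == 0) = (x == 0).
Proof. by rewrite -(inj_eq (@complexI R)) cmodC normr_eq0. Qed.

Lemma cmod_gt0 x : (0 < cmod x) = (x != 0).
Proof. by rewrite lt_def cmod_eq0 cmod_ge0 andbT. Qed.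

Lemma cmodD x y : cmod (x + y) <= cmod x + cmod y.
Proof. by rewrite -lecR rmorphD /= !cmodC ler_normD. Qed.

Lemma cmodBD x y : cmod (x - y) <= cmod x + cmod y.
Proof. by rewrite -(cmodN y) cmodD. Qed.

Lemma cmod_dist y x z : cmod (x - z) <= cmod (x - y) + cmod (y - z).
Proof. by rewrite (le_trans _ (cmodD _ _))// addrA subrK. Qed.

Lemma cmod_sub_le x y : cmod x - cmod y <= cmod (x - y).
Proof. by rewrite lerBlDr (le_trans _ (cmodD _ _))// subrK. Qed.

Lemma cmod_real t : cmod t%:C = `|t|.
Proof. by rewrite cmodE /= expr0n addr0 sqrtr_sqr. Qed.

Lemma cmod_conj x : cmod x^* = cmod x.
Proof. by apply: (@complexI R); rewrite !cmodC normcJ. Qed.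

Lemma normRe_le z : `|complex.Re z| <= cmod z.
Proof. by rewrite -lecR cmodC normc_ge_Re. Qed.

Lemma normIm_le z : `|complex.Im z| <= cmod z.
Proof.
rewrite cmodE -sqrtr_sqr ler_wsqrtr// lerDr sqr_ge0 //.
Qed.

Lemma cmod_le_ReIm z : cmod z <= `|complex.Re z| + `|complex.Im z|.
Proof.
rewrite (complexE z) (le_trans (cmodD _ _))//= cmodM.
rewrite !cmod_real cmodE /= expr0n /= expr1n add0r sqrtr1 mul1r.
by rewrite !(addr0,mul0r,mul1r,subr0,add0r).
Qed.

Lemma cmod_sqr z : cmod z ^+ 2 = complex.Re z ^+ 2 + complex.Im z ^+ 2.
Proof. by rewrite cmodE sqr_sqrtr// addr_ge0 ?sqr_ge0. Qed.

Lemma cmod_cis t : cmod (cis t) = 1.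
Proof. by rewrite cmodE /= cos2Dsin2 sqrtr1. Qed.

Lemma cis_neq0 t : cis t != 0.
Proof. by rewrite -cmod_gt0 cmod_cis. Qed.

Lemma cisD s t : cis (s + t) = cis s * cis t.
Proof. by rewrite /cis cosD sinD; apply/eqP; rewrite eq_complex /= addrC [_ * sin t + _]addrC !eqxx. Qed.

Lemma cis0 : cis (0 : R) = 1.
Proof. by rewrite /cis cos0 sin0. Qed.

Lemma cisN t : cis (- t) = (cis t)^-1.
Proof. by apply: (mulIf (cis_neq0 t)); rewrite -cisD addNr cis0 mulVf// cis_neq0. Qed.

Lemma cis_conj t : (cis t)^* = cis (- t).
Proof. by rewrite /cis cosN sinN. Qed.

Lemma cisMn n t : cis (n%:R * t) = cis t ^+ n.
Proof.
elim: n => [|n IH]; first by rewrite mul0r cis0.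
by rewrite -natr1 mulrDl mul1r cisD IH exprSr.
Qed.

Lemma cis2pi : cis (2 * pi : R) = 1.
Proof. by rewrite mulr2n mulrDl mul1r /cis -mulr2n cos2pi sin2pi. Qed.

Lemma cReM x y : complex.Re (x * y) = complex.Re x * complex.Re y - complex.Im x * complex.Im y.
Proof. by case: x; case: y. Qed.

Lemma cImM x y : complex.Im (x * y) = complex.Re x * complex.Im y + complex.Im x * complex.Re y.
Proof. by case: x; case: y. Qed.

Lemma cReD x y : complex.Re (x + y) = complex.Re x + complex.Re y.
Proof. by case: x; case: y. Qed.

Lemma cImD x y : complex.Im (x + y) = complex.Im x + complex.Im y.
Proof. by case: x; case: y. Qed.

Lemma cReN x : complex.Re (- x) = - complex.Re x.
Proof. by case: x. Qed.

Lemma cImN x : complex.Im (- x) = - complex.Im x.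
Proof. by case: x. Qed.

Lemma polar z : exists2 t : R, 0 <= t <= 2 * pi & z = (cmod z)%:C * cis t.
Proof.
have [->|z0] := eqVneq z 0.
  by exists 0; [rewrite lexx mulr_ge0// pi_ge0|rewrite cmod0 mul0r].
have c0 : 0 < cmod z by rewrite cmod_gt0.
pose x := complex.Re z / cmod z; pose y := complex.Im z / cmod z.
have xy : x ^+ 2 + y ^+ 2 = 1.
  by rewrite /x /y !expr_div_n -mulrDl -cmod_sqr divff// expf_neq0// gt_eqF.
have x1 : -1 <= x <= 1.
  rewrite -ler_norml -(@ler_pXn2r _ 2)// ?nnegrE// expr1n real_normK ?num_real//.
  by rewrite -xy lerDl sqr_ge0.
have y1 : `|y| = Num.sqrt (1 - x ^+ 2) by rewrite -xy addrAC subrr add0r sqrtr_sqr.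
have zE : z = (cmod z)%:C * (x +i* y).
  rewrite /x /y {1}(complexE z); apply/eqP; rewrite eq_complex /= !(mul0r, mul1r, subr0, add0r, addr0).
  by rewrite !(mulrCA (cmod z)) !divff ?(gt_eqF c0)// !mulr1 !eqxx.
have pi0 := pi_ge0 R.
have [y0|y0] := leP 0 y.
  exists (acos x).
    rewrite acos_ge0//= (le_trans (acos_lepi x1))//; lra.
  by rewrite {1}zE /cis acosK ?in_itv// sin_acos// -y1 ger0_norm.
exists (2 * pi - acos x).
  have := acos_ge0 x1; have := acos_lepi x1; lra.
by rewrite {1}zE cisD cis2pi mul1r /cis cosN sinN acosK ?in_itv// sin_acos// -y1 ltr0_norm// opprK.
Qed.

End Cmod.

(** * Integration along curves *)

Section RealIntegral.
Variable R : realType.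
Implicit Types (f g : R -> R) (a b c : R).

Definition rint f a b : R := \int[lebesgue_measure]_(t in `[a, b]) f t.

Lemma cont_integrable f a b : continuous f ->
  (@lebesgue_measure R).-integrable `[a, b] (EFin \o f).
Proof.
move=> cf; apply: continuous_compact_integrable; first exact: segment_compact.
exact: continuous_subspaceT.
Qed.

Lemma rintD f g a b : continuous f -> continuous g ->
  rint (fun t => f t + g t) a b = rint f a b + rint g a b.
Proof. by move=> cf cg; rewrite /rint RintegralD//; exact: cont_integrable. Qed.

Lemma rintZ k f a b : continuous f -> rint (fun t => k * f t) a b = k * rint f a b.
Proof. by move=> cf; rewrite /rint RintegralZl//; exact: cont_integrable. Qed.

Lemma rintN f a b : continuous f -> rint (fun t => - f t) a b = - rint f a b.
Proof.
by move=> cf; rewrite -mulN1r -rintZ//; congr (rint _ a b); apply/funext => t; rewrite mulN1r.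
Qed.

Lemma rint_cst k a b : a <= b -> rint (fun=> k) a b = k * (b - a).
Proof.
move=> ab; rewrite /rint Rintegral_cst//= lebesgue_measure_itv/= lte_fin.
by move: ab; rewrite le_eqVlt => /predU1P[->|->//]; rewrite ltxx subrr mulr0.
Qed.

Lemma rint_le f g a b : continuous f -> continuous g ->
  (forall t, a <= t <= b -> f t <= g t) -> rint f a b <= rint g a b.
Proof.
move=> cf cg fg; rewrite /rint le_Rintegral//; try exact: cont_integrable.
Qed.

Lemma rint_ge0 f a b : (forall t, a <= t <= b -> 0 <= f t) -> 0 <= rint f a b.
Proof. by move=> f0; apply: Rintegral_ge0 => t; rewrite /= in_itv/=; exact: f0. Qed.

Lemma eq_rint f g a b : (forall t, a <= t <= b -> f t = g t) -> rint f a b = rint g a b.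
Proof.
by move=> fg; apply: eq_Rintegral => t; rewrite inE /= in_itv/=; exact: fg.
Qed.

Lemma rint_split c f a b : continuous f -> a <= c <= b ->
  rint f a b = rint f a c + rint f c b.
Proof.
move=> cf /andP[ac cb]; apply/eqP; rewrite addrC -subr_eq; apply/eqP.
rewrite /rint Rintegral_itvB//; last exact: cont_integrable.
rewrite Rintegral_itv_obnd_cbnd//.
by apply: integrableS (cont_integrable c b cf) => //; apply: subset_itvr; rewrite bnd_simp.
Qed.

Lemma rint_bound (M : R) f a b : a <= b -> continuous f ->
  (forall t, a <= t <= b -> `|f t| <= M) -> `|rint f a b| <= M * (b - a).
Proof.
move=> ab cf fM; rewrite ler_norml -mulNr -!rint_cst//.
have cc (k : R) : continuous (cst k : R -> R) by move=> x; exact: cvg_cst.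
by rewrite !rint_le//; try exact: cc; move=> t /fM; rewrite ler_norml => /andP[].
Qed.

Lemma rint_FTC F f a b : a <= b -> continuous f ->
  (forall x : R, is_derive x 1 F (f x)) -> rint f a b = F b - F a.
Proof.
rewrite le_eqVlt => /predU1P[->|ab] cf dF.
  by rewrite subrr /rint set_itv1 Rintegral_set1.
have cF : continuous F.
  move=> x; have [d _] := dF x.
  by apply: differentiable_continuous; exact/derivable1_diffP.
rewrite /rint /Rintegral (@continuous_FTC2 _ f F)//.
- exact: continuous_subspaceT.
- split => [x _||]; first by have [] := dF x.
  + exact/cvg_at_right_filter/cF.
  + exact/cvg_at_left_filter/cF.
- by move=> x _; rewrite derive1E; have [_] := dF x.
Qed.

End RealIntegral.

(** * Complex-valued functions of a real variable *)

Section ComplexIntegral.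
Variable R : realType.
Implicit Types (F G : R -> R[i]) (a b c : R).

(** Continuity is imposed on the two components because [cint] is built from real integrals;
    [ccontP] gives the epsilon-delta form in terms of [cmod]. *)
Definition ccont F := continuous (fun t => complex.Re (F t)) /\
  continuous (fun t => complex.Im (F t)).

Lemma cst_continuous_real (k : R) : continuous (cst k : R -> R).
Proof. by move=> x; exact: cvg_cst. Qed.

Lemma ccont_cst (z : R[i]) : ccont (fun=> z).
Proof. by split; exact: cst_continuous_real. Qed.

Lemma ccont_real (f : R -> R) : continuous f -> ccont (fun t => (f t)%:C).
Proof. by split => //; exact: cst_continuous_real. Qed.

Lemma ccontD F G : ccont F -> ccont G -> ccont (fun t => F t + G t).
Proof.
move=> [F1 F2] [G1 G2]; split.
- rewrite (_ : (fun t => complex.Re (F t + G t)) = (fun t => complex.Re (F t) + complex.Re (G t))).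
    by move=> x; apply: cvgD; [exact: F1|exact: G1].
  by apply/funext => t; rewrite raddfD.
- rewrite (_ : (fun t => complex.Im (F t + G t)) = (fun t => complex.Im (F t) + complex.Im (G t))).
    by move=> x; apply: cvgD; [exact: F2|exact: G2].
  by apply/funext => t; rewrite raddfD.
Qed.

Lemma ccontM F G : ccont F -> ccont G -> ccont (fun t => F t * G t).
Proof.
move=> [F1 F2] [G1 G2]; split.
- under eq_fun do rewrite cReM.
  by move=> x; apply: cvgB; apply: cvgM; [exact: F1|exact: G1|exact: F2|exact: G2].
- under eq_fun do rewrite cImM.
  by move=> x; apply: cvgD; apply: cvgM; [exact: F1|exact: G2|exact: F2|exact: G1].
Qed.

Lemma ccontN F : ccont F -> ccont (fun t => - F t).
Proof.
move=> cF; rewrite (_ : (fun t => - F t) = fun t => (-1) * F t).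
  by apply: ccontM => //; exact: ccont_cst.
by apply/funext => t; rewrite mulN1r.
Qed.

Lemma ccontB F G : ccont F -> ccont G -> ccont (fun t => F t - G t).
Proof. by move=> cF cG; apply: ccontD => //; exact: ccontN. Qed.

Lemma ccontX F n : ccont F -> ccont (fun t => F t ^+ n).
Proof.
move=> cF; elim: n => [|n IH].
  by under eq_fun do rewrite expr0; exact: ccont_cst.
by under eq_fun do rewrite exprS; exact: ccontM.
Qed.

Lemma ccont_sum (I : Type) (s : seq I) (F : I -> R -> R[i]) : (forall i, ccont (F i)) ->
  ccont (fun t => \sum_(i <- s) F i t).
Proof.
move=> cF; elim: s => [|i s IH].
  by under eq_fun do rewrite big_nil; exact: ccont_cst.
by under eq_fun do rewrite big_cons; exact: ccontD.
Qed.

Lemma ccont_cmod F : ccont F -> continuous (fun t => cmod (F t)).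
Proof.
move=> [F1 F2]; under eq_fun do rewrite cmodE.
move=> x; apply: continuous_cvg; first exact: sqrt_continuous.
by apply: cvgD; apply: cvgM; [exact: F1|exact: F1|exact: F2|exact: F2].
Qed.

Lemma ccontV F : (forall t, F t != 0) -> ccont F -> ccont (fun t => (F t)^-1).
Proof.
move=> F0 cF; have [F1 F2] := cF.
have h : continuous (fun t => (cmod (F t) ^+ 2)^-1).
  move=> x; apply: cvgV; first by rewrite expf_neq0// cmod_eq0.
  by apply: cvgM; exact: ccont_cmod.
split.
- rewrite (_ : (fun t => _) = (fun t => complex.Re (F t) * (cmod (F t) ^+ 2)^-1)).
    by move=> x; apply: cvgM; [exact: F1|exact: h].
  by apply/funext => t; rewrite cmod_sqr; case: (F t).
- rewrite (_ : (fun t => _) = (fun t => - complex.Im (F t) * (cmod (F t) ^+ 2)^-1)).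
    by move=> x; apply: cvgM; [apply: cvgN; exact: F2|exact: h].
  by apply/funext => t; rewrite cmod_sqr; case: (F t) => u v /=; rewrite mulNr.
Qed.

Lemma ccont_conj F : ccont F -> ccont (fun t => (F t)^*).
Proof.
move=> [F1 F2]; split.
  by rewrite (_ : (fun t => _) = (fun t => complex.Re (F t)))//; apply/funext => t; case: (F t).
rewrite (_ : (fun t => _) = (fun t => - complex.Im (F t))).
  by move=> x; apply: cvgN; exact: F2.
by apply/funext => t; case: (F t).
Qed.

Lemma ccont_cis (k : R) : ccont (fun t => cis (k * t)).
Proof.
have h : continuous (fun t : R => k * t) by move=> x; apply: cvgM; [exact: cvg_cst|exact: cvg_id].
split => x; apply: continuous_comp; [exact: h|exact: continuous_cos|exact: h|exact: continuous_sin].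
Qed.

Lemma ccont_cis1 : ccont (@cis R).
Proof. by have := ccont_cis 1; under eq_fun do rewrite mul1r. Qed.

Lemma ccontP F : ccont F <-> forall x (e : R), 0 < e ->
  exists2 d : R, 0 < d & forall y, `|y - x| < d -> cmod (F y - F x) < e.
Proof.
split.
- move=> cF x e e0.
  have cG : continuous (fun t => cmod (F t - F x)).
    by apply: ccont_cmod; apply: ccontB => //; exact: ccont_cst.
  have /cvgr_dist_lt := cG x; rewrite subrr cmod0 => /(_ e e0).
  move=> /nbhs_ballP[d d0 H]; exists d => // y xy.
  have := H y; rewrite /ball /= distrC => /(_ xy).
  by rewrite sub0r normrN ger0_norm ?cmod_ge0.
- move=> H; split => x; apply/cvgrPdist_lt => e e0; have [d d0 Hd] := H x e e0;
  apply/nbhs_ballP; exists d => // y; rewrite /ball /= distrC => /Hd {Hd}Hd.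
  + by rewrite distrC -raddfB (le_lt_trans (normRe_le _)).
  + by rewrite distrC -raddfB (le_lt_trans (normIm_le _)).
Qed.

Definition cint F a b : R[i] :=
  rint (fun t => complex.Re (F t)) a b +i* rint (fun t => complex.Im (F t)) a b.

Lemma eq_cint F G a b : (forall t, a <= t <= b -> F t = G t) -> cint F a b = cint G a b.
Proof. by move=> FG; congr (_ +i* _); apply: eq_rint => t /FG ->. Qed.

Lemma cintD F G a b : ccont F -> ccont G ->
  cint (fun t => F t + G t) a b = cint F a b + cint G a b.
Proof.
move=> [F1 F2] [G1 G2]; apply/eqP; rewrite eq_complex /= -!rintD//.
by apply/andP; split; apply/eqP; apply: eq_rint => t _; rewrite raddfD.
Qed.

Lemma cintZ (z : R[i]) F a b : ccont F -> cint (fun t => z * F t) a b = z * cint F a b.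
Proof.
move=> [F1 F2]; have cZ (k : R) f : continuous f -> continuous (fun t : R => k * f t : R).
  by move=> cf x; apply: cvgM; [exact: cvg_cst|exact: cf].
case: z => x y; apply/eqP; rewrite eq_complex /=.
rewrite -!rintZ// -rintD//; try exact: cZ.
rewrite -rintN; last exact: cZ.
rewrite -rintD; [|exact: cZ|by move=> u; apply: cvgN; exact: cZ].
by apply/andP; split; apply/eqP; apply: eq_rint => t _; case: (F t).
Qed.

Lemma cintN F a b : ccont F -> cint (fun t => - F t) a b = - cint F a b.
Proof. by move=> cF; rewrite -mulN1r -cintZ//; apply: eq_cint => t _; rewrite mulN1r. Qed.

Lemma cintB F G a b : ccont F -> ccont G ->
  cint (fun t => F t - G t) a b = cint F a b - cint G a b.
Proof. by move=> cF cG; rewrite cintD ?cintN//; exact: ccontN. Qed.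

Lemma cint_cst (z : R[i]) a b : a <= b -> cint (fun=> z) a b = z * (b - a)%:C.
Proof.
move=> ab; rewrite /cint !rint_cst//; case: z => x y.
by apply/eqP; rewrite eq_complex /= !mulr0 subr0 add0r !eqxx.
Qed.

Lemma cint_sum (I : Type) (s : seq I) (F : I -> R -> R[i]) a b : a <= b ->
  (forall i, ccont (F i)) ->
  cint (fun t => \sum_(i <- s) F i t) a b = \sum_(i <- s) cint (F i) a b.
Proof.
move=> ab cF; elim: s => [|i s IH].
  by rewrite big_nil -[RHS](mul0r (b - a)%:C) -cint_cst//; apply: eq_cint => t _; rewrite big_nil.
rewrite big_cons -IH -cintD//; last exact: ccont_sum.
by apply: eq_cint => t _; rewrite big_cons.
Qed.

Lemma cint_split c F a b : ccont F -> a <= c <= b ->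
  cint F a b = cint F a c + cint F c b.
Proof.
by move=> [F1 F2] acb; apply/eqP; rewrite eq_complex /= -!rint_split// !eqxx.
Qed.

(** The factor 2 comes from bounding the real and the imaginary part separately; only its finiteness
    matters later. *)
Lemma cint_bound (M : R) F a b : a <= b -> ccont F ->
  (forall t, a <= t <= b -> cmod (F t) <= M) -> cmod (cint F a b) <= 2 * M * (b - a).
Proof.
move=> ab [F1 F2] FM; rewrite (le_trans (cmod_le_ReIm _))//= -mulrA mulr_natl mulr2n.
by apply: lerD; apply: rint_bound => // t /FM; apply: le_trans; rewrite ?normRe_le ?normIm_le.
Qed.

Lemma cint_conj F a b : ccont F -> cint (fun t => (F t)^*) a b = (cint F a b)^*.
Proof.
move=> [F1 F2]; apply/eqP; rewrite eq_complex /= -rintN//.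
by apply/andP; split; apply/eqP; apply: eq_rint => t _; case: (F t).
Qed.

Definition cderiv F G := forall x : R, is_derive x 1 (fun t => complex.Re (F t)) (complex.Re (G x))
  /\ is_derive x 1 (fun t => complex.Im (F t)) (complex.Im (G x)).

Lemma cint_FTC F G a b : a <= b -> ccont G -> cderiv F G -> cint G a b = F b - F a.
Proof.
move=> ab [G1 G2] dF; apply/eqP; rewrite eq_complex /= !raddfB /=.
have -> : rint (fun t => complex.Re (G t)) a b = complex.Re (F b) - complex.Re (F a).
  by apply: (@rint_FTC _ (fun t => complex.Re (F t))) => // x; have [] := dF x.
have -> : rint (fun t => complex.Im (G t)) a b = complex.Im (F b) - complex.Im (F a).
  by apply: (@rint_FTC _ (fun t => complex.Im (F t))) => // x; have [] := dF x.
by rewrite !eqxx.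
Qed.

Lemma cderiv_cst (z : R[i]) : cderiv (fun=> z) (fun=> 0).
Proof. by move=> x; split; exact: is_derive_cst. Qed.

Lemma cderivD F F' G G' : cderiv F F' -> cderiv G G' ->
  cderiv (fun t => F t + G t) (fun t => F' t + G' t).
Proof.
move=> dF dG x; have [f1 f2] := dF x; have [g1 g2] := dG x.
split; rewrite raddfD /=.
  by under eq_fun do rewrite raddfD/=; exact: is_deriveD.
by under eq_fun do rewrite raddfD/=; exact: is_deriveD.
Qed.

Lemma rderivB (f g : R -> R) (x df dg : R) : is_derive x 1 f df -> is_derive x 1 g dg ->
  is_derive x 1 (fun t => f t - g t) (df - dg).
Proof. by move=> hf hg; have := is_deriveB hf hg. Qed.

Lemma rderivD (f g : R -> R) (x df dg : R) : is_derive x 1 f df -> is_derive x 1 g dg ->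
  is_derive x 1 (fun t => f t + g t) (df + dg).
Proof. by move=> hf hg; have := is_deriveD hf hg. Qed.

Lemma rderivM (f g : R -> R) (x df dg : R) : is_derive x 1 f df -> is_derive x 1 g dg ->
  is_derive x 1 (fun t => f t * g t) (df * g x + f x * dg).
Proof.
move=> hf hg; have := is_deriveM hf hg.
by rewrite /GRing.scale /= addrC (mulrC (g x)).
Qed.

Lemma rderivZ (k : R) (f : R -> R) (x df : R) : is_derive x 1 f df ->
  is_derive x 1 (fun t => k * f t) (k * df).
Proof. by move=> hf; have := is_deriveZ k hf. Qed.

Lemma cderivM F F' G G' : cderiv F F' -> cderiv G G' ->
  cderiv (fun t => F t * G t) (fun t => F' t * G t + F t * G' t).
Proof.
move=> dF dG x; have [f1 f2] := dF x; have [g1 g2] := dG x; split.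
- under eq_fun do rewrite cReM.
  apply: (is_derive_eq (rderivB (rderivM f1 g1) (rderivM f2 g2))).
  by rewrite cReD !cReM; ring.
- under eq_fun do rewrite cImM.
  apply: (is_derive_eq (rderivD (rderivM f1 g2) (rderivM f2 g1))).
  by rewrite cImD !cImM; ring.
Qed.

Lemma cderiv_cis (k : R) : cderiv (fun t => cis (k * t)) (fun t => ('i * k%:C) * cis (k * t)).
Proof.
move=> x.
have h : is_derive x 1 (fun t : R => k * t) k.
  by rewrite -[X in is_derive _ _ _ X]mulr1; apply: rderivZ; exact: is_derive_id.
split; rewrite ?cReM ?cImM /=.
- apply: (is_derive_eq (is_derive1_comp (is_derive_cos (k * x)) h)).
  by rewrite /=; ring.
- apply: (is_derive_eq (is_derive1_comp (is_derive_sin (k * x)) h)).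
  by rewrite /=; ring.
Qed.

End ComplexIntegral.

(** * Cauchy's formula *)

Section Goursat.
Variable R : realType.

(* Goursat's bisection argument for an additive function of rectangles. *)
Lemma rect_additive_zero (psi : R -> R -> R -> R -> R[i]) (a b c d : R) :
  a <= b -> c <= d ->
  (forall u v w y y', u <= v <= w -> y <= y' ->
    psi u w y y' = psi u v y y' + psi v w y y') ->
  (forall u u' x y z, u <= u' -> x <= y <= z ->
    psi u u' x z = psi u u' x y + psi u u' y z) ->
  (forall p q e : R, 0 < e -> exists2 dl : R, 0 < dl & forall u u' y y' : R,
    u <= p <= u' -> y <= q <= y' -> u' - u < dl -> y' - y < dl ->
    cmod (psi u u' y y') <= e * ((u' - u) + (y' - y)) ^+ 2) ->
  psi a b c d = 0.
Proof.
move=> ab cd addu addy loc.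
pose W := b - a; pose H := d - c.
have W0 : 0 <= W by rewrite subr_ge0.
have H0 : 0 <= H by rewrite subr_ge0.
pose w n := W / 2 ^+ n; pose h n := H / 2 ^+ n.
have p2 n : 0 < (2 : R) ^+ n by rewrite exprn_gt0.
have w0 n : 0 <= w n by rewrite divr_ge0// ltW.
have h0 n : 0 <= h n by rewrite divr_ge0// ltW.
have wS n : w n = w n.+1 + w n.+1.
  by rewrite /w exprS invfM; field; rewrite gt_eqF.
have hS n : h n = h n.+1 + h n.+1.
  by rewrite /h exprS invfM; field; rewrite gt_eqF.
pose P n (x : R * R) := psi x.1 (x.1 + w n) x.2 (x.2 + h n).
have step (nx : nat * (R * R)) : exists x' : R * R,
    [/\ nx.2.1 <= x'.1 <= nx.2.1 + w nx.1.+1, nx.2.2 <= x'.2 <= nx.2.2 + h nx.1.+1 &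
     cmod (P nx.1 nx.2) <= 4 * cmod (P nx.1.+1 x')].
  case: nx => n [x y] /=; have wn := w0 n.+1; have hn := h0 n.+1.
  have := cmodD (P n.+1 (x, y) + P n.+1 (x, y + h n.+1))
    (P n.+1 (x + w n.+1, y) + P n.+1 (x + w n.+1, y + h n.+1)).
  have -> : P n.+1 (x, y) + P n.+1 (x, y + h n.+1) +
    (P n.+1 (x + w n.+1, y) + P n.+1 (x + w n.+1, y + h n.+1)) = P n (x, y).
    rewrite /P /= (wS n) (hS n) !addrA (addu x (x + w n.+1) (x + w n.+1 + w n.+1)); [|lra|lra].
    rewrite (addy x (x + w n.+1) y (y + h n.+1) (y + h n.+1 + h n.+1)); [|lra|lra].
    by rewrite (addy (x + w n.+1) _ y (y + h n.+1) (y + h n.+1 + h n.+1)); [rewrite !addrA|lra|lra].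
  have := cmodD (P n.+1 (x, y)) (P n.+1 (x, y + h n.+1)).
  have := cmodD (P n.+1 (x + w n.+1, y)) (P n.+1 (x + w n.+1, y + h n.+1)).
  set A := cmod (P n _); set A1 := cmod (P n.+1 _); set A2 := cmod (P n.+1 (_, y + _));
  set A3 := cmod (P n.+1 (_, y)); set A4 := cmod (P n.+1 (_, y + _)) => i1 i2 i3.
  have [k1|k1] := leP A (4 * A3).
    by exists (x, y); split => //=; lra.
  have [k2|k2] := leP A (4 * A2).
    by exists (x, y + h n.+1); split => //=; lra.
  have [k3|k3] := leP A (4 * A1).
    by exists (x + w n.+1, y); split => //=; lra.
  have [k4|k4] := leP A (4 * A4).
    by exists (x + w n.+1, y + h n.+1); split => //=; lra.
  by lra.
have [f fP] := choice step.
pose s := fix s n := if n is m.+1 then f (m, s m) else (a, c).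
have s1 n : (s n).1 <= (s n.+1).1 /\ (s n.+1).1 + w n.+1 <= (s n).1 + w n.
  by have [/= /andP[? ?] _ _] := fP (n, s n); split => //=; rewrite (wS n) addrA lerD2r.
have s2 n : (s n).2 <= (s n.+1).2 /\ (s n.+1).2 + h n.+1 <= (s n).2 + h n.
  by have [/= _ /andP[? ?] _] := fP (n, s n); split => //=; rewrite (hS n) addrA lerD2r.
have s3 n : cmod (psi a b c d) <= 4 ^+ n * cmod (P n (s n)).
  elim: n => [|n IH].
    by rewrite mul1r /P /= /w /h !expr0 !divr1 /W /H !subrKC.
  rewrite (le_trans IH)// exprSr -mulrA ler_wpM2l ?exprn_ge0//.
  by have [_ _] := fP (n, s n).
(* Nested intervals: every right end bounds all left ends, so the supremum of the left ends lies in
   each interval. *)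
have nest (x : R^nat) (v : R^nat) : (forall n, 0 <= v n) ->
    (forall n, x n <= x n.+1 /\ x n.+1 + v n.+1 <= x n + v n) ->
    exists p, forall n, x n <= p <= x n + v n.
  move=> v0 xv.
  have xm m k : x m <= x (m + k)%N.
    by elim: k => [|k IH]; rewrite ?addn0// addnS (le_trans IH)//; have [] := xv (m + k)%N.
  have vm m k : x (m + k)%N + v (m + k)%N <= x m + v m.
    by elim: k => [|k IH]; rewrite ?addn0// addnS (le_trans _ IH)//; have [] := xv (m + k)%N.
  have ub m : ubound (range x) (x m + v m).
    move=> _ [n _ <-].
    have [mn|nm] := leqP m n.
      by rewrite -(subnKC mn) (le_trans _ (vm m (n - m)%N))// lerDl.
    by rewrite -(subnKC (ltnW nm)) (le_trans (xm n (m - n)%N))// lerDl.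
  exists (sup (range x)) => n; apply/andP; split.
    by apply: ub_le_sup; [exists (x 0%N + v 0%N); exact: ub|exists n].
  by apply: ge_sup; [exists (x 0%N); exists 0%N|exact: ub].
have [p pP] := nest _ _ w0 s1; have [q qP] := nest _ _ h0 s2.
suff sm (e : R) : 0 < e -> cmod (psi a b c d) <= e * (W + H) ^+ 2.
  apply/eqP; rewrite -cmod_eq0 eq_le cmod_ge0 andbT.
  apply/ler_addgt0Pr => /= e e0; rewrite add0r.
  have k0 : 0 < (W + H) ^+ 2 + 1 by rewrite ltr_wpDl// sqr_ge0.
  rewrite (le_trans (sm (e / ((W + H) ^+ 2 + 1)) _)) ?divr_gt0//.
  by rewrite mulrAC ler_pdivrMr// ler_pM2l// lerDl.
move=> e0; have [dl dl0 Hd] := loc p q e e0.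
have [n nP] : exists n, W + H < dl * 2 ^+ n.
  exists (Num.bound ((W + H) / dl)); rewrite mulrC -ltr_pdivrMr//.
  have := archi_boundP (divr_ge0 (addr_ge0 W0 H0) (ltW dl0)); move/lt_le_trans; apply.
  by rewrite -natrX ler_nat ltnW// ltn_expl.
have wh k : w k + h k = (W + H) / 2 ^+ k by rewrite /w /h [RHS]mulrDl.
have whn : w n + h n < dl by rewrite wh ltr_pdivrMr.
rewrite (le_trans (s3 n))//.
have := Hd (s n).1 ((s n).1 + w n) (s n).2 ((s n).2 + h n) (pP n) (qP n).
rewrite ![_ + _ - _]addrAC !subrr !add0r => hh.
have /hh{}hh : w n < dl by rewrite (le_lt_trans _ whn)// lerDl.
have /hh{}hh : h n < dl by rewrite (le_lt_trans _ whn)// lerDr.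
(* The factor 4^n lost in [s3] is compensated by the square of the side lengths, which have shrunk
   by 2^n. *)
rewrite (le_trans (ler_wpM2l _ hh)) ?exprn_ge0//.
rewrite wh expr_div_n -exprM mulnC exprM (_ : 2 ^+ 2 = 4 :> R); last by ring.
by rewrite mulrCA [4 ^+ n * _]mulrC divfK// expf_neq0.
Qed.

(** Complex differentiability at [z] with derivative [D], as an inequality free of quotients: the
    form in which Goursat's local estimate uses it. *)
Definition cdiff (F : R[i] -> R[i]) (z D : R[i]) := forall e : R, 0 < e ->
  exists2 d : R, 0 < d & forall w, cmod (w - z) < d ->
    cmod (F w - F z - D * (w - z)) <= e * cmod (w - z).

Lemma cdiff_cont F z D : cdiff F z D -> forall e : R, 0 < e ->
  exists2 d : R, 0 < d & forall w, cmod (w - z) < d -> cmod (F w - F z) < e.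
Proof.
move=> dF e e0; have [d d0 Hd] := dF 1 ltr01.
have k0 : 0 < 1 + cmod D by rewrite ltr_pwDl// cmod_ge0.
exists (Num.min d (e / (1 + cmod D))); first by rewrite lt_min d0 divr_gt0.
move=> w; rewrite lt_min => /andP[/Hd{}Hd h].
have -> : F w - F z = (F w - F z - D * (w - z)) + D * (w - z) by ring.
rewrite (le_lt_trans (cmodD _ _))// cmodM (le_lt_trans (lerD Hd (lexx _)))//.
by rewrite -mulrDl mulrC -ltr_pdivlMr.
Qed.

Section Homotopy.
Variables (F : R[i] -> R[i]) (phi phiu phiy : R -> R -> R[i]) (L : R).
Hypothesis L0 : 0 < L.
Hypothesis Fdiff : forall u y, exists D, cdiff F (phi u y) D.
Hypothesis phi_lip : forall u y u' y',
  cmod (phi u' y' - phi u y) <= L * (`|u' - u| + `|y' - y|).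
Hypothesis dphiu : forall y, cderiv (phi ^~ y) (phiu ^~ y).
Hypothesis dphiy : forall u, cderiv (phi u) (phiy u).
Hypothesis cphiu : forall y, ccont (phiu ^~ y).
Hypothesis cphiy : forall u, ccont (phiy u).
Hypothesis phiu_le : forall u y, cmod (phiu u y) <= L.
Hypothesis phiy_le : forall u y, cmod (phiy u y) <= L.

Let bdry (G : R[i] -> R[i]) u u' y y' : R[i] :=
  cint (fun t => G (phi t y) * phiu t y) u u' + cint (fun t => G (phi u' t) * phiy u' t) y y'
  - cint (fun t => G (phi t y') * phiu t y') u u' - cint (fun t => G (phi u t) * phiy u t) y y'.

Let cphi_u y : ccont (phi ^~ y).
Proof.
apply/ccontP => x e e0; exists (e / L); first by rewrite divr_gt0.
move=> t xt; rewrite (le_lt_trans (phi_lip _ _ _ _))// subrr normr0 addr0.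
by rewrite mulrC -ltr_pdivlMr.
Qed.

Let cphi_y u : ccont (phi u).
Proof.
apply/ccontP => x e e0; exists (e / L); first by rewrite divr_gt0.
move=> t xt; rewrite (le_lt_trans (phi_lip _ _ _ _))// subrr normr0 add0r.
by rewrite mulrC -ltr_pdivlMr.
Qed.

Let cF_u y : ccont (fun t => F (phi t y)).
Proof.
apply/ccontP => x e e0; have [D /cdiff_cont /(_ e e0) [d d0 Hd]] := Fdiff x y.
have /ccontP/(_ x d d0)[d' d'0 Hd'] := cphi_u y.
by exists d' => // t /Hd' /Hd.
Qed.

Let cF_y u : ccont (fun t => F (phi u t)).
Proof.
apply/ccontP => x e e0; have [D /cdiff_cont /(_ e e0) [d d0 Hd]] := Fdiff u x.
have /ccontP/(_ x d d0)[d' d'0 Hd'] := cphi_y u.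
by exists d' => // t /Hd' /Hd.
Qed.

Let bdry_affine A D z u u' y y' : u <= u' -> y <= y' ->
  bdry (fun w => A + D * (w - z)) u u' y y' = 0.
Proof.
(* [G] is a primitive of the affine map, so the four integrals are differences of values of [G] at
   the corners and cancel. *)
move=> uu yy; pose G w := A * w + D / 2 * ((w - z) * (w - z)).
have dG f f' : cderiv f f' -> cderiv (fun t => G (f t)) (fun t => (A + D * (f t - z)) * f' t).
  move=> df; have dfz := cderivD df (cderiv_cst (- z)).
  have := cderivD (cderivM (cderiv_cst A) df)
    (cderivM (cderiv_cst (D / 2)) (cderivM dfz dfz)).
  congr cderiv; by apply/funext => t; field.
have cc f : ccont f -> ccont (fun t => A + D * (f t - z)).
  by move=> cf; exact: (ccontD (ccont_cst _) (ccontM (ccont_cst _) (ccontB cf (ccont_cst _)))).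
rewrite /bdry !(cint_FTC _ _ (dG _ _ (dphiu _)))// ?(cint_FTC _ _ (dG _ _ (dphiy _)))//;
  do ?[apply: ccontM => //; exact: cc].
by ring.
Qed.

(** The integral of F dz over the image of a rectangle's boundary is additive in the rectangle. Near
    a point, F is affine up to o(|w - z|), and the affine part has a primitive; what remains is
    o(diameter) times the perimeter, as [rect_additive_zero] requires. *)
Lemma homotopy_square a b c d : a <= b -> c <= d ->
  cint (fun t => F (phi t c) * phiu t c) a b + cint (fun t => F (phi b t) * phiy b t) c d
  - cint (fun t => F (phi t d) * phiu t d) a b - cint (fun t => F (phi a t) * phiy a t) c d = 0.
Proof.
move=> ab cd; have cu y : ccont (fun t => F (phi t y) * phiu t y) by exact: ccontM.
have cy u : ccont (fun t => F (phi u t) * phiy u t) by exact: ccontM.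
apply: (@rect_additive_zero (bdry F)) => //.
- move=> u v w y y' uvw yy; rewrite /bdry (cint_split (cu y) uvw) (cint_split (cu y') uvw).
  by ring.
- move=> u u' x y z uu xyz; rewrite /bdry (cint_split (cy u) xyz) (cint_split (cy u') xyz).
  by ring.
move=> p q e e0; set z := phi p q; have [D HD] := Fdiff p q.
(* Writing e' for this constant, a side contributes at most 2 * (e' * L * s) * L times its length,
   and the four lengths add up to 2 * s; the 4 makes the total e * s^2. *)
have e'0 : 0 < e / (4 * L ^+ 2) by rewrite divr_gt0// mulr_gt0// exprn_gt0.
have [dl dl0 Hdl] := HD _ e'0; exists (dl / (2 * L)); first by rewrite divr_gt0// mulr_gt0.
move=> u u' y y' /andP[up pu'] /andP[yq qy'] du dy.
have uu : u <= u' by exact: le_trans pu'.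
have yy : y <= y' by exact: le_trans qy'.
pose P w := F z + D * (w - z).
have cc f : ccont f -> ccont (fun t => P (f t)).
  by move=> cf; exact: (ccontD (ccont_cst _) (ccontM (ccont_cst _) (ccontB cf (ccont_cst _)))).
pose s := (u' - u) + (y' - y).
have s0 : 0 <= s by rewrite addr_ge0// subr_ge0.
have small t x : u <= t <= u' -> y <= x <= y' -> cmod (F (phi t x) - P (phi t x)) <= e / (4 * L ^+ 2) * (L * s).
  move=> /andP[ut tu] /andP[yx xy].
  have hz : cmod (phi t x - z) <= L * s.
    rewrite (le_trans (phi_lip _ _ _ _))// ler_pM2l// lerD// ler_norml; apply/andP; split; lra.
  have : cmod (phi t x - z) < dl.
    rewrite (le_lt_trans hz)// mulrC -ltr_pdivlMr// (lt_le_trans (ltrD du dy))//.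
    by rewrite -mulrDr ?mulr2n; rewrite le_eqVlt; apply/orP; left; apply/eqP; field; rewrite gt_eqF.
  move=> /Hdl; rewrite /P opprD addrA => /le_trans -> //.
  by rewrite ler_wpM2l// ltW.
have est f g x x' : x <= x' -> ccont (fun t => F (f t)) -> ccont f -> ccont g ->
    (forall t, cmod (g t) <= L) ->
    (forall t, x <= t <= x' -> cmod (F (f t) - P (f t)) <= e / (4 * L ^+ 2) * (L * s)) ->
    exists2 E, cint (fun t => F (f t) * g t) x x' = cint (fun t => P (f t) * g t) x x' + E
      & cmod E <= e / 2 * s * (x' - x).
  move=> xx cF cf cg gL sm.
  exists (cint (fun t => (F (f t) - P (f t)) * g t) x x').
    rewrite -cintD; [|by apply: ccontM => //; exact: cc|by apply: ccontM => //; apply: ccontB => //; exact: cc].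
    by apply: eq_cint => t _; ring.
  have := @cint_bound _ (e / (4 * L ^+ 2) * (L * s) * L) (fun t => (F (f t) - P (f t)) * g t) x x' xx.
  move=> /(_ _ _)/le_trans; apply.
  - by apply: ccontM => //; apply: ccontB => //; exact: cc.
  - by move=> t xt; rewrite cmodM ler_pM ?cmod_ge0//; exact: sm.
  rewrite le_eqVlt; apply/orP; left; apply/eqP; field; rewrite gt_eqF//.
have [|||||E1 e1 b1] := est (phi ^~ y) (phiu ^~ y) u u' uu => //.
  by move=> t ut; apply: small => //; rewrite lexx.
have [|||||E2 e2 b2] := est (phi u') (phiy u') y y' yy => //.
  by move=> t ut; apply: small => //; rewrite lexx andbT.
have [|||||E3 e3 b3] := est (phi ^~ y') (phiu ^~ y') u u' uu => //.
  by move=> t ut; apply: small => //; rewrite lexx andbT.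
have [|||||E4 e4 b4] := est (phi u) (phiy u) y y' yy => //.
  by move=> t ut; apply: small => //; rewrite lexx.
rewrite /bdry e1 e2 e3 e4.
have := bdry_affine (F z) D z uu yy; rewrite /bdry -!/(P _) => bP.
have -> : forall a1 a2 a3 a4 : R[i], a1 + E1 + (a2 + E2) - (a3 + E3) - (a4 + E4) =
  (a1 + a2 - a3 - a4) + (E1 + E2 - E3 - E4) by move=> *; ring.
rewrite bP add0r.
rewrite (le_trans (cmodBD _ _))// (le_trans (lerD (cmodBD _ _) (lexx _)))//.
rewrite (le_trans (lerD (lerD (cmodD _ _) (lexx _)) (lexx _)))//.
rewrite (le_trans (lerD (lerD (lerD b1 b2) b3) b4))// le_eqVlt; apply/orP; left; apply/eqP.
by rewrite /s; field.
Qed.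

End Homotopy.

End Goursat.

(** * Contraction of circles and the Cauchy kernel *)

Section Cauchy.
Variable R : realType.
Implicit Types (f : R[i] -> R[i]) (z w : R[i]) (r t : R).

Lemma holomorphic_cdiff f z : holomorphic_on (disk R) f -> disk R z ->
  exists D, cdiff f z D.
Proof.
move=> hf /hf; rewrite /derivable => /cvg_ex[D /= hD]; exists D => e e0.
have e0' : 0 < e%:C by rewrite ltcR.
have /cvgrPdist_le/(_ _ e0') := hD.
rewrite /dnbhs /within /=; case/nbhs_ballP => d /= d0 Hd.
(* The radius of a ball in [R[i]] is itself a complex number; being positive, it is real. *)
have dE : d = (complex.Re d)%:C by move: d0; rewrite ltcE => /andP[/eqP]; case: (d) => a b /= ->.
exists (complex.Re d); first by rewrite -ltcR -dE.
move=> w wz; have [->|wz0] := eqVneq w z.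
  by rewrite !subrr mulr0 subrr cmod0 mulr0.
have wz1 : w - z != 0 by rewrite subr_eq0.
have := Hd (w - z); rewrite /ball /= sub0r normrN -cmodC dE ltcR => /(_ wz wz1).
rewrite /GRing.scale /= mulr1 subrK => h.
rewrite -lecR rmorphM /= !cmodC.
have -> : f w - f z - D * (w - z) = - ((D - (w - z)^-1 * (f w - f z)) * (w - z)) by field.
by rewrite normrN normrM ler_wpM2r.
Qed.

Lemma real_lip (f df : R -> R) : (forall x : R, is_derive x 1 f (df x)) ->
  (forall x, `|df x| <= 1) -> forall x y, `|f x - f y| <= `|x - y|.
Proof.
move=> fdf dfle x y; wlog xy : x y / y <= x.
  by move=> H; have [/H//|/ltW/H] := leP y x; rewrite distrC => /le_trans; apply; rewrite distrC.
have cf : {within `[y, x], continuous f}.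
  apply: continuous_subspaceT => u; have [? _] := fdf u.
  by apply: differentiable_continuous; exact/derivable1_diffP.
have [c _ ->] := MVT_segment xy (fun u _ => fdf u) cf.
by rewrite normrM ler_piMl.
Qed.

Lemma cos_lip (x y : R) : `|cos x - cos y| <= `|x - y|.
Proof.
apply: (real_lip (@is_derive_cos R)) => u; rewrite normrN; exact: sin_max.
Qed.

Lemma sin_lip (x y : R) : `|sin x - sin y| <= `|x - y|.
Proof. apply: (real_lip (@is_derive_sin R)) => u; exact: cos_max. Qed.

Lemma cis_lip (x y : R) : cmod (cis x - cis y) <= 2 * `|x - y|.
Proof.
rewrite (le_trans (cmod_le_ReIm _))// mulr_natl mulr2n.
by apply: lerD; rewrite /= ?cos_lip ?sin_lip.
Qed.

Lemma cmod_i : cmod ('i : R[i]) = 1.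
Proof. by rewrite cmodE /= expr0n expr1n add0r sqrtr1. Qed.

(* The circle is contracted towards [z] along [z + l (c(t) - z)], with
[l = (1 + lam) / 2 + (1 - lam) / 2 * cos u] so that the homotopy is smooth and
globally Lipschitz in [u]. *)
Lemma circle_shrink F z r lam : cmod z < r -> r < 1 -> 0 < lam <= 1 ->
  (forall w, disk R w -> w != z -> exists D, cdiff F w D) ->
  cint (fun t => F (r%:C * cis t) * (r%:C * cis t)) 0 (2 * pi) =
  cint (fun t => F (z + lam%:C * (r%:C * cis t - z)) * (lam%:C * (r%:C * cis t))) 0 (2 * pi).
Proof.
move=> zr r1 /andP[lam0 lam1] dF.
have r0 : 0 < r by rewrite (le_lt_trans _ zr)// cmod_ge0.
have pi0 := pi_ge0 R.
pose l u := (1 + lam) / 2 + (1 - lam) / 2 * cos u.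
have l_lam u : lam <= l u.
  have : (1 - lam) / 2 * - 1 <= (1 - lam) / 2 * cos u.
    by rewrite ler_wpM2l ?cos_geN1// divr_ge0// subr_ge0.
  rewrite /l; lra.
have l_1 u : l u <= 1.
  have : (1 - lam) / 2 * cos u <= (1 - lam) / 2 * 1.
    by rewrite ler_wpM2l ?cos_le1// divr_ge0// subr_ge0.
  rewrite /l; lra.
have l_gt0 u : 0 < l u := lt_le_trans lam0 (l_lam u).
have l_lip u u' : `|l u' - l u| <= `|u' - u|.
  rewrite /l opprD addrACA subrr add0r -mulrBr normrM.
  rewrite -[leRHS]mul1r ler_pM// ?cos_lip// ger0_norm; lra.
pose c t := r%:C * cis t.
have cc t : cmod (c t) = r by rewrite cmodM cmod_cis cmod_real mulr1 ger0_norm// ltW.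
have cz t : c t - z != 0.
  by rewrite subr_eq0; apply/eqP => h; move: zr; rewrite -h cc ltxx.
have cz2 t : cmod (c t - z) <= 2.
  by rewrite (le_trans (cmodBD _ _))// cc mulr2n; apply: lerD; lra.
pose phi u y := z + (l u)%:C * (c y - z).
pose phiu u y := (- ((1 - lam) / 2) * sin u)%:C * (c y - z).
pose phiy u y := (l u)%:C * ('i * c y).
have dl (u : R) : is_derive u 1 l (- ((1 - lam) / 2) * sin u).
  by apply: is_derive_eq; rewrite /GRing.scale /=; ring.
have dlc : cderiv (fun u => (l u)%:C) (fun u => (- ((1 - lam) / 2) * sin u)%:C).
  by move=> u; split => //; exact: is_derive_cst.
have dc : cderiv c (fun t => 'i * c t).
  have := cderivM (cderiv_cst r%:C) (cderiv_cis (1 : R)).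
  rewrite /c (_ : (fun t => r%:C * cis (1 * t)) = (fun t => r%:C * cis t)); last first.
    by apply/funext => t; rewrite mul1r.
  by congr cderiv; apply/funext => t; rewrite mul1r; ring.
have cl : ccont (fun t => c t) by apply: ccontM; [exact: ccont_cst|exact: ccont_cis1].
have inD u t : disk R (z + (l u)%:C * (c t - z)) /\ z + (l u)%:C * (c t - z) != z.
  split; last first.
    rewrite -subr_eq0 addrAC subrr add0r mulf_neq0//.
    by rewrite -cmod_gt0 cmod_real normr_gt0 gt_eqF.
  have -> : z + (l u)%:C * (c t - z) = (1 - l u)%:C * z + (l u)%:C * c t.
    by rewrite rmorphB /=; ring.
  rewrite /disk /= (le_lt_trans (cmodD _ _))// (cmodM _ z) (cmodM _ (c t)) !cmod_real cc.
  rewrite !ger0_norm ?subr_ge0 ?(ltW (l_gt0 _))//.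
  have h1 := l_gt0 u; have h2 := l_1 u.
  apply: (@le_lt_trans _ _ ((1 - l u) * r + l u * r)); last by rewrite -mulrDl subrK mul1r.
  by rewrite lerD2r ler_wpM2l ?subr_ge0// ltW.
(* The sides y = 0 and y = 2 pi have the same image because [c] is periodic, so they cancel. What
   remains is the circle u = 0, where l = 1, and the circle u = pi, where l = lam. *)
have := @homotopy_square _ F phi phiu phiy 2 _ _ _ _ _ _ _ _ _ 0 pi 0 (2 * pi).
rewrite /phi /phiu /phiy.
have -> : c (2 * pi) = c 0 by rewrite /c cis2pi cis0.
have l0 : l 0 = 1 by rewrite /l cos0; field.
have lpi : l pi = lam by rewrite /l cospi; field.
rewrite l0 lpi.
set X := cint _ 0 pi; set Y := cint _ 0 (2 * pi); set Z := cint _ 0 (2 * pi).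
move=> H; have {H} : X + Y - X - Z = 0.
  apply: H => //; last by rewrite mulr_ge0.
  - by move=> u y; have [? ?] := inD u y; exact: dF.
  - move=> u y u' y'.
    have -> : phi u' y' - phi u y = (l u' - l u)%:C * (c y' - z) + (l u)%:C * (r%:C * (cis y' - cis y)).
      by rewrite /phi /c rmorphB /=; ring.
    apply: (le_trans (cmodD _ _)); rewrite [leRHS]mulrDr; apply: lerD.
      by rewrite cmodM cmod_real mulrC ler_pM ?cmod_ge0.
    rewrite mulrA cmodM -[leRHS]mul1r ler_pM ?cmod_ge0 ?cis_lip//.
    rewrite cmodM !cmod_real ger0_norm ?(ltW (l_gt0 _))// ger0_norm ?(ltW r0)//.
    by rewrite mulr_ile1 ?l_1 ?(ltW r1) ?(ltW r0)// ltW.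
  - move=> y; have := cderivM dlc (cderiv_cst (c y - z)).
    move/(cderivD (cderiv_cst z)); congr cderiv; apply/funext => t.
    by rewrite /phiu; ring.
  - move=> u; have := cderivM (cderiv_cst (l u)%:C) (cderivD dc (cderiv_cst (- z))).
    move/(cderivD (cderiv_cst z)); congr cderiv; apply/funext => t.
    by rewrite /phiy; ring.
  - move=> y; apply: ccontM (ccont_cst _); apply: ccont_real => x.
    by apply: cvgM; [exact: cvg_cst|exact: continuous_sin].
  - by move=> u; exact: ccontM (ccont_cst _) (ccontM (ccont_cst _) cl).
  - move=> u y; rewrite cmodM cmod_real -[leRHS]mul1r ler_pM ?cmod_ge0// normrM normrN.
    by rewrite -[leRHS]mul1r ler_pM ?sin_max// ger0_norm; lra.
  - move=> u y; rewrite cmodM (cmodM 'i) cmod_real cmod_i cc mul1r ger0_norm ?(ltW (l_gt0 _))//.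
    apply: (@le_trans _ _ 1); last by rewrite ler1n.
    by rewrite mulr_ile1 ?l_1 ?(ltW r1) ?(ltW r0)// ltW.
have -> : X + Y - X - Z = Y - Z by ring.
move/eqP; rewrite subr_eq0 => /eqP; rewrite /Y /Z => {X Y Z}YZ.
have i0 : ('i : R[i]) != 0 by rewrite -cmod_gt0 cmod_i.
(* Along the circles dz carries a factor ['i], which the statement omits. *)
apply: (mulfI i0).
have dcont u : ccont (fun t => F (z + (l u)%:C * (c t - z))).
  apply/ccontP => x e e0.
  have [i1 i2] := inD u x; have [D /cdiff_cont/(_ e e0)[d d0 Hd]] := dF _ i1 i2.
  have ccz : ccont (fun t => z + (l u)%:C * (c t - z)).
    exact: ccontD (ccont_cst _) (ccontM (ccont_cst _) (ccontB cl (ccont_cst _))).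
  by have /ccontP/(_ x d d0)[d' d'0 Hd'] := ccz; exists d' => // t /Hd' /Hd.
have h1 := dcont 0; have h2 := dcont pi; rewrite l0 in h1; rewrite lpi in h2.
rewrite -!cintZ.
- transitivity (cint (fun t => F (z + 1%:C * (c t - z)) * (1%:C * ('i * c t))) 0 (2 * pi)).
    by apply: eq_cint => t _; rewrite !mul1r subrKC /c; ring.
  rewrite -YZ; apply: eq_cint => t _; rewrite /c; ring.
- by apply: ccontM h2 (ccontM (ccont_cst _) cl).
- apply: ccontM cl; move: h1; congr ccont; apply/funext => t.
  by rewrite mul1r subrKC.
Qed.

Lemma cint_cis (k : R) : k != 0 -> cis (k * (2 * pi)) = 1 ->
  cint (fun t => cis (k * t)) 0 (2 * pi) = 0.
Proof.
move=> k0 k1; have i0 : 'i * k%:C != 0 :> R[i].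
  by rewrite -cmod_gt0 cmodM cmod_i mul1r cmod_real normr_gt0.
have := cderivM (cderiv_cst ('i * k%:C)^-1) (cderiv_cis k).
rewrite (_ : (fun t => 0 * _ + _) = fun t => cis (k * t)); last first.
  by apply/funext => t; rewrite mul0r add0r mulKf.
move/cint_FTC => ->; rewrite ?mulr_ge0 ?pi_ge0//; last exact: ccont_cis.
by rewrite k1 mulr0 cis0 subrr.
Qed.

Lemma cint_cis_nat n : cint (fun t => cis t ^+ n) 0 (2 * pi) = (2 * pi)%:C *+ (n == 0%N).
Proof.
case: n => [|n].
  by under eq_fun do rewrite expr0; rewrite cint_cst ?mulr_ge0 ?pi_ge0// subr0 mul1r.
rewrite mulr0n; under eq_fun do rewrite -cisMn.
by rewrite cint_cis ?pnatr_eq0// cisMn cis2pi expr1n.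
Qed.

Lemma cint_cisN_nat n : cint (fun t => cis (- t) ^+ n) 0 (2 * pi) = (2 * pi)%:C *+ (n == 0%N).
Proof.
transitivity (cint (fun t => (cis t ^+ n)^*) 0 (2 * pi)).
  by apply: eq_cint => t _; rewrite rmorphXn /= cis_conj.
rewrite cint_conj; last by apply: ccontX; exact: ccont_cis1.
rewrite cint_cis_nat; case: (n == 0%N); rewrite ?(mulr0n, mulr1n);
by apply/eqP; rewrite eq_complex /= oppr0 !eqxx.
Qed.

Lemma pow_small m (x C q : R) : 0 <= q < 1 -> (forall n, (m < n)%N -> x <= C * q ^+ n) -> x <= 0.
Proof.
move=> /andP[q0 q1] H; have h : C * q ^+ n @[n --> \oo] --> C * 0.
  by apply: cvgM; [exact: cvg_cst|apply: cvg_expr; rewrite ger0_norm].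
rewrite -(mulr0 C) -(cvg_lim _ h)//; apply: limr_ge; first exact: cvgP h.
by near=> n; apply: H; near: n; exact: nbhs_infty_gt.
Unshelve. all: by end_near. Qed.

Lemma cauchy_kernel_cont w : cmod w < 1 -> ccont (fun t => cis t / (cis t - w)).
Proof.
move=> w1; apply: ccontM; first exact: ccont_cis1.
apply: ccontV; last by apply: ccontB; [exact: ccont_cis1|exact: ccont_cst].
by move=> t; rewrite subr_eq0; apply/eqP => h; move: w1; rewrite -h cmod_cis ltxx.
Qed.

Lemma cauchy_kernel_le w t : cmod w < 1 -> cmod (cis t / (cis t - w)) <= (1 - cmod w)^-1.
Proof.
move=> w1; rewrite cmodM cmod_cis mul1r cmodV lef_pV2 ?posrE ?subr_gt0//.
  by rewrite -[leLHS](_ : cmod (cis t) - cmod w = _) ?cmod_sub_le// cmod_cis.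
by rewrite (lt_le_trans _ (cmod_sub_le _ _))// cmod_cis subr_gt0.
Qed.

(** Finite geometric expansion of the Cauchy kernel: after N terms in w / cis t the remainder is
    exactly (w / cis t)^N times the kernel, so no infinite series has to be integrated. *)
Lemma cauchy_geom (h : R -> R[i]) M w N : ccont h -> (forall t, cmod (h t) <= M) -> cmod w < 1 ->
  cmod (cint (fun t => h t * (cis t / (cis t - w))) 0 (2 * pi) -
    \sum_(k < N) w ^+ k * cint (fun t => h t * cis (- t) ^+ k) 0 (2 * pi))
  <= 4 * pi * M / (1 - cmod w) * cmod w ^+ N.
Proof.
move=> ch hM w1; have pi0 : 0 <= 2 * pi :> R by rewrite mulr_ge0 ?pi_ge0.
have cN : ccont (fun t : R => cis (- t)).
  by have := ccont_cis (-1 : R); under eq_fun do rewrite mulN1r.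
have hk k : ccont (fun t => h t * cis (- t) ^+ k) by apply: ccontM => //; exact: ccontX.
rewrite (eq_bigr (fun k : 'I_N => cint (fun t => w ^+ k * (h t * cis (- t) ^+ k)) 0 (2 * pi))); last first.
  by move=> k _; rewrite cintZ.
rewrite -cint_sum//; last by move=> k; exact: ccontM (ccont_cst _) (hk k).
have ck := cauchy_kernel_cont w1.
rewrite -cintB; [|exact: ccontM|by apply: ccont_sum => k; exact: ccontM (ccont_cst _) (hk k)].
rewrite (eq_cint (G := fun t => h t * (w ^+ N * cis (- t) ^+ N * (cis t / (cis t - w))))); last first.
  move=> t _; have tw : cis t - w != 0.
    by rewrite subr_eq0; apply/eqP => e; move: w1; rewrite -e cmod_cis ltxx.
  have ct : cis (- t) * cis t = 1 by rewrite -cisD addNr cis0.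
  elim: N => [|N IH]; first by rewrite big_ord0 subr0 !expr0 !mul1r.
  rewrite big_ord_recr /= opprD addrA IH !exprSr; set a := w ^+ N; set b := cis (- t) ^+ N.
  have -> : h t * (a * w * (b * cis (- t)) * (cis t / (cis t - w))) =
    h t * (a * b * (w * (cis (- t) * cis t) / (cis t - w))) by ring.
  by rewrite ct mulr1; field.
rewrite (le_trans (@cint_bound _ (M * (cmod w ^+ N * (1 - cmod w)^-1)) _ _ _ pi0 _ _))//.
- apply: ccontM ch (ccontM (ccontM (ccont_cst _) _) ck); exact: ccontX.
- move=> t _; rewrite cmodM (cmodM (_ * _)) (cmodM (w ^+ N)) !cmodX cmod_cis expr1n mulr1.
  rewrite ler_pM ?cmod_ge0 ?mulr_ge0 ?exprn_ge0 ?cmod_ge0//.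
  by rewrite ler_wpM2l ?exprn_ge0 ?cmod_ge0// cauchy_kernel_le.
rewrite subr0 le_eqVlt; apply/orP; left; apply/eqP; field.
by rewrite gt_eqF// subr_gt0.
Qed.

(** By orthogonality of the powers of [cis t], only the term k = n of [cauchy_geom] survives once N
    > n, while the remainder tends to 0 with N. *)
Lemma cauchy_cis n w : cmod w < 1 ->
  cint (fun t => cis t ^+ n * (cis t / (cis t - w))) 0 (2 * pi) = (2 * pi)%:C * w ^+ n.
Proof.
move=> w1; apply/eqP; rewrite -subr_eq0 -cmod_eq0 eq_le cmod_ge0 andbT.
apply: (@pow_small n _ (4 * pi * 1 / (1 - cmod w)) (cmod w)); first by rewrite cmod_ge0.
move=> N nN.
  have h (t : R) : cmod (cis t ^+ n) <= 1 by rewrite cmodX cmod_cis expr1n.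
  have := cauchy_geom N (ccontX n (@ccont_cis1 R)) h w1; congr (cmod (_ - _) <= _).
  rewrite (bigD1 (Ordinal nN))//= big1 ?addr0 => [|k kn].
    rewrite mulrC; congr (_ * _).
    transitivity (cint (fun=> (1 : R[i])) (0 : R) (2 * pi)).
      by apply: eq_cint => t _; rewrite -exprMn -cisD subrr cis0 expr1n.
    by rewrite cint_cst ?mulr_ge0 ?pi_ge0// subr0 mul1r.
  rewrite -[RHS](mulr0 (w ^+ k)); congr (_ * _).
  have kn' : (k != n :> nat) by apply: contra kn => /eqP e; apply/eqP/val_inj.
  have [kn2|nk] := ltnP k n.
    transitivity (cint (fun t : R => cis t ^+ (n - k)) 0 (2 * pi)).
      apply: eq_cint => t _; rewrite -{1}(subnK (ltnW kn2)) exprD -mulrA -exprMn -cisD subrr cis0.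
      by rewrite expr1n mulr1.
    by rewrite cint_cis_nat subn_eq0 leqNgt kn2.
  transitivity (cint (fun t : R => cis (- t) ^+ (k - n)) 0 (2 * pi)).
    apply: eq_cint => t _; rewrite -{1}(subnK nk) addnC exprD mulrA -exprMn -cisD subrr cis0.
    by rewrite expr1n mul1r.
  by rewrite cint_cisN_nat subn_eq0 leqNgt ltn_neqAle eq_sym kn' nk.
Qed.

End Cauchy.

(** * Cauchy's integral formula and Taylor expansion at 0 *)

Section Taylor.
Variable R : realType.
Implicit Types (f : R[i] -> R[i]) (z w : R[i]) (r t : R).

Lemma cdiff_cst (c : R[i]) w : cdiff (fun=> c) w 0.
Proof.
move=> e e0; exists 1 => // v _.
by rewrite mul0r subr0 subrr cmod0 mulr_ge0 ?cmod_ge0// ltW.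
Qed.

Lemma cdiffM f g w D D' : cdiff f w D -> cdiff g w D' ->
  cdiff (fun v => f v * g v) w (D * g w + f w * D').
Proof.
move=> df dg e e0.
pose A := cmod (f w) + cmod (g w) + cmod D + 1.
have A0 : 0 < A by rewrite ltr_wpDl// !addr_ge0 ?cmod_ge0.
pose e' := Num.min 1 (e / (3 * A)).
have e'0 : 0 < e' by rewrite lt_min ltr01 divr_gt0// mulr_gt0.
have e'1 : e' <= 1 by rewrite ge_min lexx.
have e'A : e' * A <= e / 3.
  rewrite -ler_pdivlMr// (@le_trans _ _ (e / (3 * A)))//; first by rewrite ge_min lexx orbT.
  by rewrite invfM mulrA.
have [d d0 hd] := df _ e'0; have [d' d'0 hd'] := dg _ e'0.
have [d2 d20 hd2] := cdiff_cont dg e'0.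
exists (Num.min d (Num.min d' d2)); first by rewrite !lt_min d0 d'0 d20.
move=> v; rewrite !lt_min => /and3P[/hd h1 /hd' h2 /hd2 /ltW h3].
have h4 : cmod (f v - f w) <= A * cmod (v - w).
  have -> : f v - f w = (f v - f w - D * (v - w)) + D * (v - w) by ring.
  rewrite (le_trans (cmodD _ _))// cmodM (le_trans (lerD h1 (lexx _)))// -mulrDl.
  rewrite ler_wpM2r ?cmod_ge0// /A.
  have := cmod_ge0 (f w); have := cmod_ge0 (g w); lra.
have -> : f v * g v - f w * g w - (D * g w + f w * D') * (v - w) =
  (f v - f w - D * (v - w)) * g w + f w * (g v - g w - D' * (v - w)) + (f v - f w) * (g v - g w) by ring.
rewrite (le_trans (cmodD _ _))// (le_trans (lerD (cmodD _ _) (lexx _)))// !cmodM.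
have k0 := cmod_ge0 (v - w).
have i1 : cmod (f v - f w - D * (v - w)) * cmod (g w) <= e / 3 * cmod (v - w).
  rewrite (le_trans (ler_wpM2r (cmod_ge0 _) h1))// mulrAC ler_wpM2r// (le_trans _ e'A)//.
  rewrite ler_wpM2l ?ltW// /A; have := cmod_ge0 (f w); have := cmod_ge0 D; lra.
have i2 : cmod (f w) * cmod (g v - g w - D' * (v - w)) <= e / 3 * cmod (v - w).
  rewrite (le_trans (ler_wpM2l (cmod_ge0 _) h2))// mulrA ler_wpM2r// (le_trans _ e'A)// mulrC.
  rewrite ler_wpM2l ?ltW// /A; have := cmod_ge0 (g w); have := cmod_ge0 D; lra.
have i3 : cmod (f v - f w) * cmod (g v - g w) <= e / 3 * cmod (v - w).
  rewrite (le_trans (ler_pM (cmod_ge0 _) (cmod_ge0 _) h4 h3))// mulrAC ler_wpM2r//.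
  by rewrite mulrC.
lra.
Qed.

Lemma cdiffX f w D n : cdiff f w D -> exists D', cdiff (fun v => f v ^+ n) w D'.
Proof.
move=> df; elim: n => [|n [D' IH]]; first by exists 0; exact: cdiff_cst.
exists (D * f w ^+ n + f w * D'); have := cdiffM df IH.
by congr cdiff; apply/funext => v; rewrite exprS.
Qed.

Lemma cdiff_inv z w : w != z -> cdiff (fun v => (v - z)^-1) w (- (w - z) ^- 2).
Proof.
rewrite -subr_eq0 => wz e e0; set a := w - z.
have a0 : 0 < cmod a by rewrite cmod_gt0.
(* The first bound keeps |v - z| >= |a| / 2; the second then makes the remainder (v - w)^2 / (a^2 (v
   - z)) at most e * |v - w|. *)
exists (Num.min (cmod a / 2) (e * cmod a ^+ 3 / 2)).
  by rewrite lt_min !divr_gt0// mulr_gt0// exprn_gt0.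
move=> v; rewrite lt_min => /andP[/ltW h1 /ltW h2].
have va : cmod a / 2 <= cmod (v - z).
  have := cmod_sub_le a (w - v); rewrite (_ : a - (w - v) = v - z) ?(cmodB w v); last by rewrite /a; ring.
  lra.
have vz0 : 0 < cmod (v - z) by rewrite (lt_le_trans _ va)// divr_gt0.
have vz : v - z != 0 by rewrite -cmod_gt0.
have -> : (v - z)^-1 - a^-1 - - a ^- 2 * (v - w) = (v - w) * ((v - w) / (a ^+ 2 * (v - z))).
  have -> : v - w = (v - z) - a by rewrite /a; ring.
  by field; rewrite vz.
rewrite cmodM mulrC ler_wpM2r ?cmod_ge0// cmodM cmodV cmodM cmodX.
rewrite ler_pdivrMr ?mulr_gt0 ?exprn_gt0// (le_trans h2)// -!mulrA ler_pM2l//.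
by rewrite !ler_pM2l.
Qed.

Section Holomorphic.
Variable f : R[i] -> R[i].
Hypothesis hf : holomorphic_on (disk R) f.

Lemma disk_circle r t : 0 <= r -> r < 1 -> disk R (r%:C * cis t).
Proof. by move=> r0 r1; rewrite /disk /= cmodM cmod_cis cmod_real ger0_norm ?mulr1. Qed.

Lemma ccont_holo (g : R -> R[i]) : ccont g -> (forall t, disk R (g t)) -> ccont (fun t => f (g t)).
Proof.
move=> cg gD; apply/ccontP => x e e0.
have [D /cdiff_cont/(_ e e0)[d d0 Hd]] := holomorphic_cdiff hf (gD x).
by have /ccontP/(_ x d d0)[d' d'0 Hd'] := cg; exists d' => // t /Hd' /Hd.
Qed.

Lemma ccont_circle r : 0 <= r -> r < 1 -> ccont (fun t => f (r%:C * cis t)).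
Proof.
move=> r0 r1; apply: ccont_holo; last by move=> t; exact: disk_circle.
by apply: ccontM; [exact: ccont_cst|exact: ccont_cis1].
Qed.

Lemma circle_bounded r : 0 <= r -> r < 1 -> exists M, forall t, cmod (f (r%:C * cis t)) <= M.
Proof.
move=> r0 r1.
have pi0 : 0 <= 2 * pi :> R by rewrite mulr_ge0 ?pi_ge0.
have [c _ Hc] := EVT_max pi0 (continuous_subspaceT (A := `[0, 2 * pi]) (ccont_cmod (ccont_circle r0 r1))).
exists (cmod (f (r%:C * cis c))) => t.
by have [s s2 ->] := polar (cis t); rewrite cmod_cis mul1r Hc// in_itv.
Qed.

(** The form dv / (v - z) is invariant under the contraction towards [z], so [circle_shrink] changes
    only the argument of [f]. That argument tends to [z] with lam, and continuity of [f] at [z]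
    finishes. *)
Lemma cauchy_formula z r : cmod z < r -> r < 1 ->
  cint (fun t => f (r%:C * cis t) * (cis t / (cis t - z / r%:C))) 0 (2 * pi) = (2 * pi)%:C * f z.
Proof.
move=> zr r1; have r0 : 0 < r by rewrite (le_lt_trans _ zr)// cmod_ge0.
have rC : r%:C != 0 by rewrite -cmod_gt0 cmod_real normr_gt0 gt_eqF.
have pi0 : 0 <= 2 * pi :> R by rewrite mulr_ge0 ?pi_ge0.
pose w := z / r%:C.
have w1 : cmod w < 1.
  by rewrite cmodM cmodV cmod_real ger0_norm ?(ltW r0)// ltr_pdivrMr// mul1r.
have zw : z = r%:C * w by rewrite mulrC divfK.
have zD : disk R z by exact: lt_trans r1.
have tw t : cis t - w != 0.
  by rewrite subr_eq0; apply/eqP => e; move: w1; rewrite -e cmod_cis ltxx.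
have shr lam : 0 < lam <= 1 ->
    cint (fun t => f (r%:C * cis t) * (cis t / (cis t - w))) 0 (2 * pi) =
    cint (fun t => f (z + lam%:C * (r%:C * cis t - z)) * (cis t / (cis t - w))) 0 (2 * pi).
  move=> lam1; have [lam0 _] := andP lam1.
  have lC : lam%:C != 0 by rewrite -cmod_gt0 cmod_real normr_gt0 gt_eqF.
  have := @circle_shrink _ (fun v => f v * (v - z)^-1) z r lam zr r1 lam1.
  have dF v : disk R v -> v != z -> exists D, cdiff (fun v => f v * (v - z)^-1) v D.
    move=> /(holomorphic_cdiff hf)[D dD] /cdiff_inv vz.
    by eexists; exact: cdiffM dD vz.
  move=> /(_ dF); congr (_ = _); apply: eq_cint => t _; rewrite -!mulrA; congr (f _ * _).
    by rewrite zw -mulrBr invfM mulrACA mulVf// mul1r mulrC.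
  rewrite (_ : z + _ - z = (lam%:C * r%:C) * (cis t - w)); last by rewrite zw; ring.
  by rewrite (mulrA lam%:C) invfM mulrACA mulVf ?mulf_neq0// mul1r mulrC.
apply/eqP; rewrite -subr_eq0 -cmod_eq0 eq_le cmod_ge0 andbT.
apply/ler_addgt0Pr => e e0; rewrite add0r.
have [D /cdiff_cont] := holomorphic_cdiff hf zD.
(* Chosen against the kernel bound 1 / (1 - |w|), the length 2 * pi and the factor 2 of
   [cint_bound]. *)
have e'0 : 0 < e * (1 - cmod w) / (4 * pi).
  by rewrite divr_gt0 ?mulr_gt0 ?subr_gt0 ?pi_gt0.
move=> /(_ _ e'0)[d d0 Hd].
pose lam := Num.min 1 (d / 4).
have lam0 : 0 < lam by rewrite lt_min ltr01 divr_gt0.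
have lam1 : lam <= 1 by rewrite ge_min lexx.
have lamd : lam <= d / 4 by rewrite ge_min lexx orbT.
have inD t : disk R (z + lam%:C * (r%:C * cis t - z)).
  have -> : z + lam%:C * (r%:C * cis t - z) = (1 - lam)%:C * z + lam%:C * (r%:C * cis t).
    by rewrite rmorphB /=; ring.
  rewrite /disk /= (le_lt_trans (cmodD _ _))// !cmodM !cmod_real cmod_cis mulr1.
  rewrite !ger0_norm ?subr_ge0 ?lam1 ?(ltW lam0) ?(ltW r0)//.
  apply: (@le_lt_trans _ _ ((1 - lam) * r + lam * r)); last by rewrite -mulrDl subrK mul1r.
  by rewrite lerD2r ler_wpM2l ?subr_ge0// ltW.
rewrite -/w.
have ck := cauchy_kernel_cont w1.
rewrite (shr lam) ?lam0//.
have := cauchy_cis 0 w1; rewrite expr0 mulr1 => <-.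
under [X in _ - X * _]eq_cint do rewrite expr0 mul1r.
have cfz : ccont (fun t => f (z + lam%:C * (r%:C * cis t - z))).
  apply: ccont_holo => //.
  exact: ccontD (ccont_cst _) (ccontM (ccont_cst _) (ccontB (ccontM (ccont_cst _) (@ccont_cis1 R)) (ccont_cst _))).
rewrite [_ * f z]mulrC -cintZ// -cintB; [|exact: ccontM|exact: ccontM (ccont_cst _) ck].
rewrite (le_trans (@cint_bound _ (e * (1 - cmod w) / (4 * pi) * (1 - cmod w)^-1) _ _ _ pi0 _ _))//.
- apply: ccontB; [exact: ccontM|exact: ccontM (ccont_cst _) ck].
- move=> t _; rewrite -mulrBl cmodM ler_pM ?cmod_ge0 ?cauchy_kernel_le// ltW// Hd//.
  rewrite addrAC subrr add0r cmodM cmod_real gtr0_norm//.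
  rewrite (@le_lt_trans _ _ (d / 4 * 2)) ?ler_pM ?cmod_ge0 ?(ltW lam0)//; last lra.
  rewrite (le_trans (cmodBD _ _))// cmodM cmod_cis cmod_real gtr0_norm//; lra.
have : 1 - cmod w != 0 by rewrite gt_eqF// subr_gt0.
have : pi != 0 :> R by rewrite gt_eqF// pi_gt0.
move: (cmod w) (@pi R) => q x x0 q0.
by rewrite le_eqVlt; apply/orP; left; apply/eqP; field; rewrite x0 q0.
Qed.

(** The Taylor coefficient at 0, read off as a Fourier coefficient on the circle of radius [r];
    higher derivatives of [f] are never formed. *)
Definition tcoef r n : R[i] :=
  ((2 * pi)^-1 / r ^+ n)%:C * cint (fun t => f (r%:C * cis t) * cis (- t) ^+ n) 0 (2 * pi).

(** [circle_shrink] with centre 0, applied to f(v) / v^(n+1), which is differentiable off the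
    centre. *)
Lemma tcoef_shrink r r' n : 0 < r' -> r' <= r -> r < 1 -> tcoef r n = tcoef r' n.
Proof.
move=> r'0 r'r r1; have r0 : 0 < r by exact: lt_le_trans r'r.
have rC : r%:C != 0 by rewrite -cmod_gt0 cmod_real normr_gt0 gt_eqF.
have rC' : r'%:C != 0 by rewrite -cmod_gt0 cmod_real normr_gt0 gt_eqF.
have cN : ccont (fun t : R => cis (- t)).
  by have := ccont_cis (-1 : R); under eq_fun do rewrite mulN1r.
have cc s : 0 < s -> s < 1 -> ccont (fun t => f (s%:C * cis t) * cis (- t) ^+ n).
  by move=> s0 s1; apply: ccontM (ccontX _ cN); apply: ccont_circle => //; exact: ltW.
have lam1 : 0 < r' / r <= 1 by rewrite divr_gt0//= ler_pdivrMr// mul1r.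
have := @circle_shrink _ (fun v => f v * (v - 0)^-1 ^+ n.+1) 0 r (r' / r).
rewrite cmod0 => /(_ r0 r1 lam1) H.
rewrite /tcoef !rmorphM /= -!mulrA; congr (_ * _).
rewrite -!cintZ; try (apply: cc => //; exact: le_lt_trans r1).
have {H} : cint (fun t => f (r%:C * cis t) * ((r%:C * cis t) - 0)^-1 ^+ n.+1 * (r%:C * cis t)) 0 (2 * pi) =
    cint (fun t => f (0 + (r' / r)%:C * (r%:C * cis t - 0)) *
      ((0 + (r' / r)%:C * (r%:C * cis t - 0)) - 0)^-1 ^+ n.+1 * ((r' / r)%:C * (r%:C * cis t))) 0 (2 * pi).
  apply: H => v /(holomorphic_cdiff hf)[D dD] /cdiff_inv v0.
  by have [D' dD'] := cdiffX n.+1 v0; eexists; exact: cdiffM dD dD'.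
have ct t : cis t != 0 by exact: cis_neq0.
congr (_ = _); apply: eq_cint => t _.
  rewrite subr0 cisN exprSr -!mulrA mulVf ?mulf_neq0// mulr1 invfM exprMn.
  by rewrite -exprVn rmorphXn /= fmorphV; ring.
have -> : 0 + (r' / r)%:C * (r%:C * cis t - 0) = r'%:C * cis t.
  by rewrite add0r subr0 mulrA -rmorphM /= divfK ?gt_eqF.
have -> : (r' / r)%:C * (r%:C * cis t) = r'%:C * cis t.
  by rewrite mulrA -rmorphM /= divfK ?gt_eqF.
rewrite subr0 cisN exprSr -!mulrA mulVf ?mulf_neq0// mulr1 invfM exprMn.
by rewrite -exprVn rmorphXn /= fmorphV; ring.
Qed.

Lemma tcoef_indep r r' n : 0 < r < 1 -> 0 < r' < 1 -> tcoef r n = tcoef r' n.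
Proof.
move=> /andP[r0 r1] /andP[r'0 r'1].
by have [h|/ltW h] := leP r' r; [|symmetry]; exact: tcoef_shrink.
Qed.

Lemma taylor_bound r M z N : 0 < r < 1 -> (forall t, cmod (f (r%:C * cis t)) <= M) ->
  cmod z < r ->
  cmod (f z - \sum_(n < N) tcoef r n * z ^+ n) <= 2 * M / (1 - cmod z / r) * (cmod z / r) ^+ N.
Proof.
move=> /andP[r0 r1] fM zr; have pi0 := pi_gt0 R.
have rC : r%:C != 0 by rewrite -cmod_gt0 cmod_real normr_gt0 gt_eqF.
have wr : cmod (z / r%:C) = cmod z / r by rewrite cmodM cmodV cmod_real ger0_norm// ltW.
have w1 : cmod (z / r%:C) < 1 by rewrite wr ltr_pdivrMr// mul1r.
have := cauchy_geom N (ccont_circle (ltW r0) r1) fM w1.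
rewrite cauchy_formula// wr.
have -> : \sum_(k < N) (z / r%:C) ^+ k * cint (fun t => f (r%:C * cis t) * cis (- t) ^+ k) 0 (2 * pi)
  = (2 * pi)%:C * \sum_(n < N) tcoef r n * z ^+ n.
  rewrite mulr_sumr; apply: eq_bigr => k _; rewrite /tcoef expr_div_n.
  rewrite (rmorphM _ (2 * pi)^-1) /= !fmorphV /= rmorphXn /=.
  have : (2 * pi : R)%:C != 0 by rewrite -cmod_gt0 cmod_real normr_gt0 gt_eqF// mulr_gt0.
  have : r%:C ^+ k != 0 by rewrite expf_neq0.
  by move: (r%:C ^+ k) ((2 * pi)%:C) => x y x0 y0; field; rewrite x0.
rewrite -mulrBr cmodM cmod_real ger0_norm ?mulr_ge0 ?(ltW pi0)//.
rewrite -ler_pdivlMl ?mulr_gt0// => /le_trans; apply.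
have : 1 - cmod z / r != 0 by rewrite gt_eqF// subr_gt0 ltr_pdivrMr// mul1r.
have : pi != 0 :> R by rewrite gt_eqF.
move: (cmod z / r) (@pi R) => q x x0 q0.
by rewrite le_eqVlt; apply/orP; left; apply/eqP; field; rewrite x0 q0.
Qed.

End Holomorphic.
End Taylor.

(** * The Poisson-Jensen formula *)

Section Poisson.
Variable R : realType.
Implicit Types (z w a b : R[i]) (t : R).

Lemma cauchy_cisN n w : cmod w < 1 ->
  cint (fun t => cis (- t) ^+ n * (cis t / (cis t - w))) 0 (2 * pi) = (2 * pi)%:C *+ (n == 0%N).
Proof.
move=> w1; apply/eqP; rewrite -subr_eq0 -cmod_eq0 eq_le cmod_ge0 andbT.
apply: (@pow_small _ 0 _ (4 * pi * 1 / (1 - cmod w)) (cmod w)); first by rewrite cmod_ge0.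
move=> N N0.
have h (t : R) : cmod (cis (- t) ^+ n) <= 1 by rewrite cmodX cmod_cis expr1n.
have cN : ccont (fun t : R => cis (- t)).
  by have := ccont_cis (-1 : R); under eq_fun do rewrite mulN1r.
have := cauchy_geom N (ccontX n cN) h w1; congr (cmod (_ - _) <= _).
case: N N0 => // N _; rewrite big_ord_recl /= big1 ?addr0 => [|k _].
  rewrite expr0 mul1r -cint_cisN_nat.
  by apply: eq_cint => t _; rewrite expr0 mulr1.
transitivity (w ^+ bump 0 k * cint (fun t : R => cis (- t) ^+ (n + bump 0 k)) 0 (2 * pi)).
  by congr (_ * _); apply: eq_cint => t _; rewrite exprD.
by rewrite cint_cisN_nat addnS mulr0n mulr0.
Qed.

Definition poisson z t : R := (1 - cmod z ^+ 2) / cmod (cis t - z) ^+ 2.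

Lemma cmod_sqrC z : (cmod z ^+ 2)%:C = z * z^*.
Proof. by rewrite rmorphXn /= cmodC sqr_normc. Qed.

Lemma cis_subr_neq0 z t : cmod z != 1 -> cis t - z != 0.
Proof. by rewrite subr_eq0; apply: contraNneq => <-; rewrite cmod_cis. Qed.

(** Reduces Poisson integrals to Cauchy integrals and their conjugates. *)
Lemma poissonE z t : cmod z < 1 -> (poisson z t)%:C =
  cis t / (cis t - z) + (cis t / (cis t - z))^* - 1.
Proof.
move=> z1; have tz : cis t - z != 0 by apply: cis_subr_neq0; rewrite lt_eqF.
have tz' : (cis t)^* - z^* != 0 by rewrite -rmorphB /= conjc_eq0.
have ct : cis t * (cis t)^* = 1 by rewrite -cmod_sqrC cmod_cis expr1n.
rewrite /poisson rmorphM rmorphB fmorphV /= !cmod_sqrC rmorphM fmorphV /= !rmorphB /=.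
rewrite rmorph1 -[X in (X - _) / _]ct; move: tz tz' ct; move: (cis t)^* (cis t) (z^*) => xb x zb tz tz' _.
by move: (x^*)%C tz' => X tz'; field; rewrite ?tz ?tz'.
Qed.

Lemma poisson_ge0 z t : cmod z < 1 -> 0 <= poisson z t.
Proof.
move=> z1; rewrite divr_ge0 ?sqr_ge0// subr_ge0 expr_le1 ?cmod_ge0 ?ltW//.
Qed.

Lemma poisson_cont z : cmod z < 1 -> continuous (poisson z).
Proof.
move=> z1 t; apply: cvgM; first exact: cvg_cst.
apply: cvgV; first by rewrite expf_neq0// cmod_eq0 cis_subr_neq0// lt_eqF.
have h : continuous (fun t => cmod (cis t - z)).
  by apply: ccont_cmod; apply: ccontB; [exact: ccont_cis1|exact: ccont_cst].
by apply: cvgM; exact: h.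
Qed.

Lemma poisson_cis z n : cmod z < 1 ->
  cint (fun t => (poisson z t)%:C * cis t ^+ n) 0 (2 * pi) = (2 * pi)%:C * z ^+ n.
Proof.
move=> z1; have ck := cauchy_kernel_cont z1.
have cX : ccont (fun t : R => cis t ^+ n) by apply: ccontX; exact: ccont_cis1.
have cN : ccont (fun t : R => cis (- t)).
  by have := ccont_cis (-1 : R); under eq_fun do rewrite mulN1r.
transitivity (cint (fun t => cis t ^+ n * (cis t / (cis t - z)) +
    ((cis (- t) ^+ n * (cis t / (cis t - z)))^* - cis t ^+ n)) 0 (2 * pi)).
  apply: eq_cint => t _; have e : (cis (- t) ^+ n)^* = cis t ^+ n.
    by rewrite rmorphXn /= cis_conj opprK.
  by rewrite poissonE// (rmorphM _ (_ ^+ n)) /= e; ring.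
rewrite cintD; [|exact: ccontM|by apply: ccontB cX; apply: ccont_conj; apply: ccontM ck; exact: ccontX].
rewrite cintB//; last by apply: ccont_conj; apply: ccontM ck; exact: ccontX.
rewrite cint_conj; last by apply: ccontM ck; exact: ccontX.
rewrite cauchy_cis// cauchy_cisN// cint_cis_nat.
rewrite -[RHS]addr0; congr (_ + _); case: (n == 0%N); rewrite ?(mulr0n, mulr1n);
by apply/eqP; rewrite eq_complex /= !(subrr, oppr0, addr0) !eqxx.
Qed.

Lemma poisson_Re N (c : nat -> R[i]) z : cmod z < 1 ->
  rint (fun t => poisson z t * complex.Re (\sum_(k < N) c k * cis t ^+ k)) 0 (2 * pi) =
  2 * pi * complex.Re (\sum_(k < N) c k * z ^+ k).
Proof.
move=> z1; have cP : ccont (fun t => (poisson z t)%:C) by apply: ccont_real; exact: poisson_cont.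
have cX k : ccont (fun t => (poisson z t)%:C * cis t ^+ k).
  by apply: ccontM cP _; apply: ccontX; exact: ccont_cis1.
transitivity (complex.Re (cint (fun t => \sum_(k < N) c k * ((poisson z t)%:C * cis t ^+ k)) 0 (2 * pi))).
  rewrite /cint /=; apply: eq_rint => t _.
  have -> : \sum_(k < N) c k * ((poisson z t)%:C * cis t ^+ k) =
      (poisson z t)%:C * \sum_(k < N) c k * cis t ^+ k.
    by rewrite mulr_sumr; apply: eq_bigr => k _; ring.
  by rewrite cReM /= mul0r subr0.
rewrite cint_sum ?mulr_ge0 ?pi_ge0//; last by move=> k; exact: ccontM (ccont_cst _) (cX k).
rewrite (eq_bigr (fun k : 'I_N => (2 * pi)%:C * (c k * z ^+ k))); last first.
  by move=> k _; rewrite cintZ// poisson_cis//; ring.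
by rewrite -mulr_sumr cReM /= mul0r subr0.
Qed.

Lemma poisson_mass z : cmod z < 1 -> rint (poisson z) 0 (2 * pi) = 2 * pi.
Proof.
move=> z1; have := poisson_Re 1 (fun=> 1) z1.
rewrite big_ord1 expr0 mulr1 /= mulr1 => h; rewrite -[RHS]h.
by apply: eq_rint => t _; rewrite big_ord1 expr0 mulr1 /= mulr1.
Qed.

Lemma cRe_div (u v : R[i]) : complex.Re (u / v) =
  (complex.Re u * complex.Re v + complex.Im u * complex.Im v) / cmod v ^+ 2.
Proof. by rewrite cmod_sqr; case: u => u1 u2; case: v => v1 v2 /=; ring. Qed.

Lemma poisson_cst k z : cmod z < 1 -> rint (fun t => poisson z t * k) 0 (2 * pi) = 2 * pi * k.
Proof.
move=> z1; transitivity (rint (fun t => k * poisson z t) 0 (2 * pi)).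
  by apply: eq_rint => t _; rewrite mulrC.
by rewrite rintZ ?poisson_mass//; [rewrite mulrC|exact: poisson_cont].
Qed.

(** Taylor's formula for the real part of log (1 - w) without a complex logarithm: along s w with s
    in [0, 1], the sum of ln |1 - s w| and its partial series has as derivative the geometric
    remainder [d], and the mean value theorem bounds the difference. *)
Lemma ln_cmod_approx w N : cmod w < 1 ->
  `|ln (cmod (1 - w)) + complex.Re (\sum_(k < N) (k.+1%:R)^-1%:C * w ^+ k.+1)|
  <= cmod w ^+ N.+1 / (1 - cmod w).
Proof.
move=> w1; set x := complex.Re w; set y := complex.Im w.
pose q (s : R) := (1 - s * x) ^+ 2 + (s * y) ^+ 2.
pose D s := 2^-1 * ln (q s) + \sum_(k < N) (s ^+ k.+1 * ((k.+1%:R)^-1 * complex.Re (w ^+ k.+1))).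
pose d s := - complex.Re (w * (s%:C * w) ^+ N / (1 - s%:C * w)).
have qE s : q s = cmod (1 - s%:C * w) ^+ 2.
  rewrite cmod_sqr /q !cReD !cImD cReN cImN cReM cImM /= -/x -/y; ring.
have sw (s : R) : 0 <= s <= 1 -> cmod (s%:C * w) <= cmod w.
  by move=> /andP[s0 s1]; rewrite cmodM cmod_real ger0_norm// ler_piMl ?cmod_ge0.
have q0 (s : R) : 0 <= s <= 1 -> 0 < q s.
  move=> /sw s1; rewrite qE exprn_gt0// cmod_gt0 subr_eq0; apply/eqP => e.
  by move: (le_lt_trans s1 w1); rewrite -e cmod1 ltxx.
have dD (s : R) : 0 <= s <= 1 -> is_derive s 1 D (d s).
  move=> s01; have qs := q0 s s01.
  have dx : is_derive s 1 (fun s : R => 1 - s * x) (- x).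
    by apply: is_derive_eq; rewrite /GRing.scale /=; ring.
  have dy : is_derive s 1 (fun s : R => s * y) y.
    by apply: is_derive_eq; rewrite /GRing.scale /=; ring.
  have dq : is_derive s 1 q (2 * (- x * (1 - s * x) + s * y * y)).
    have := rderivD (rderivM dx dx) (rderivM dy dy).
    rewrite (_ : (fun t => _) = q); last by apply/funext => u; rewrite /q !expr2.
    by move=> h; apply: (is_derive_eq h); ring.
  have dl := rderivZ 2^-1 (is_derive1_comp (is_derive1_ln qs) dq).
  have dS : is_derive s 1 (fun s => \sum_(k < N) (s ^+ k.+1 * ((k.+1%:R)^-1 * complex.Re (w ^+ k.+1))))
      (\sum_(k < N) s ^+ k * complex.Re (w ^+ k.+1)).
    clear. elim: N => [|N IH].
      under eq_fun do rewrite big_ord0; rewrite big_ord0; exact: is_derive_cst.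
    under eq_fun do rewrite big_ord_recr /=; rewrite big_ord_recr /=.
    apply: rderivD IH _.
    have h n : is_derive s 1 (fun s : R => s ^+ n.+1) (n.+1%:R * s ^+ n).
      elim: n => [|n h]; first by rewrite mulr1; exact: is_derive_id.
      have := rderivM (is_derive_id s 1) h; rewrite (_ : (fun t => _) = fun t => t ^+ n.+2); last first.
        by apply/funext => t; rewrite [RHS]exprS.
      by move=> h'; apply: (is_derive_eq h'); rewrite mul1r mulrCA -exprS -[in RHS]nat1r mulrDl mul1r.
    have := rderivM (h N) (is_derive_cst (N.+1%:R^-1 * complex.Re (w ^+ N.+1)) s 1).
    move=> h'; apply: (is_derive_eq h'); rewrite /cst; field.
    by rewrite nat1r pnatr_eq0.
  apply: (is_derive_eq (rderivD dl dS)).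
  have w0 : 1 - s%:C * w != 0.
    by apply: contraTneq qs => e; rewrite qE e cmod0 expr0n ltxx.
  have -> : \sum_(k < N) s ^+ k * complex.Re (w ^+ k.+1) =
      complex.Re (w / (1 - s%:C * w) - w * (s%:C * w) ^+ N / (1 - s%:C * w)).
    clear - w0; elim: N => [|N IH].
      by rewrite big_ord0 expr0 mulr1 subrr.
    rewrite big_ord_recr /= IH.
    have -> : s ^+ N * complex.Re (w ^+ N.+1) = complex.Re (w * (s%:C * w) ^+ N).
      by rewrite exprMn -rmorphXn /= mulrCA -exprS cReM /= mul0r subr0.
    rewrite -cReD; congr complex.Re; rewrite exprSr; move: ((s%:C * w) ^+ N) w0 => v.
    by move: (s%:C) => c w0; field.
  rewrite /d cReD cReN addrA -[RHS]add0r; congr (_ - _).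
  rewrite cRe_div -qE cReD cImD cReN cImN cReM cImM /= -/x -/y.
  by move: (q s) qs => Q Q0; field; rewrite gt_eqF.
have cD : {within `[0, 1], continuous D}.
  apply: derivable_within_continuous => s; rewrite in_itv => s01.
  by have [] := dD s s01.
have dD' (s : R) : s \in `]0, 1[ -> is_derive s 1 D (d s).
  by rewrite in_itv/= => /andP[s0 s1]; apply: dD; rewrite !ltW.
have [c] := MVT_segment ler01 dD' cD.
rewrite in_itv/= subr0 mulr1 => c01.
have D0 : D 0 = 0.
  rewrite /D qE mul0r subr0 cmod1 expr1n ln1 mulr0 add0r big1// => k _.
  by rewrite exprS !mul0r.
have D1 : D 1 = ln (cmod (1 - w)) + complex.Re (\sum_(k < N) (k.+1%:R)^-1%:C * w ^+ k.+1).
  have w0 : 0 < cmod (1 - w).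
    by rewrite cmod_gt0 subr_eq0; apply/eqP => e; move: w1; rewrite -e cmod1 ltxx.
  rewrite /D qE mul1r lnXn// -[ln _ *+ 2]mulr_natl mulKf//; congr (_ + _).
  clear; elim: N => [|N IH]; first by rewrite !big_ord0.
  by rewrite !big_ord_recr /= IH cReD cReM /= mul0r subr0 expr1n mul1r.
rewrite D0 subr0 -D1 => ->; rewrite /d normrN (le_trans (normRe_le _))//.
have cw := sw _ c01.
rewrite !cmodM cmodX cmodV exprS -!mulrA ler_wpM2l ?cmod_ge0//.
rewrite ler_pM ?exprn_ge0 ?invr_ge0 ?cmod_ge0//.
  by rewrite lerXn2r ?nnegrE ?cmod_ge0.
have h : 1 - cmod w <= cmod (1 - c%:C * w).
  by rewrite (le_trans _ (cmod_sub_le _ _))// cmod1 lerD2l lerN2.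
by rewrite lef_pV2 ?posrE ?subr_gt0// (lt_le_trans _ h)// subr_gt0.
Qed.

Lemma ln_cmod_cont (g : R -> R[i]) : ccont g -> (forall t, g t != 0) ->
  continuous (fun t => ln (cmod (g t))).
Proof.
move=> cg g0 t; apply: (@continuous_comp _ _ _ (fun t => cmod (g t)) (@ln R)).
  exact: ccont_cmod.
by apply: continuous_ln; rewrite cmod_gt0.
Qed.

(** Up to an error that decays geometrically in N, uniformly on the closed disk, ln |1 - a x| is the
    real part of a polynomial, and [poisson_Re] reproduces such functions exactly. *)
Lemma poisson_log a z : cmod a < 1 -> cmod z < 1 ->
  rint (fun t => poisson z t * ln (cmod (1 - a * cis t))) 0 (2 * pi) =
  2 * pi * ln (cmod (1 - a * z)).
Proof.
move=> a1 z1; have pi0 : 0 <= 2 * pi :> R by rewrite mulr_ge0 ?pi_ge0.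
have cP := poisson_cont z1.
have at1 t : 1 - a * cis t != 0.
  rewrite subr_eq0; apply/eqP => e; have : cmod (a * cis t) = 1 by rewrite -e cmod1.
  by rewrite cmodM cmod_cis mulr1 => e'; rewrite e' ltxx in a1.
have cl : continuous (fun t => ln (cmod (1 - a * cis t))).
  apply: ln_cmod_cont => //.
  exact: ccontB (ccont_cst _) (ccontM (ccont_cst _) (@ccont_cis1 R)).
pose c k : R[i] := if k is n.+1 then (k%:R^-1)%:C * a ^+ k else 0.
pose S N x := \sum_(k < N) c k * x ^+ k.
have SE N x : S N.+1 x = \sum_(k < N) (k.+1%:R^-1)%:C * (a * x) ^+ k.+1.
  rewrite /S big_ord_recl mul0r add0r; apply: eq_bigr => k _.
  by rewrite /= /bump /= add1n exprMn mulrA.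
have approx N x : cmod x <= 1 -> `|ln (cmod (1 - a * x)) + complex.Re (S N.+1 x)| <= cmod a ^+ N / (1 - cmod a).
  move=> x1; have ax : cmod (a * x) <= cmod a by rewrite cmodM ler_piMr ?cmod_ge0.
  have ax1 := le_lt_trans ax a1.
  rewrite SE (le_trans (ln_cmod_approx N ax1))//.
  rewrite ler_pM ?exprn_ge0 ?invr_ge0 ?cmod_ge0// ?subr_ge0 ?(ltW ax1)//.
    rewrite exprS (@le_trans _ _ (1 * cmod (a * x) ^+ N))//.
      by rewrite ler_wpM2r ?exprn_ge0 ?cmod_ge0// ltW.
    by rewrite mul1r lerXn2r ?nnegrE ?cmod_ge0.
  by rewrite lef_pV2 ?posrE ?subr_gt0// lerD2l lerN2.
apply/eqP; rewrite -subr_eq0 -normr_eq0 eq_le normr_ge0 andbT.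
apply: (@pow_small _ 0 _ (4 * pi / (1 - cmod a)) (cmod a)); first by rewrite cmod_ge0.
move=> N _.
have cS : continuous (fun t => complex.Re (S N.+1 (cis t))).
  have : ccont (fun t => S N.+1 (cis t)).
    by apply: ccont_sum => k; apply: ccontM (ccont_cst _) _; apply: ccontX; exact: ccont_cis1.
  by case.
have cM (f g : R -> R) : continuous f -> continuous g -> continuous (fun t : R => f t * g t : R).
  by move=> cf cg t; apply: cvgM; [exact: cf|exact: cg].
have cD (f g : R -> R) : continuous f -> continuous g -> continuous (fun t : R => f t + g t : R).
  by move=> cf cg t; apply: cvgD; [exact: cf|exact: cg].
have -> : rint (fun t => poisson z t * ln (cmod (1 - a * cis t))) 0 (2 * pi) =
    rint (fun t => poisson z t * (ln (cmod (1 - a * cis t)) + complex.Re (S N.+1 (cis t)))) 0 (2 * pi)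
    - 2 * pi * complex.Re (S N.+1 z).
  rewrite -poisson_Re// -rintN; last exact: cM.
  rewrite -rintD; [|by apply: cM => //; exact: cD|by move=> t; apply: cvgN; exact: cM].
  by apply: eq_rint => t _; rewrite mulrDr addrK.
rewrite -addrA -opprD -mulrDr [X in 2 * pi * X]addrC (le_trans (ler_normB _ _))//.
have b1 : `|rint (fun t => poisson z t * (ln (cmod (1 - a * cis t)) + complex.Re (S N.+1 (cis t)))) 0 (2 * pi)|
   <= 2 * pi * (cmod a ^+ N / (1 - cmod a)).
  have cc : continuous (fun t => poisson z t * (cmod a ^+ N / (1 - cmod a))).
    by apply: cM => // u; exact: cvg_cst.
  rewrite -(poisson_cst _ z1) ler_norml -rintN//.
  have e t : `|poisson z t * (ln (cmod (1 - a * cis t)) + complex.Re (S N.+1 (cis t)))| <=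
      poisson z t * (cmod a ^+ N / (1 - cmod a)).
    rewrite normrM ger0_norm ?poisson_ge0// ler_wpM2l ?poisson_ge0//.
    by apply: approx; rewrite cmod_cis.
  apply/andP; split; apply: rint_le => //; do ?[by apply: cM => //; exact: cD].
  - by move=> u; apply: cvgN; exact: cc.
  - by move=> t _; have := e t; rewrite ler_norml => /andP[].
  - by move=> t _; have := e t; rewrite ler_norml => /andP[].
have b2 : `|2 * pi * (ln (cmod (1 - a * z)) + complex.Re (S N.+1 z))| <= 2 * pi * (cmod a ^+ N / (1 - cmod a)).
  by rewrite normrM ger0_norm// ler_wpM2l// approx// ltW.
rewrite (le_trans (lerD b1 b2))// le_eqVlt; apply/orP; left; apply/eqP.
have : 1 - cmod a != 0 by rewrite gt_eqF// subr_gt0.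
by move: (cmod a) (@pi R) => q x q0; field.
Qed.

(** Green's function of the disk with pole [b]; the value 0 for the other [b] lets one formula cover
    the roots inside and outside. *)
Definition green b z : R :=
  if cmod b < 1 then ln (cmod (1 - b^* * z)) - ln (cmod (z - b)) else 0.

(** For |b| < 1 the function |x - b| agrees on the circle with |1 - b^* x|, to which [poisson_log]
    applies; for |b| > 1 the factor b is pulled out instead. At z = b the two occurrences of ln |z -
    b| cancel, whatever the value of [ln 0]. *)
Lemma poisson_log_factor b z : cmod b != 1 -> cmod z < 1 ->
  rint (fun t => poisson z t * ln (cmod (cis t - b))) 0 (2 * pi) =
  2 * pi * (ln (cmod (z - b)) + green b z).
Proof.
move=> b1 z1; rewrite /green; have cP := poisson_cont z1.
have [bl|bg] := ltP (cmod b) 1.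
  rewrite addrC subrK -poisson_log ?cmod_conj//; apply: eq_rint => t _.
  congr (_ * ln _); have -> : cis t - b = cis t * (1 - b^* * cis t)^*.
    have h : cis t * (cis t)^* = 1 by rewrite -cmod_sqrC cmod_cis expr1n.
    by rewrite rmorphB rmorph1 rmorphM /= conjCK mulrBr mulr1 mulrCA h mulr1.
  by rewrite cmodM cmod_cis mul1r cmod_conj.
have {b1}bg : 1 < cmod b by rewrite lt_neqAle eq_sym b1.
have b0 : b != 0 by rewrite -cmod_gt0 (lt_trans _ bg).
have bV : cmod b^-1 < 1 by rewrite cmodV invf_lt1// (lt_trans _ bg).
have E x : cmod x <= 1 -> ln (cmod (x - b)) = ln (cmod b) + ln (cmod (1 - b^-1 * x)).
  move=> x1; rewrite -lnM ?posrE ?cmod_gt0//.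
    by rewrite -cmodM mulrBr mulr1 mulVKf// cmodB.
  rewrite subr_eq0; apply/eqP => e; have : cmod (b^-1 * x) = 1 by rewrite -e cmod1.
  by move/eqP; apply/negP; rewrite lt_eqF// cmodM (le_lt_trans _ bV)// ler_piMr// cmod_ge0.
rewrite addr0 E ?(ltW z1)// [RHS]mulrDr -(poisson_log bV z1) -(poisson_cst _ z1) -rintD.
- by apply: eq_rint => t _; rewrite E ?cmod_cis// mulrDr.
- by move=> t; apply: cvgM; [exact: cP|exact: cvg_cst].
- move=> t; apply: cvgM; first exact: cP.
  apply: ln_cmod_cont => [|u].
    exact: ccontB (ccont_cst _) (ccontM (ccont_cst _) (@ccont_cis1 R)).
  rewrite subr_eq0; apply/eqP => e; have : cmod (b^-1 * cis u) = 1 by rewrite -e cmod1.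
  by rewrite cmodM cmod_cis mulr1 => /eqP; apply/negP; rewrite lt_eqF.
Qed.

Lemma poisson_jensen c (rs : seq R[i]) z : c != 0 -> all (fun b => cmod b != 1) rs ->
  cmod z < 1 ->
  rint (fun t => poisson z t * ln (cmod (c * \prod_(b <- rs) (cis t - b)))) 0 (2 * pi) =
  2 * pi * (ln (cmod c) + \sum_(b <- rs) (ln (cmod (z - b)) + green b z)).
Proof.
move=> c0 rs1 z1; have cP := poisson_cont z1.
elim: rs rs1 => [_|b rs IH /= /andP[b1 rs1]].
  rewrite big_nil addr0 -(poisson_cst _ z1).
  by apply: eq_rint => t _; rewrite big_nil mulr1.
have tb t : cis t - b != 0 by exact: cis_subr_neq0.
have ct : ccont (fun t => cis t - b) by apply: ccontB (ccont_cst _); exact: ccont_cis1.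
have P0 t : c * \prod_(b <- rs) (cis t - b) != 0.
  rewrite mulf_neq0//; elim: {IH} rs rs1 => [|b' rs IH] /=; first by rewrite big_nil oner_eq0.
  by move=> /andP[b'1 rs1]; rewrite big_cons mulf_neq0 ?IH// cis_subr_neq0.
have cPr : ccont (fun t => c * \prod_(b <- rs) (cis t - b)).
  apply: ccontM (ccont_cst _) _; clear; elim: rs => [|b' rs IH].
    by under eq_fun do rewrite big_nil; exact: ccont_cst.
  under eq_fun do rewrite big_cons; apply: ccontM IH; apply: ccontB (ccont_cst _); exact: ccont_cis1.
rewrite big_cons addrCA [RHS]mulrDr -IH// -poisson_log_factor// -rintD.
- apply: eq_rint => t _; rewrite big_cons mulrCA (cmodM (cis t - b)) lnM ?posrE ?cmod_gt0//.
  by rewrite mulrDr.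
- by move=> t; apply: cvgM; [exact: cP|exact: ln_cmod_cont].
- by move=> t; apply: cvgM; [exact: cP|exact: ln_cmod_cont].
Qed.

End Poisson.

(** * Polynomial approximation *)

Section Approximation.
Variable R : realType.
Implicit Types (z w b c : R[i]) (t : R) (rs : seq R[i]).

Definition rpoly c rs z : R[i] := c * \prod_(b <- rs) (z - b).

Definition off_circle rs := all (fun b => cmod b != 1) rs.

Lemma exists_notin (u v : R) (l : seq R) : u < v -> exists2 s, u < s < v & s \notin l.
Proof.
elim: l u v => [|x l IH] u v uv.
  by exists ((u + v) / 2) => //; apply/andP; split; lra.
have [h|h] := leP x ((u + v) / 2).
  have [|s /andP[s1 s2] sl] := IH ((u + v) / 2) v; first lra.
  exists s; first by apply/andP; split; lra.
  by rewrite inE negb_or sl andbT gt_eqF// (le_lt_trans h).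
have [|s /andP[s1 s2] sl] := IH u ((u + v) / 2); first lra.
exists s; first by apply/andP; split; lra.
by rewrite inE negb_or sl andbT lt_eqF// (lt_trans s2).
Qed.

Lemma pow_lt_eps m (C q e : R) : 0 <= q < 1 -> 0 < e -> exists2 N, (m < N)%N & C * q ^+ N <= e.
Proof.
move=> /andP[q0 q1] e0; have h : C * q ^+ n @[n --> \oo] --> C * 0.
  by apply: cvgM; [exact: cvg_cst|apply: cvg_expr; rewrite ger0_norm].
rewrite mulr0 in h; have /cvgr_le/(_ e e0) [N _ HN] := h.
exists (maxn N m.+1); first by rewrite leq_max ltnSn orbT.
by apply: HN; rewrite /= leq_maxl.
Qed.

(* The factor [z ^+ m] carries the zero of [f] at the origin, which keeps
[rpoly c rs 0] away from [0]; [s] is moved slightly so as to avoid roots of the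
Taylor polynomial on the circle. *)
Lemma polynomial_approx (f : R[i] -> R[i]) : holomorphic_on (disk R) f -> ~ zero_on_disk R f ->
  exists m k0, 0 < k0 /\ forall s0 e : R, s0 < 1 -> 0 < e -> exists s c rs,
    [/\ s0 < s, 0 < s < 1, c != 0, off_circle rs &
     (forall z, cmod z <= 1 -> cmod (rpoly c rs z * z ^+ m - f (s%:C * z)) <= e) /\
     k0 <= cmod (rpoly c rs 0)].
Proof.
move=> hf fn0; pose C n := tcoef f 2^-1 n.
have half : 0 < (2^-1 : R) < 1 by apply/andP; split; lra.
(* If all Taylor coefficients vanished, [taylor_bound] would bound |f(z)| by a geometric sequence
   tending to 0. *)
have [n Cn] : exists n, C n != 0.
  apply: contrapT => nC; apply: fn0 => z; rewrite /disk /= => z1.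
  pose r := (1 + cmod z) / 2; have zr : cmod z < r by rewrite /r; lra.
  have r01 : 0 < r < 1 by have := cmod_ge0 z => ?; apply/andP; split; rewrite /r; lra.
  have [r0 r1] := andP r01.
  have [M fM] := circle_bounded hf (ltW r0) r1.
  apply/eqP; rewrite -cmod_eq0 eq_le cmod_ge0 andbT.
  apply: (@pow_small _ 0 _ (2 * M / (1 - cmod z / r)) (cmod z / r)).
    by rewrite divr_ge0 ?cmod_ge0 ?(ltW r0)//= ltr_pdivrMr// mul1r.
  move=> N _; have := taylor_bound hf N r01 fM zr.
  rewrite big1 ?subr0// => k _; rewrite (tcoef_indep hf k r01 half).
  have -> : tcoef f 2^-1 k = 0 by apply/eqP/negPn/negP => h; apply: nC; exists k.
  by rewrite mul0r.
have {n Cn} exC : exists n, C n != 0 by exists n.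
pose m := ex_minn exC.
have Cm : C m != 0 by rewrite /m; case: ex_minnP.
have Clt k : (k < m)%N -> C k = 0.
  rewrite /m; case: ex_minnP => m' _ mmin km; apply/eqP/negPn/negP => /mmin.
  by rewrite leqNgt km.
(* The polynomial built below takes the value s^m * C m at 0, with s >= 1/2. *)
exists m, (2^-1 ^+ m * cmod (C m)); split.
  by rewrite mulr_gt0 ?exprn_gt0 ?cmod_gt0//; lra.
move=> s0 e s01 e0.
pose s1 := Num.max s0 2^-1; have s11 : s1 < 1 by rewrite /s1 gt_max s01; lra.
have s1h : 2^-1 <= s1 by rewrite /s1 le_max lexx orbT.
have s1s : s0 <= s1 by rewrite /s1 le_max lexx.
(* [s] will be sought in (s1, s2); the Taylor remainder on |w| <= s2 comes from the larger circle of
   radius [r], so it decays like (s2 / r)^N. *)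
pose s2 := (1 + s1) / 2; pose r := (1 + s2) / 2.
have s12 : s1 < s2 by rewrite /s2; lra.
have s2r : s2 < r by rewrite /r /s2; lra.
have r1 : r < 1 by rewrite /r /s2; lra.
have s20 : 0 < s2 by rewrite /s2; lra.
have r0 : 0 < r by lra.
have [M fM] := circle_bounded hf (ltW r0) r1.
have M0 : 0 <= M := le_trans (cmod_ge0 _) (fM 0).
have q01 : 0 <= s2 / r < 1.
  by rewrite divr_ge0 ?(ltW r0) ?(ltW s20)//= ltr_pdivrMr// mul1r.
have [N mN HN] := pow_lt_eps m (2 * M / (1 - s2 / r)) q01 e0.
have app w : cmod w <= s2 -> cmod (f w - \sum_(n < N) C n * w ^+ n) <= e.
  move=> ws; have r01 : 0 < r < 1 by rewrite r0.
  have := taylor_bound hf N r01 fM (le_lt_trans ws s2r).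
  rewrite (eq_bigr (fun n : 'I_N => C n * w ^+ n)); last first.
    by move=> k _; rewrite (tcoef_indep hf k r01 half).
  move=> /le_trans; apply; apply: le_trans HN.
  have wq : cmod w / r <= s2 / r by rewrite ler_pM2r ?invr_gt0.
  have wq0 : 0 <= cmod w / r by rewrite divr_ge0 ?cmod_ge0 ?ltW.
  move: (s2 / r) q01 wq => q /andP[q0 q1] wq; move: (cmod w / r) wq wq0 => x wq wq0.
  rewrite -!mulrA ler_wpM2l// ler_wpM2l// ler_pM ?exprn_ge0// ?invr_ge0 ?subr_ge0 ?(ltW (le_lt_trans wq q1))//.
    by rewrite lef_pV2 ?posrE ?subr_gt0 ?(le_lt_trans wq q1)// lerD2l lerN2.
  by rewrite lerXn2r ?nnegrE// ltW.
pose P := \poly_(n < (N - m)%N) C (n + m)%N.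
have PE x : P.[x] * x ^+ m = \sum_(n < N) C n * x ^+ n.
  rewrite horner_poly mulr_suml -(big_mkord xpredT (fun n => C n * x ^+ n)).
  rewrite (@big_cat_nat _ _ _ m)//=; last exact: ltnW.
  have -> : \sum_(0 <= i < m) C i * x ^+ i = 0.
    by rewrite big_nat_cond big1// => k /andP[/andP[_ /Clt ->] _]; rewrite mul0r.
  rewrite add0r.
  rewrite [RHS](_ : _ = \sum_(0 + m <= i < N) C i * x ^+ i)// big_addn big_mkord; apply: eq_bigr => k _.
  by rewrite exprD mulrA.
have [rs PF] := closed_field_poly_normal P.
have P0 : P`_0 = C m by rewrite coef_poly subn_gt0 mN add0n.
have Pn0 : P != 0 by apply: contraNneq Cm => h; rewrite -P0 h coef0.
have [s /andP[ss1 ss2] sl] := exists_notin (map (@cmod R) rs) s12.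
have s_0 : 0 < s by lra.
have sC : s%:C != 0 by rewrite -cmod_gt0 cmod_real normr_gt0 gt_eqF.
(* Rescaling: the roots of x |-> P(s x) are b / s, which is off the unit circle exactly when |b|
   differs from s. *)
have sE x : rpoly (s%:C ^+ m * (lead_coef P * s%:C ^+ size rs)) [seq b / s%:C | b <- rs] x = s%:C ^+ m * P.[s%:C * x].
  rewrite /rpoly [in RHS]PF hornerZ horner_prod big_map -!mulrA; congr (_ * (_ * _)).
  clear - sC; elim: rs => [|b rs IH]; first by rewrite !big_nil mulr1.
  rewrite !big_cons /= exprS hornerXsubC -IH mulrACA; congr (_ * _).
  by rewrite mulrBr [s%:C * (b / _)]mulrC divfK.
exists s, (s%:C ^+ m * (lead_coef P * s%:C ^+ size rs)), [seq b / s%:C | b <- rs]; split.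
- lra.
- by rewrite s_0/= (lt_trans ss2)// /s2; lra.
- by rewrite !mulf_neq0 ?expf_neq0// lead_coef_eq0.
- rewrite /off_circle all_map; apply/allP => b brs /=; apply: contra sl => /eqP h.
  apply/mapP; exists b => //; move: h; rewrite cmodM cmodV cmod_real gtr0_norm//.
  by move/(congr1 (fun x => x * s)); rewrite divfK ?gt_eqF// mul1r.
split.
  move=> z z1; rewrite sE cmodB [_ * _ * z ^+ m]mulrAC -exprMn [_ * P.[_]]mulrC PE.
  by rewrite app// cmodM cmod_real gtr0_norm// -[leRHS]mulr1 ler_pM ?cmod_ge0// ltW.
rewrite sE mulr0 horner_coef0 P0 cmodM cmodX cmod_real gtr0_norm//.
rewrite ler_wpM2r ?cmod_ge0// lerXn2r ?nnegrE//; lra.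
Qed.

Lemma rpoly_neq0 c rs t : c != 0 -> off_circle rs -> rpoly c rs (cis t) != 0.
Proof.
move=> c0 rs1; rewrite mulf_neq0//; elim: rs rs1 => [|b rs IH] /=; first by rewrite big_nil oner_eq0.
by move=> /andP[b1 rs1]; rewrite big_cons mulf_neq0 ?IH// cis_subr_neq0.
Qed.

Lemma rpoly_cont c rs : ccont (fun t => rpoly c rs (cis t)).
Proof.
apply: ccontM (ccont_cst _) _; elim: rs => [|b' rs IH].
  by under eq_fun do rewrite big_nil; exact: ccont_cst.
under eq_fun do rewrite big_cons; apply: ccontM IH; apply: ccontB (ccont_cst _); exact: ccont_cis1.
Qed.

Lemma ln_rpoly c rs z : c != 0 -> z \notin rs ->
  ln (cmod (rpoly c rs z)) = ln (cmod c) + \sum_(b <- rs) ln (cmod (z - b)).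
Proof.
move=> c0; elim: rs => [|b rs IH]; first by rewrite /rpoly !big_nil mulr1 addr0.
rewrite inE negb_or => /andP[zb zrs]; rewrite /rpoly !big_cons mulrCA cmodM lnM ?posrE.
- by rewrite -/(rpoly c rs z) IH// addrCA.
- by rewrite cmod_gt0 subr_eq0.
- rewrite cmod_gt0 mulf_neq0// prodf_seq_neq0; apply/allP => x xrs /=.
  by rewrite subr_eq0; apply: contraNneq zrs => ->.
Qed.

Lemma rpoly_eq0 c rs z : rpoly c rs z != 0 -> c != 0 /\ z \notin rs.
Proof.
rewrite mulf_eq0 negb_or prodf_seq_neq0 => /andP[-> /allP h]; split => //.
by apply/negP => /h /=; rewrite subrr eqxx.
Qed.

Lemma poisson_jensen_rpoly c rs z : off_circle rs -> cmod z < 1 -> rpoly c rs z != 0 ->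
  rint (fun t => poisson z t * ln (cmod (rpoly c rs (cis t)))) 0 (2 * pi) =
  2 * pi * (ln (cmod (rpoly c rs z)) + \sum_(b <- rs) green b z).
Proof.
move=> rs1 z1 /rpoly_eq0[c0 zrs]; rewrite /rpoly poisson_jensen// -/(rpoly c rs z).
by rewrite ln_rpoly// -addrA -big_split.
Qed.

Lemma poisson0 t : poisson 0 t = 1.
Proof. by rewrite /poisson cmod0 subr0 cmod_cis expr0n subr0 expr1n divr1. Qed.

Lemma green0 b : b != 0 -> cmod b < 1 -> 1 - cmod b <= green b 0.
Proof.
move=> b0 b1; rewrite /green b1 mulr0 subr0 cmod1 ln1 add0r sub0r cmodN lerNr opprB.
by have := @le_ln1Dx _ (cmod b - 1); rewrite [1 + _]addrC subrK; apply; rewrite ltrDr cmod_gt0.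
Qed.

(** Poisson-Jensen at 0, where the kernel is 1 and the Green function - ln |b| is at least 1 -
    |b|. *)
Lemma jensen_rpoly c rs : off_circle rs -> rpoly c rs 0 != 0 ->
  2 * pi * (ln (cmod (rpoly c rs 0)) + \sum_(b <- rs | cmod b < 1) (1 - cmod b)) <=
  rint (fun t => ln (cmod (rpoly c rs (cis t)))) 0 (2 * pi).
Proof.
move=> rs1 r0; have z1 : cmod (0 : R[i]) < 1 by rewrite cmod0.
apply: (@le_trans _ _ (2 * pi * (ln (cmod (rpoly c rs 0)) + \sum_(b <- rs) green b 0))); last first.
  rewrite -poisson_jensen_rpoly// le_eqVlt; apply/orP; left; apply/eqP.
  by apply: eq_rint => t _; rewrite poisson0 mul1r.
rewrite ler_wpM2l ?mulr_ge0 ?pi_ge0// lerD2l big_mkcond !big_seq ler_sum// => b brs.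
have [b1|b1] := ltP (cmod b) 1; last by rewrite /green ltNge b1.
by apply: green0 => //; have [_] := rpoly_eq0 r0; apply: contraNneq => <-.
Qed.

End Approximation.

(** * Lower bounds in Stolz angles *)

Section Maximal.
Variable R : realType.
Notation mu := (@lebesgue_measure R).

(** The Poisson kernel of the half-plane at height [h], up to the factor 1 / pi. With h = 1 - |z| it
    dominates the Poisson kernel of the disk and is adapted to centred intervals. *)
Definition kern (h x : R) : R := h / (h ^+ 2 + x ^+ 2).

Lemma kern_ge0 (h x : R) : 0 < h -> 0 <= kern h x.
Proof. by move=> h0; rewrite divr_ge0 ?addr_ge0 ?sqr_ge0// ltW. Qed.

Lemma kern_cont (h a : R) : 0 < h -> continuous (fun x => kern h (x - a)).
Proof.
move=> h0 x; apply: cvgM; first exact: cvg_cst.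
apply: cvgV; first by rewrite gt_eqF// ltr_pwDl ?exprn_gt0 ?sqr_ge0.
apply: cvgD; first exact: cvg_cst.
have h1 : continuous (fun x : R => x - a) by move=> y; apply: cvgB; [exact: cvg_id|exact: cvg_cst].
by apply: cvgM; exact: h1.
Qed.

Lemma integral_indicM (A : set R) (phi : R -> R) :
  (\int[mu]_x (phi x * \1_A x)%:E = \int[mu]_(x in A) (phi x)%:E)%E.
Proof.
rewrite [RHS]integral_mkcond; apply: eq_integral => x _; rewrite patchE indicE.
by case: ifP => _; rewrite ?mulr1 ?mulr0.
Qed.

Lemma HL_ball (phi : R -> R) (th lam rho : R) : (forall x, 0 <= phi x) -> 0 < rho ->
  (HL_maximal phi th <= lam%:E)%E ->
  (\int[mu]_(x in ball th rho) (phi x)%:E <= (lam * (2 * rho))%:E)%E.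
Proof.
move=> phi0 r0 hl.
have : (iavg phi (ball th rho) <= lam%:E)%E.
  apply: le_trans hl; apply: ereal_sup_ubound; exists rho => //.
  by rewrite /= in_itv/= r0.
rewrite /iavg lebesgue_measure_ball ?(ltW r0)// -[rho *+ 2]mulr_natl.
have -> : (\int[mu]_(y in ball th rho) `|(phi y)%:E| = \int[mu]_(y in ball th rho) (phi y)%:E)%E.
  by apply: eq_integral => y _; rewrite /= ger0_norm.
by rewrite inver gt_eqF ?mulr_gt0// lee_pdivrMl ?mulr_gt0// (mulrC lam) EFinM.
Qed.

(** On the shell 2^(k-1) h <= |x| < 2^k h the kernel is at most 4 / (4^k h), so the single term k
    already dominates it; the term k = 0 covers |x| < h. *)
Lemma kern_dyadic (h x : R) N : 0 < h -> `|x| < 2 ^+ N * h ->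
  kern h x <= \sum_(k < N.+1) 4 / (4 ^+ k * h) * (`|x| < 2 ^+ k * h)%R%:R.
Proof.
move=> h0; have c0 k : 0 < 4 / (4 ^+ k * h) :> R by rewrite divr_gt0// mulr_gt0// exprn_gt0.
have den : 0 < h ^+ 2 + x ^+ 2 by rewrite ltr_pwDl ?exprn_gt0 ?sqr_ge0.
elim: N => [|N IH] xN.
  rewrite big_ord1 xN mulr1 expr0 mul1r /kern.
  rewrite ler_pdivrMr// mulrAC ler_pdivlMr//.
  have := sqr_ge0 x; have := sqr_ge0 h; rewrite -expr2; lra.
rewrite big_ord_recr /= xN mulr1.
have [x2|x2] := ltP `|x| (2 ^+ N * h).
  by rewrite (le_trans (IH x2))// lerDl ltW.
rewrite ler_wpDl//; first by apply: sumr_ge0 => k _; rewrite mulr_ge0// ltW.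
rewrite /kern ler_pdivrMr// mulrAC ler_pdivlMr ?mulr_gt0 ?exprn_gt0//.
have : (2 ^+ N * h) ^+ 2 <= x ^+ 2.
  by rewrite -(@real_normK _ x) ?num_real// lerXn2r ?nnegrE// ?mulr_ge0 ?exprn_ge0// ltW.
rewrite exprMn -exprM mulnC exprM (_ : 2 ^+ 2 = 4 :> R); last by ring.
have -> : h * (4 ^+ N.+1 * h) = 4 * (4 ^+ N * h ^+ 2) by rewrite exprS; ring.
move=> H.
by rewrite ler_pM2l// ler_wpDl// sqr_ge0.
Qed.

Lemma mem_ballR (th r x : R) : (x \in (ball th r : set R)) = (`|x - th| < r).
Proof. by apply/idP/idP; rewrite inE /ball /= distrC. Qed.

(** The interval of radius 2^k h has length 2 * 2^k h and weight 4 / (4^k h), hence contributes at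
    most 8 * lam / 2^k. The support condition makes the dyadic sum finite, and the bound is uniform
    in [N]. *)
Lemma kernel_maximal (phi : R -> R) (th h lam : R) N : measurable_fun setT phi ->
  (forall x, 0 <= phi x) -> 0 < h -> (HL_maximal phi th <= lam%:E)%E ->
  (forall x, phi x != 0 -> `|x - th| < 2 ^+ N * h) ->
  (\int[mu]_x (kern h (x - th) * phi x)%:E <= (16 * lam)%:E)%E.
Proof.
move=> mphi phi0 h0 hl supp.
have c0 k : 0 < 4 / (4 ^+ k * h) :> R by rewrite divr_gt0// mulr_gt0// exprn_gt0.
pose B k : set R := ball th (2 ^+ k * h).
have mB k : measurable (B k) by apply: open_measurable; exact: ball_open.
pose g k x := ((4 / (4 ^+ k * h))%:E * (phi x * \1_(B k) x)%:E)%E.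
have gB0 k x : (0 <= (phi x * \1_(B k) x)%:E)%E by rewrite lee_fin mulr_ge0.
have mgB k : measurable_fun setT (fun x => (phi x * \1_(B k) x)%:E).
  by apply/measurable_EFinP; apply: measurable_funM => //; exact: measurable_indic.
have g0 k x : (0 <= g k x)%E by rewrite mule_ge0// lee_fin ltW.
have mg k : measurable_fun setT (g k) by exact: measurable_funeM.
have mK : measurable_fun setT (fun x : R => kern h (x - th)).
  by apply: continuous_measurable_fun; exact: kern_cont.
apply: (@le_trans _ _ (\int[mu]_x \sum_(k < N.+1) g k x)%E).
  apply: ge0_le_integral => //.
  - by move=> x _; rewrite lee_fin mulr_ge0 ?kern_ge0.
  - by apply/measurable_EFinP; exact: measurable_funM.
  - by apply: emeasurable_sum => k; exact: mg.
  move=> x _; have [->|p0] := eqVneq (phi x) 0; first by rewrite mulr0 sume_ge0.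
  have := kern_dyadic h0 (supp _ p0) => H.
  rewrite (eq_bigr (fun k : 'I_N.+1 => (4 / (4 ^+ k * h) * (phi x * \1_(B k) x))%:E))// sumEFin lee_fin.
  rewrite (eq_bigr (fun k : 'I_N.+1 => 4 / (4 ^+ k * h) * (`|x - th| < 2 ^+ k * h)%R%:R * phi x)); last first.
    by move=> k _; rewrite [RHS]mulrAC -[RHS]mulrA indicE mem_ballR.
  by rewrite -mulr_suml ler_wpM2r.
rewrite ge0_integral_sum//; last by move=> k; exact: mg.
apply: (@le_trans _ _ (\sum_(k < N.+1) (8 * lam * 2^-1 ^+ k)%:E)%E).
  apply: lee_sum => k _; rewrite ge0_integralZl_EFin//; [|exact: mgB|exact: ltW].
  rewrite integral_indicM.
  have := HL_ball phi0 (_ : 0 < 2 ^+ k * h) hl; rewrite mulr_gt0 ?exprn_gt0// => /(_ isT) H.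
  rewrite (le_trans (lee_wpmul2l _ H)) ?lee_fin ?(ltW (c0 k))//.
  rewrite le_eqVlt; apply/orP; left; apply/eqP.
  rewrite (_ : 4 = 2 ^+ 2 :> R); last by ring.
  rewrite -exprM mulnC exprM exprVn; have : 2 ^+ k != 0 :> R by rewrite expf_neq0.
  by move: (2 ^+ k) => q q0; field; rewrite q0 gt_eqF.
rewrite sumEFin lee_fin -mulr_sumr.
have lam0 : 0 <= lam.
  have := HL_ball phi0 ltr01 hl; rewrite mulr1 => /(le_trans (integral_ge0 _ _)).
  have h' : forall x, ball th 1 x -> (0 <= (phi x)%:E)%E by move=> x _; rewrite lee_fin.
  by move=> /(_ h'); rewrite lee_fin pmulr_lge0.
have -> : 16 * lam = 8 * lam * 2 by ring.
rewrite ler_wpM2l ?mulr_ge0//.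
have : \sum_(k < N.+1) (2^-1 : R) ^+ k <= 2 - 2^-1 ^+ N.
  elim: (N) => [|n IH]; first by rewrite big_ord1 expr0; lra.
  by rewrite big_ord_recr /= (le_trans (lerD IH (lexx _)))// exprS; lra.
by move/le_trans; apply; rewrite gerBl exprn_ge0.
Qed.

Lemma sin_ge_linear (k : R) : 0 < k -> k < 1 ->
  exists2 c, 0 < c <= 1 & forall x, 0 <= x <= pi - k -> c * x <= sin x.
Proof.
move=> k0 k1; have p2 := @pi_ge2 R; have p4 : pi <= 4 :> R by have := @pihalf_lt2 R; lra.
have k1' : 1 <= pi - k :> R by lra.
have [m mi Hm] := EVT_min k1' (continuous_subspaceT (A := `[1, pi - k]) (@continuous_sin R)).
have m0 : 0 < sin m by apply: sin_gt0_pi; move: mi; rewrite in_itv/= => /andP[? ?]; apply/andP; split; lra.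
have c1 := @cos1_gt0 R.
(* On [0, 1] the mean value theorem gives slope at least cos 1; on [1, pi - k] the positive minimum
   [sin m] is compared with x <= 4. *)
exists (Num.min (cos 1) (sin m / 4)).
  by rewrite lt_min c1 divr_gt0//= ge_min cos_le1.
move=> x /andP[x0 xk]; have [x1|x1] := leP x 1.
  apply: (@le_trans _ _ (cos 1 * x)); first by rewrite ler_wpM2r// ge_min lexx.
  have [c] := MVT_segment x0 (fun u _ => is_derive_sin u) (continuous_subspaceT (A := `[0, x]) (@continuous_sin R)).
  rewrite in_itv/= => /andP[c0 cx]; rewrite sin0 !subr0 => ->.
  rewrite ler_wpM2r//; have [->//|cn1] := eqVneq c 1.
  by rewrite ltW// ltr_cos ?in_itv/=; [rewrite lt_neqAle cn1 (le_trans cx)|lra|lra].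
apply: (@le_trans _ _ (sin m / 4 * x)); first by rewrite ler_wpM2r// ge_min lexx orbT.
apply: (@le_trans _ _ (sin m)); last by apply: Hm; rewrite in_itv/= (ltW x1).
by rewrite mulrAC ler_pdivrMr// ler_pM2l//; lra.
Qed.

Lemma chord_sin (x y : R) : cmod (cis x - cis y) = 2 * `|sin ((x - y) / 2)|.
Proof.
apply/eqP; rewrite -(@eqrXn2 _ 2)// ?cmod_ge0 ?mulr_ge0//; apply/eqP.
rewrite cmod_sqr exprMn real_normK ?num_real// !cReD !cImD cReN cImN /=.
have e : cos (x - y) = 1 - 2 * sin ((x - y) / 2) ^+ 2.
  have {1}-> : x - y = ((x - y) / 2) *+ 2 by rewrite -mulr_natl; field.
  by rewrite cos_mulr2n sin2cos2 -mulr_natl; ring.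
rewrite cosB in e.
have := cos2Dsin2 x; have := cos2Dsin2 y; rewrite !expr2 in e *; lra.
Qed.

(** The chord is 2 |sin ((t - th) / 2)|. Keeping [th] away from both ends keeps |t - th| / 2 below
    pi - k / 2, where the sine is bounded below by a linear function. *)
Lemma chord_lower (k : R) : 0 < k -> k < 1 -> exists2 c, 0 < c <= 1 &
  forall t th, 0 <= t <= 2 * pi -> k <= th <= 2 * pi - k ->
    c * `|t - th| <= cmod (cis t - cis th).
Proof.
move=> k0 k1; have [||c c01 Hc] := @sin_ge_linear (k / 2); [lra|lra|].
exists c => // t th /andP[t0 t1] /andP[th0 th1]; rewrite chord_sin.
have -> : `|sin ((t - th) / 2)| = `|sin (`|t - th| / 2)|.
  by have [h|h] := leP 0 (t - th); [rewrite (ger0_norm h)|rewrite (ltr0_norm h) mulNr sinN normrN].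
have : c * (`|t - th| / 2) <= sin (`|t - th| / 2).
  apply: Hc; apply/andP; split; first by rewrite divr_ge0.
  have : `|t - th| <= 2 * pi - k by rewrite ler_norml; apply/andP; split; lra.
  lra.
have := ler_norm (sin (`|t - th| / 2)); lra.
Qed.

End Maximal.

(** * Logarithmic lower bounds and the measure of the bad vertices *)

Section BadSet.
Variable R : realType.
Notation mu := (@lebesgue_measure R).
Implicit Types (z w b c : R[i]) (rs : seq R[i]).

Definition lnm (x : R) : R := Num.max 0 (- ln x).

Lemma lnm_ge0 x : 0 <= lnm x.
Proof. by rewrite /lnm le_max lexx. Qed.

Lemma lnm_cont (g : R -> R[i]) : ccont g -> (forall t, g t != 0) ->
  continuous (fun t => lnm (cmod (g t))).
Proof.
move=> cg g0 t; apply: (@continuous_max _ _ (fun=> 0) (fun t => - ln (cmod (g t)))).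
  exact: cvg_cst.
by apply: cvgN; exact: ln_cmod_cont.
Qed.

Lemma rint_integral (f : R -> R) (a b : R) : continuous f ->
  (rint f a b)%:E = (\int[mu]_(x in `[a, b]) (f x)%:E)%E.
Proof.
move=> cf; rewrite /rint /Rintegral fineK//.
by apply: integrable_fin_num => //; exact: cont_integrable.
Qed.

Definition carg z : R := s2val (cid2 (polar z)).

Lemma carg_itv z : 0 <= carg z <= 2 * pi.
Proof. exact: s2valP (cid2 (polar z)). Qed.

Lemma cargE z : z = (cmod z)%:C * cis (carg z).
Proof. exact: s2valP' (cid2 (polar z)). Qed.

Lemma cis_carg_dist z : cmod z <= 1 -> cmod (cis (carg z) - z) = 1 - cmod z.
Proof.
move=> z1; rewrite {2}(cargE z) -{1}[cis _]mul1r -mulrBl cmodM cmod_cis mulr1.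
by rewrite -(rmorph1 (real_complex R)) -rmorphB cmod_real ger0_norm// subr_ge0.
Qed.

Definition droots rs := [seq b <- rs | cmod b < 1].

(** The function whose Hardy-Littlewood maximal function controls [- ln |Q|]
in Stolz angles, away from the roots: each root [b] of the disk, a point mass
[1 - |b|], is spread over the interval of radius [1 - |b|] below it. *)
Definition majorant c rs (t : R) : R :=
  lnm (cmod (rpoly c rs (cis t))) * \1_(`[0, 2 * pi] : set R) t
  + \sum_(b <- droots rs) \1_(ball (carg b) (1 - cmod b)) t.

Lemma measurable_ballR (x r : R) : measurable (ball x r : set R).
Proof. exact: measurable_ball. Qed.

Lemma integral_ball_cst (x r k : R) : 0 <= r ->
  (\int[mu]_(y in ball x r) (cst k y)%:E = (k * (2 * r))%:E)%E.
Proof.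
move=> r0; transitivity (\int[mu]_(y in ball x r) cst k%:E y)%E => //.
rewrite integral_cst; last exact: measurable_ballR.
rewrite EFinM; congr (_ * _)%E; rewrite mulr_natl; exact: lebesgue_measure_ball.
Qed.

Section OnePolynomial.
Variables (c : R[i]) (rs : seq R[i]).
Hypotheses (c0 : c != 0) (rs1 : off_circle rs).

Let Q0 t : rpoly c rs (cis t) != 0 := rpoly_neq0 t c0 rs1.

Let cl : continuous (fun t => lnm (cmod (rpoly c rs (cis t)))).
Proof. by apply: lnm_cont => //; exact: rpoly_cont. Qed.

Lemma majorant_ge0 t : 0 <= majorant c rs t.
Proof.
by rewrite addr_ge0 ?mulr_ge0 ?lnm_ge0// sumr_ge0.
Qed.

Lemma measurable_majorant : measurable_fun setT (majorant c rs).
Proof.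
apply: measurable_funD.
  apply: measurable_funM; last exact: measurable_indic.
  exact: continuous_measurable_fun.
apply: measurable_sum => b; apply: measurable_indic; exact: measurable_ballR.
Qed.

Lemma integral_majorant (v : R -> R) : continuous v -> (forall x, 0 <= v x) ->
  (\int[mu]_x (v x * majorant c rs x)%:E =
   \int[mu]_(x in `[0%R, (2 * pi)%R]) (v x * lnm (cmod (rpoly c rs (cis x))))%:E
   + \sum_(b <- droots rs) \int[mu]_(x in ball (carg b) (1 - cmod b)) (v x)%:E)%E.
Proof.
move=> cv v0; have mv : measurable_fun setT v by exact: continuous_measurable_fun.
have ml : measurable_fun setT (fun t => lnm (cmod (rpoly c rs (cis t)))).
  exact: continuous_measurable_fun.
rewrite -(integral_indicM `[0, 2 * pi]).
rewrite (eq_bigr (fun b => \int[mu]_x (v x * \1_(ball (carg b) (1 - cmod b)) x)%:E)%E); last first.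
  by move=> b _; rewrite integral_indicM.
have m1 b : measurable_fun setT (fun x => (v x * \1_(ball (carg b) (1 - cmod b)) x)%:E).
  by apply/measurable_EFinP/measurable_funM => //; apply: measurable_indic; exact: measurable_ballR.
have p1 b x : (0 <= (v x * \1_(ball (carg b) (1 - cmod b)) x)%:E)%E.
  by rewrite lee_fin mulr_ge0.
rewrite -ge0_integral_sum// -ge0_integralD//.
- apply: eq_integral => x _; rewrite sumEFin -EFinD /majorant mulrDr mulrA mulr_sumr.
  by [].
- by move=> x _; rewrite lee_fin !mulr_ge0 ?lnm_ge0.
- apply/measurable_EFinP/measurable_funM; last exact: measurable_indic.
  exact: measurable_funM.
- by move=> x _; apply: sume_ge0.
- by apply: emeasurable_sum => b; exact: m1.
Qed.

(** 3 = 1 + 2: the interval below a root has length 2 * (1 - |b|). *)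
Lemma majorant_mass A : rint (fun t => lnm (cmod (rpoly c rs (cis t)))) 0 (2 * pi) <= A ->
  \sum_(b <- droots rs) (1 - cmod b) <= A ->
  (\int[mu]_x (majorant c rs x)%:E <= (3 * A)%:E)%E.
Proof.
move=> lA bA; have c1 : continuous (cst 1 : R -> R) by move=> x; exact: cvg_cst.
have := integral_majorant c1 (fun=> ler01).
under eq_integral do rewrite mul1r.
move=> ->; under [X in (X + _)%E]eq_integral do rewrite mul1r.
rewrite -rint_integral//.
rewrite big_seq (eq_bigr (fun b => (2 * (1 - cmod b))%:E)); last first.
  move=> b; rewrite mem_filter => /andP[b1 _].
  by rewrite integral_ball_cst ?mul1r// subr_ge0 ltW.
rewrite -big_seq sumEFin -EFinD lee_fin -mulr_sumr; lra.
Qed.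

End OnePolynomial.

Lemma cmod_sqr_conj b z :
  cmod (1 - b^* * z) ^+ 2 = cmod (z - b) ^+ 2 + (1 - cmod z ^+ 2) * (1 - cmod b ^+ 2).
Proof.
rewrite !cmod_sqr; case: z => z1 z2; case: b => b1 b2 /=; ring.
Qed.

(** By [cmod_sqr_conj], twice the Green function equals ln (1 + x) <= x with x = (1 - |z|^2) (1 -
    |b|^2) / |z - b|^2. *)
Lemma green_le b z : cmod b < 1 -> cmod z < 1 -> z != b ->
  green b z <= 2 * (1 - cmod z) * (1 - cmod b) / cmod (z - b) ^+ 2.
Proof.
move=> b1 z1 zb; rewrite /green b1.
have D0 : 0 < cmod (z - b) by rewrite cmod_gt0 subr_eq0.
have bz := cmod_ge0 b; have zz := cmod_ge0 z.
set x := (1 - cmod z ^+ 2) * (1 - cmod b ^+ 2) / cmod (z - b) ^+ 2.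
have x0 : 0 <= x.
  by rewrite divr_ge0 ?sqr_ge0// mulr_ge0// subr_ge0 expr_le1// ltW.
have E : cmod (1 - b^* * z) ^+ 2 = cmod (z - b) ^+ 2 * (1 + x).
  by rewrite cmod_sqr_conj mulrDr mulr1 /x; field; rewrite gt_eqF.
have N0 : 0 < cmod (1 - b^* * z).
  rewrite lt_def cmod_ge0 andbT; apply: contraTneq (_ : 0 < cmod (z - b) ^+ 2 * (1 + x)).
    by move=> h; rewrite -E h expr0n ltxx.
  by rewrite mulr_gt0 ?exprn_gt0// ltr_pwDl.
have : ln (cmod (1 - b^* * z) ^+ 2) = ln (cmod (z - b) ^+ 2) + ln (1 + x).
  by rewrite E lnM ?posrE ?exprn_gt0// ltr_pwDl.
rewrite !lnXn//.
have : ln (1 + x) <= x by apply: le_ln1Dx; rewrite (lt_le_trans _ x0).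
have : x <= 2 * (2 * (1 - cmod z) * (1 - cmod b) / cmod (z - b) ^+ 2).
  rewrite /x mulrA ler_pM2r ?invr_gt0 ?exprn_gt0//.
  have -> : 2 * (2 * (1 - cmod z) * (1 - cmod b)) = ((1 - cmod z) * 2) * ((1 - cmod b) * 2) by ring.
  have e y : 1 - y ^+ 2 = (1 - y) * (1 + y) :> R by ring.
  rewrite !e ler_pM ?mulr_ge0 ?subr_ge0 ?addr_ge0 ?(ltW b1) ?(ltW z1)//.
    by rewrite ler_wpM2l ?subr_ge0 ?ltW//; lra.
  by rewrite ler_wpM2l ?subr_ge0 ?ltW//; lra.
set y := 2 * (1 - cmod z) * _ / _.
rewrite !mulr2n; lra.
Qed.

(** Poisson-Jensen bounds - ln |Q(z)| by the Poisson integral of ln^- |Q| plus the Green functions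
    of the roots. Both are dominated by integrals of [kern] centred at the vertex: the Poisson
    kernel pointwise, a Green function by the integral over the interval below its root, provided z
    is not too close to it. Together they form the integral of [kern] against [majorant], which
    [kernel_maximal] controls. *)
Lemma log_lower_bound (k alpha : R) : 0 < k -> k < 1 -> 0 < alpha ->
  exists2 C, 0 < C & forall c rs th z lam, c != 0 -> off_circle rs ->
    k <= th <= 2 * pi - k -> stolz alpha (cis th) z -> rpoly c rs z != 0 ->
    (forall b, b \in droots rs -> (1 - cmod z) / 2 <= cmod (z - b)) ->
    (HL_maximal (majorant c rs) th <= lam%:E)%E ->
    - ln (cmod (rpoly c rs z)) <= C * lam.
Proof.
move=> k0 k1 al0; have [ch /andP[ch0 ch1] chord] := chord_lower k0 k1.
(* Both constants bound h^2 + (t - th)^2 by a multiple of D^2. For [C1], D = |cis t - z| >= h and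
   the chord from t to th is at most (2 + alpha) D. For [C2], D = |z - b| >= h / 2, so 1 - |b| <= 3
   D and the path from th through z and b to [carg b] is at most (6 + 2 alpha) D. *)
pose C1 := 1 + ((2 + alpha) / ch) ^+ 2.
pose C2 := 4 + ((6 + 2 * alpha) / ch + 3) ^+ 2.
have C10 : 0 < C1 by rewrite ltr_pwDl// sqr_ge0.
have C20 : 0 < C2 by rewrite ltr_pwDl// sqr_ge0.
have pi0 := pi_gt0 R.
have p4 : pi <= 4 :> R by have := @pihalf_lt2 R; lra.
pose C3 := 2 * C1 + 2 * pi * C2.
have C30 : 0 < C3 by rewrite addr_gt0 ?mulr_gt0.
exists (C3 * 16 / (2 * pi)); first by rewrite divr_gt0 ?mulr_gt0.
move=> c rs th z lam c0 rs1 thk [z1 zst] Qz zb HL.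
have Q0 t : rpoly c rs (cis t) != 0 := rpoly_neq0 t c0 rs1.
set h := 1 - cmod z; have h0 : 0 < h by rewrite subr_gt0.
have {}zst : cmod (cis th - z) < (1 + alpha) * h by rewrite -ltr_pdivrMr.
have cP := poisson_cont z1.
have ck : continuous (fun x => kern h (x - th)) by exact: kern_cont.
have kp x : 0 <= kern h (x - th) by exact: kern_ge0.
have cl : continuous (fun t => lnm (cmod (rpoly c rs (cis t)))).
  by apply: lnm_cont => //; exact: rpoly_cont.
have cM (f g : R -> R) : continuous f -> continuous g -> continuous (fun t : R => f t * g t : R).
  by move=> cf cg t; apply: cvgM; [exact: cf|exact: cg].
(* The majorant is supported within distance 10 of [th]: 2 * pi <= 8 and the intervals below the
   roots have radius at most 1. *)
have [N HN] : exists N, 10 / h < 2 ^+ N.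
  exists (Num.bound (10 / h)).
  have := archi_boundP (divr_ge0 (ler0n R 10) (ltW h0)); move/lt_le_trans; apply.
  by rewrite -natrX ler_nat ltnW// ltn_expl.
have KM : (\int[mu]_x (kern h (x - th) * majorant c rs x)%:E <= (16 * lam)%:E)%E.
  apply: (@kernel_maximal _ _ _ _ _ N) => //.
  - exact: measurable_majorant.
  - by move=> x; exact: majorant_ge0.
  move=> x phix; rewrite -ltr_pdivrMr//; apply: lt_trans HN; rewrite ltr_pM2r ?invr_gt0//.
  have [th0 th1] := andP thk.
  have [x01|x01] := boolP (x \in `[0, 2 * pi]).
    by move: x01; rewrite in_itv/= => /andP[? ?]; rewrite ltr_norml; apply/andP; split; lra.
  have [/hasP[b bD]|/hasPn nb] := boolP (has (fun b => `|x - carg b| < 1 - cmod b) (droots rs)).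
    have := cmod_ge0 b; have /andP[? ?] := carg_itv b.
    by rewrite !ltr_norml => ? /andP[? ?]; apply/andP; split; lra.
  case/eqP: phix; rewrite /majorant indicE.
  rewrite (_ : (x \in (`[0, 2 * pi]%classic : set R)) = false) ?mulr0 ?add0r; last first.
    by apply/negbTE; apply: contra x01; rewrite inE.
  rewrite big_seq big1// => b bD; rewrite indicE mem_ballR.
  by rewrite (negbTE (nb b bD)).
rewrite integral_majorant// in KM.
have P1 : ((rint (fun t => poisson z t * lnm (cmod (rpoly c rs (cis t)))) 0 (2 * pi))%:E <=
    C3%:E * \int[mu]_(x in `[0%R, (2 * pi)%R]) (kern h (x - th) * lnm (cmod (rpoly c rs (cis x))))%:E)%E.
  rewrite rint_integral; last exact: cM.
  rewrite -ge0_integralZl_EFin ?(ltW C30)//; last 2 first.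
  - by move=> x _; rewrite lee_fin mulr_ge0 ?lnm_ge0.
  - apply/measurable_EFinP; apply: measurable_funTS; apply: continuous_measurable_fun; exact: cM.
  apply: ge0_le_integral => //.
  - by move=> x _; rewrite lee_fin mulr_ge0 ?lnm_ge0 ?poisson_ge0.
  - apply/measurable_EFinP; apply: measurable_funTS; apply: continuous_measurable_fun; exact: cM.
  - apply: measurable_funeM; apply/measurable_EFinP; apply: measurable_funTS.
    apply: continuous_measurable_fun; exact: cM.
  move=> t; rewrite /= in_itv/= => t02; rewrite -EFinM lee_fin mulrA ler_wpM2r ?lnm_ge0//.
  have D0 : 0 < cmod (cis t - z) by rewrite cmod_gt0 cis_subr_neq0// lt_eqF.
  have hD : h <= cmod (cis t - z).
    by rewrite (le_trans _ (cmod_sub_le _ _))// cmod_cis.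
  set D := cmod (cis t - z) in D0 hD *.
  have tD : `|t - th| <= (2 + alpha) / ch * D.
    rewrite mulrAC ler_pdivlMr// mulrC (le_trans (chord _ _ t02 thk))//.
    rewrite (le_trans (cmod_dist z _ _))// -/D (cmodB z).
    have : (1 + alpha) * h <= (1 + alpha) * D by rewrite ler_wpM2l//; lra.
    lra.
  have hx : h ^+ 2 + (t - th) ^+ 2 <= C1 * D ^+ 2.
    rewrite /C1 mulrDl mul1r -exprMn lerD//; first by rewrite lerXn2r ?nnegrE// ltW.
    by rewrite -(@real_normK _ (t - th)) ?num_real// lerXn2r ?nnegrE// (le_trans _ tD).
  have hx0 : 0 < h ^+ 2 + (t - th) ^+ 2 by rewrite ltr_pwDl ?exprn_gt0// sqr_ge0.
  have D20 : 0 < D ^+ 2 by rewrite exprn_gt0.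
  apply: (@le_trans _ _ (2 * C1 * kern h (t - th))); last first.
    by rewrite ler_wpM2r// /C3 lerDl !mulr_ge0// ltW.
  rewrite /poisson /kern -/D ler_pdivrMr// mulrA mulrAC ler_pdivlMr//.
  have e : 1 - cmod z ^+ 2 <= 2 * h.
    have -> : 1 - cmod z ^+ 2 = h * (1 + cmod z) by rewrite /h; ring.
    by rewrite mulrC ler_wpM2r ?(ltW h0)//; rewrite /h in h0; lra.
  have e0 : 0 <= 1 - cmod z ^+ 2 by rewrite subr_ge0 expr_le1 ?cmod_ge0// ltW.
  rewrite (le_trans (ler_pM e0 (ltW hx0) e hx))// le_eqVlt; apply/orP; left; apply/eqP; ring.
(* On the interval below [b] the kernel is at least h / (C2 D^2); times the length 2 * (1 - |b|)
   this recovers the bound of [green_le]. *)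
have P2 b : b \in droots rs -> ((2 * pi * green b z)%:E <=
    C3%:E * \int[mu]_(x in ball (carg b) (1 - cmod b)) (kern h (x - th))%:E)%E.
  move=> bD; have hD := zb _ bD; move: (bD); rewrite mem_filter => /andP[b1 _].
  have zb' : z != b.
    by apply: contraTneq hD => <-; rewrite subrr cmod0 -ltNge divr_gt0.
  have g1 := green_le b1 z1 zb'; rewrite -/h in g1 hD.
  set D := cmod (z - b) in g1 hD.
  have D0 : 0 < D by rewrite cmod_gt0 subr_eq0.
  have bh : 1 - cmod b <= 3 * D.
    have := cmod_sub_le z b; rewrite -/D; rewrite /h in hD; lra.
  have b0 : 0 < 1 - cmod b by rewrite subr_gt0.
  have hx t : `|t - carg b| < 1 - cmod b -> h ^+ 2 + (t - th) ^+ 2 <= C2 * D ^+ 2.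
    move=> tb; rewrite /C2 mulrDl -exprMn lerD//.
      have -> : 4 * D ^+ 2 = (2 * D) ^+ 2 by ring.
      by rewrite lerXn2r ?nnegrE ?(ltW h0) ?mulr_ge0 ?(ltW D0)//; lra.
    rewrite -(@real_normK _ (t - th)) ?num_real//.
    have tt : `|t - th| <= ((6 + 2 * alpha) / ch + 3) * D.
      have -> : t - th = (t - carg b) + (carg b - th) by ring.
      rewrite (le_trans (ler_normD _ _))// addrC mulrDl lerD//; last by rewrite (le_trans _ bh)// ltW.
      rewrite mulrAC ler_pdivlMr// mulrC (le_trans (chord _ _ (carg_itv b) thk))//.
      rewrite (le_trans (cmod_dist b _ _))// cis_carg_dist ?(ltW b1)//.
      have := cmod_dist z b (cis th); rewrite (cmodB b z) -/D (cmodB z).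
      have : (1 + alpha) * h <= (1 + alpha) * (2 * D) by rewrite ler_wpM2l//; lra.
      lra.
    by rewrite lerXn2r ?nnegrE// (le_trans _ tt).
  have CD0 : 0 < C2 * D ^+ 2 by rewrite mulr_gt0 ?exprn_gt0.
  have kl t : `|t - carg b| < 1 - cmod b -> h / (C2 * D ^+ 2) <= kern h (t - th).
    move=> /hx H; rewrite /kern ler_pM2l// lef_pV2// posrE.
    by rewrite ltr_pwDl ?exprn_gt0// sqr_ge0.
  apply: (@le_trans _ _ (C3%:E * \int[mu]_(x in ball (carg b) (1 - cmod b)) (cst (h / (C2 * D ^+ 2)) x)%:E)%E).
    rewrite integral_ball_cst ?(ltW b0)// -!EFinM lee_fin.
    apply: (@le_trans _ _ (2 * pi * C2 * (h / (C2 * D ^+ 2) * (2 * (1 - cmod b))))); last first.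
      rewrite ler_wpM2r//; last by rewrite /C3 lerDr mulr_ge0// ltW.
      apply: mulr_ge0; first by rewrite divr_ge0 ?(ltW h0) ?(ltW CD0).
      by rewrite mulr_ge0// ltW.
    rewrite -!mulrA ler_pM2l// ler_pM2l// (le_trans g1)// le_eqVlt; apply/orP; left; apply/eqP.
    by move: (1 - cmod b) => x; field; rewrite !gt_eqF.
  rewrite lee_wpmul2l ?lee_fin ?(ltW C30)//; apply: ge0_le_integral => //.
  - exact: measurable_ballR.
  - by move=> x _; rewrite lee_fin /= divr_ge0 ?(ltW h0) ?(ltW CD0).
  - by apply/measurable_EFinP; exact: measurable_cst.
  - by apply/measurable_EFinP; apply: measurable_funTS; exact: continuous_measurable_fun.
  - by move=> x xb; rewrite lee_fin kl// -mem_ballR inE.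
rewrite mulrAC ler_pdivlMr ?mulr_gt0// -lee_fin.
apply: (@le_trans _ _ ((rint (fun t => poisson z t * lnm (cmod (rpoly c rs (cis t)))) 0 (2 * pi))%:E
   + \sum_(b <- droots rs) (2 * pi * green b z)%:E)%E).
  rewrite sumEFin -EFinD lee_fin -mulr_sumr.
  have -> : \sum_(b <- droots rs) green b z = \sum_(b <- rs) green b z.
    rewrite big_filter big_mkcond; apply: eq_bigr => b _.
    by case: ifP => // /negbT b1; rewrite /green (negbTE b1).
  have := poisson_jensen_rpoly rs1 z1 Qz.
  have lc : continuous (fun t => ln (cmod (rpoly c rs (cis t)))).
    by apply: ln_cmod_cont => //; exact: rpoly_cont.
  have : - rint (fun t => poisson z t * ln (cmod (rpoly c rs (cis t)))) 0 (2 * pi) <=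
      rint (fun t => poisson z t * lnm (cmod (rpoly c rs (cis t)))) 0 (2 * pi).
    rewrite -rintN; last exact: cM.
    apply: rint_le; [by move=> t; apply: cvgN; exact: cM|exact: cM|].
    by move=> t _; rewrite -mulrN ler_wpM2l ?poisson_ge0// /lnm le_max lexx orbT.
  set S := \sum_(b <- rs) _; set I1 := rint _ _ _; set I2 := rint _ _ _ => i1 i2.
  rewrite mulrC mulrN; move: i2; rewrite [2 * pi * (_ + _)]mulrDr; lra.
apply: (@le_trans _ _ (C3%:E * (16 * lam)%:E)%E); last by rewrite -EFinM mulrA.
apply: le_trans (lee_wpmul2l _ KM); last by rewrite lee_fin ltW.
rewrite ge0_muleDr.
- rewrite leeD//= ge0_sume_distrr; last by move=> b _; apply: integral_ge0 => x _; rewrite lee_fin.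
  by rewrite !big_seq lee_sum.
- by apply: integral_ge0 => x _; rewrite lee_fin mulr_ge0 ?lnm_ge0.
- by apply: sume_ge0 => b _; apply: integral_ge0 => x _; rewrite lee_fin.
Qed.

(** Trades membership in a Stolz angle for membership in an interval; used to count roots above a
    vertex and in the Borel-Cantelli argument. *)
Lemma stolz_shadow (k alpha : R) : 0 < k -> k < 1 -> 0 < alpha ->
  exists2 C, 0 < C & forall th z, k <= th <= 2 * pi - k -> stolz alpha (cis th) z ->
    `|th - carg z| < C * (1 - cmod z).
Proof.
move=> k0 k1 al0; have [ch /andP[ch0 ch1] chord] := chord_lower k0 k1.
exists ((2 + alpha) / ch); first by rewrite divr_gt0//; lra.
move=> th z thk [z1 zst]; rewrite /disk /= in z1.
have h0 : 0 < 1 - cmod z by rewrite subr_gt0.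
rewrite ltr_pdivrMr// in zst; rewrite mulrAC ltr_pdivlMr// mulrC distrC.
rewrite (le_lt_trans (chord _ _ (carg_itv z) thk))// (le_lt_trans (cmod_dist z _ _))//.
rewrite cis_carg_dist ?(ltW z1)// (cmodB z); lra.
Qed.

(** Counting the roots above a point controls the case where the points of the
Stolz angle are close to roots: distinct well-separated points near roots force
distinct roots. *)
Lemma bad_set (k alpha : R) : 0 < k -> k < 1 -> 0 < alpha ->
  exists2 C, 0 < C & forall c rs A lam (K : nat), c != 0 -> off_circle rs ->
    rint (fun t => lnm (cmod (rpoly c rs (cis t)))) 0 (2 * pi) <= A ->
    \sum_(b <- droots rs) (1 - cmod b) <= A -> 0 < lam -> (0 < K)%N ->
    exists B : set R, [/\ measurable B, (mu B <= (C * A * (lam^-1 + K%:R^-1))%:E)%E &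
      forall th (zs : nat -> R[i]), k <= th <= 2 * pi - k ->
        (forall i, (i < K)%N -> stolz alpha (cis th) (zs i)) ->
        (forall i j, (i < j)%N -> (j < K)%N -> 3 * (1 - cmod (zs j)) <= 1 - cmod (zs i)) ->
        (forall i, (i < K)%N -> cmod (rpoly c rs (zs i)) < expR (- lam)) -> B th].
Proof.
move=> k0 k1 al0; have [C1 C10 low] := log_lower_bound k0 k1 al0.
(* A root within (1 - |z|) / 2 of a point z of the Stolz angle has 1 - |b| > (1 - |z|) / 2, hence
   lies in the Stolz angle of this larger aperture. *)
have al'0 : 0 < 2 + 2 * alpha by lra.
have [C2 C20 shadow] := stolz_shadow k0 k1 al'0.
(* 9 = 3 * 3 joins the constant of the maximal inequality to that of [majorant_mass]; 2 * C2 * (1 -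
   |b|) is the length of the shadow of a root. *)
exists (9 * C1 + 2 * C2); first lra.
move=> c rs A lam K c0 rs1 lA bA lam0 K0.
have A0 : 0 <= A.
  by rewrite (le_trans _ lA)// rint_ge0// => t _; exact: lnm_ge0.
have mphi := @measurable_majorant c rs c0 rs1.
have phi0 := @majorant_ge0 c rs.
have mass := majorant_mass c0 rs1 lA bA.
have phiE : (\int[mu]_x `|(majorant c rs x)%:E| = \int[mu]_x (majorant c rs x)%:E)%E.
  by apply: eq_integral => x _; rewrite /= ger0_norm.
have lphi : locally_integrable setT (majorant c rs).
  apply: open_integrable_locally; first exact: openT.
  apply/integrableP; split; first exact/measurable_EFinP.
  by rewrite phiE (le_lt_trans mass)// ltry.
pose B1 := [set x | (HL_maximal (majorant c rs) x > (lam / C1)%:E)%E].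
have mB1 : measurable B1.
  rewrite -[B1]setTI; apply: emeasurable_fun_o_infty => //.
  exact: measurable_HL_maximal.
have l1 : 0 < lam / C1 by rewrite divr_gt0.
have mu1 : (mu B1 <= (9 * C1 * A / lam)%:E)%E.
  apply: (le_trans (maximal_inequality lphi l1)).
  have l3 : (0 <= (3 / (lam / C1))%:E)%E by rewrite lee_fin divr_ge0// ltW.
  rewrite phiE; apply: (le_trans (lee_wpmul2l l3 mass)); rewrite -EFinM lee_fin.
  by rewrite le_eqVlt; apply/orP; left; apply/eqP; field; rewrite !gt_eqF.
pose Sh b : set R := ball (carg b) (C2 * (1 - cmod b)).
have mSh b : measurable (Sh b) by exact: measurable_ballR.
pose S x : R := \sum_(b <- droots rs) \1_(Sh b) x.
have mS : measurable_fun setT S by apply: measurable_sum => b; exact: measurable_indic.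
pose B2 := [set x | (K%:R <= S x)%R].
have mB2 : measurable B2.
  rewrite -[B2]setTI (_ : B2 = S @^-1` `[K%:R, +oo[); first exact: mS.
  by apply/seteqP; split => x /=; rewrite in_itv/= andbT.
have K0' : 0 < K%:R :> R by rewrite ltr0n.
have mu2 : (mu B2 <= (2 * C2 * A / K%:R)%:E)%E.
  have intS : (\int[mu]_x (S x)%:E <= (2 * C2 * A)%:E)%E.
    have -> : (\int[mu]_x (S x)%:E = \int[mu]_x \sum_(b <- droots rs) (\1_(Sh b) x)%:E)%E.
      by apply: eq_integral => x _; rewrite sumEFin.
    have mI b : measurable_fun setT (fun x => (\1_(Sh b) x)%:E : \bar R).
      by apply/measurable_EFinP; exact: measurable_indic.
    have I0 b x : setT x -> (0 <= ((\1_(Sh b) x : R))%:E)%E by rewrite lee_fin.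
    rewrite (@ge0_integral_sum _ _ _ mu _ measurableT _ _ mI I0).
    rewrite big_seq (eq_bigr (fun b => (2 * C2 * (1 - cmod b))%:E)); last first.
      move=> b; rewrite mem_filter => /andP[b1 _]; rewrite integral_indic; [|exact: measurableT|exact: mSh]; rewrite setIT.
      rewrite (_ : 2 * C2 * (1 - cmod b) = (C2 * (1 - cmod b)) *+ 2); last by rewrite [RHS]mulr2n; lra.
      by apply: lebesgue_measure_ball; rewrite mulr_ge0 ?(ltW C20)// subr_ge0 ltW.
    by rewrite -big_seq sumEFin lee_fin -mulr_sumr ler_wpM2l// mulr_ge0// ltW.
  have : (K%:R%:E * mu B2 <= \int[mu]_x (S x)%:E)%E.
    have S0 x : 0 <= S x by apply: sumr_ge0.
    have := @le_integral_comp_abse _ _ _ mu setT measurableT (EFin \o S) K%:R id (@measurable_id _ _ _).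
    have mES : measurable_fun setT (EFin \o S) by exact/measurable_EFinP.
    move=> /(_ (fun r r0 => r0) (fun x y _ _ xy => xy) mES K0').
    rewrite setTI (_ : [set x | _] = B2); last first.
      by apply/seteqP; split => x /=; rewrite lee_fin ger0_norm.
    move/le_trans; apply; rewrite le_eqVlt; apply/orP; left; apply/eqP.
    by apply: eq_integral => x _; rewrite /= ger0_norm.
  move=> /le_trans/(_ intS); rewrite -lee_pdivlMl// => /le_trans; apply.
  by rewrite -EFinM lee_fin mulrC.
exists (B1 `|` B2); split.
- exact: measurableU.
- apply: (le_trans (measureU2 mu mB1 mB2)); apply: (le_trans (leeD mu1 mu2)); rewrite -EFinD lee_fin.
  have x0 : 0 <= lam^-1 by rewrite invr_ge0 ltW.
  have y0 : 0 <= K%:R^-1 :> R by rewrite invr_ge0 ltW.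
  have := mulr_ge0 (mulr_ge0 (ltW C10) A0) y0; have := mulr_ge0 (mulr_ge0 (ltW C20) A0) x0.
  move: (lam^-1) (K%:R^-1) => x y; rewrite -!mulrA; nra.
move=> th zs thk zst sep small; apply: contrapT => /not_orP[nB1 nB2].
have HL : (HL_maximal (majorant c rs) th <= (lam / C1)%:E)%E by rewrite leNgt; exact/negP.
(* Off [B1], a point of the Stolz angle away from all roots satisfies |Q| >= e^(-lam) by [low];
   small values therefore occur only near a root. *)
have near i : exists b, (i < K)%N -> b \in droots rs /\ cmod (zs i - b) < (1 - cmod (zs i)) / 2.
  have [iK|] := ltnP i K; last by exists 0.
  have [zi1 _] := zst i iK; rewrite /disk /= in zi1.
  apply: contrapT => /forallNP H.
  have H' b : b \in droots rs -> (1 - cmod (zs i)) / 2 <= cmod (zs i - b).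
    by move=> bD; rewrite leNgt; apply/negP => h; apply: (H b).
  have Qz : rpoly c rs (zs i) != 0.
    apply/negP; rewrite mulf_eq0 (negbTE c0) /= prodf_seq_eq0 => /hasP[b brs].
    rewrite /= subr_eq0 => /eqP e; have : zs i \in droots rs by rewrite mem_filter zi1 e.
    by move/H'; rewrite subrr cmod0 leNgt divr_gt0// subr_gt0.
  have := low c rs th (zs i) _ c0 rs1 thk (zst i iK) Qz H' HL.
  rewrite mulrC divfK ?gt_eqF// => h.
  have := small i iK; rewrite ltNge => /negP; apply.
  by rewrite -[leRHS]lnK ?posrE ?cmod_gt0// ler_expR lerNl.
have [g gP] := choice near.
apply: nB2; rewrite /B2 /=.
have SE : S th = (size [seq b <- droots rs | `|th - carg b| < C2 * (1 - cmod b)])%:R.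
  rewrite /S; elim: (droots rs) => [|b D IH]; first by rewrite big_nil.
  rewrite big_cons IH indicE /Sh mem_ballR /=; case: ifP => _ /=; last by rewrite add0r.
  by rewrite -[RHS]natr1 addrC.
rewrite SE ler_nat -[X in (X <= _)%N](size_iota 0) -(size_map g).
(* 1 - |g i| lies strictly between 1/2 and 3/2 times 1 - |zs i|. The ratio 3 required of the points
   makes these ranges disjoint, so distinct points have distinct roots. *)
have loc i : (i < K)%N -> [/\ cmod (g i) < 1, (1 - cmod (zs i)) / 2 < 1 - cmod (g i) &
    1 - cmod (g i) < 3 * (1 - cmod (zs i)) / 2].
  move=> iK; have [gD gz] := gP i iK; move: gD; rewrite mem_filter => /andP[g1 _].
  have := cmod_sub_le (zs i) (g i); have := cmod_sub_le (g i) (zs i); rewrite (cmodB (g i)).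
  by split => //; lra.
apply: uniq_leq_size.
  rewrite map_inj_in_uniq ?iota_uniq// => i j; rewrite !mem_iota !add0n /= => iK jK e.
  have [_ a1 a2] := loc i iK; have [_ b1 b2] := loc j jK; rewrite e in a1 a2.
  have [ij|ji|//] := ltngtP i j.
    by exfalso; have := sep i j ij jK; lra.
  by exfalso; have := sep j i ji iK; lra.
apply/allP; rewrite all_map; apply/allP => i; rewrite mem_iota add0n /= => iK.
have [gD gz] := gP i iK; have [g1 a1 a2] := loc i iK.
rewrite mem_filter gD andbT; apply: shadow => //; split => //.
have [zi1 zi2] := zst i iK; rewrite /disk /= in zi1.
have h0 : 0 < 1 - cmod (zs i) by rewrite subr_gt0.
rewrite ltr_pdivrMr// in zi2; rewrite ltr_pdivrMr ?subr_gt0//.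
rewrite (le_lt_trans (cmod_dist (zs i) _ _))//.
have : (3 + 2 * alpha) * ((1 - cmod (zs i)) / 2) <= (3 + 2 * alpha) * (1 - cmod (g i)).
  by rewrite ler_wpM2l ?ltW//; lra.
lra.
Qed.

End BadSet.

(** * Summable families and null sets *)

Section SummableFamilies.
Import finmap.
Variable R : realType.

(** Each level a x > 1 / (n + 1) is finite, since an infinite one would contain finite subsets of
    arbitrarily large sum. Countability is what lets subadditivity of the measure apply to families
    indexed by points of the disk. *)
Lemma esum_gt0_countable (T : choiceType) (D : set T) (a : T -> R) :
  (forall x, D x -> 0 < a x) -> (\esum_(x in D) (a x)%:E < +oo)%E -> countable D.
Proof.
move=> a0 S.
have -> : D = \bigcup_(n in [set: nat]) (D `&` [set x | n.+1%:R^-1 < a x]).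
  apply/seteqP; split => [x Dx|x [n _ []//]].
  have [n _ /(_ n (leqnn n)) an] := near_infty_natSinv_lt (PosNum (a0 x Dx)).
  by exists n.
apply: bigcup_countable => // n _; apply: finite_set_countable; apply: contrapT => inf.
have S0 : (0 <= \esum_(x in D) (a x)%:E)%E by apply: esum_ge0 => x /a0/ltW; rewrite lee_fin.
have /fineK SE : (\esum_(x in D) (a x)%:E)%E \is a fin_num by rewrite ge0_fin_numE.
set s := fine _ in SE.
have [B BD Bn] := infinite_set_fset (Num.truncn (s * n.+1%:R)).+1 inf.
have : (\sum_(x \in [set` B]) (a x)%:E <= s%:E)%E.
  rewrite SE; apply: esum_ge; exists [set` B] => //; split; first exact: finite_fset.
  by move=> x /BD[].
rewrite fsbig_finite// set_fsetK sumEFin lee_fin leNgt => /negP; apply.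
have n0 : 0 < n.+1%:R :> R by rewrite ltr0n.
apply: (@lt_le_trans _ _ (\sum_(x <- B) n.+1%:R^-1)); last first.
  by rewrite !big_seq; apply: ler_sum => x /BD[_ /ltW].
rewrite big_const_seq count_predT iter_addr_0 -[ltRHS]mulr_natl -ltr_pdivrMr ?invr_gt0// invrK.
by rewrite (lt_le_trans (truncnS_gt _))// ler_nat.
Qed.

(** A finite subset carries the sum up to [e], and being finite it lies in a closed disk of radius q
    < 1. *)
Lemma esum_disk_tail (a : set R[i]) (g : R[i] -> R) (e : R) : a `<=` disk R ->
  (forall z, a z -> 0 <= g z) -> (\esum_(z in a) (g z)%:E < +oo)%E -> 0 < e ->
  exists2 q : R, 0 <= q < 1 & (\esum_(z in a `&` [set z | (q < cmod z)%R]) (g z)%:E <= e%:E)%E.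
Proof.
move=> ad g0 S e0.
have g0' z : a z -> (0 <= (g z)%:E)%E by move=> /g0; rewrite lee_fin.
have S0 : (0 <= \esum_(z in a) (g z)%:E)%E by exact: esum_ge0.
have Sfin : (\esum_(z in a) (g z)%:E)%E \is a fin_num by rewrite ge0_fin_numE.
have [_ [F [finF Fa] <-] HF] := ub_ereal_sup_adherent e0 Sfin.
pose q := \big[Order.max/0]_(z <- fset_set F) cmod z.
have Fq z : F z -> cmod z <= q.
  by move=> Fz; apply: le_bigmax_seq => //; rewrite in_fset_set//; exact: mem_set.
have q01 : 0 <= q < 1.
  rewrite /q; apply/andP; split; first exact: bigmax_ge_id.
  by rewrite big_seq; apply: bigmax_lt => // z; rewrite in_fset_set// => /set_mem /Fa; exact: ad.
exists q => //.
set T := (\esum_(z in a `&` _) _)%E.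
have := esumID [set z | q < cmod z] a (fun z => (g z)%:E) g0'.
rewrite -/T; set U := (\esum_(z in a `&` ~` _) _)%E => SE.
have FU : (\sum_(z \in F) (g z)%:E <= U)%E.
  apply: esum_ge; exists F => //; split => // z Fz; split; first exact: Fa.
  by rewrite /= => /(le_lt_trans (Fq z Fz)); rewrite ltxx.
have T0 : (0 <= T)%E by apply: esum_ge0 => z [/g0'].
have U0 : (0 <= U)%E by apply: esum_ge0 => z [/g0'].
have Ufin : U \is a fin_num.
  by rewrite ge0_fin_numE// (le_lt_trans _ S)// SE leeDr.
move: (lt_le_trans HF FU); rewrite -/(esum _ _) SE lteBlDr// addeC lteD2lE// => /ltW.
by [].
Qed.

End SummableFamilies.

(** * Lebesgue outer measure of arbitrary sets *)

Section OuterMeasure.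
Variable R : realType.
Notation mu := (@lebesgue_measure R).

(** No measurability is assumed: the sets of vertices defined by cluster conditions are never shown
    to be measurable, and [lebesgue_measure] is an outer measure on all sets. *)
Lemma lebesgue_sub (A B : set R) : A `<=` B -> (mu A <= mu B)%E.
Proof. exact: (le_outer_measure ((wlength idfun)^*)%mu). Qed.

Lemma lebesgue_bigcup (F : nat -> set R) : (mu (\bigcup_n F n) <= \sum_(n <oo) mu (F n))%E.
Proof. exact: (outer_measure_sigma_subadditive ((wlength idfun)^*)%mu F). Qed.

Lemma lebesgue_bigcup_esum (T : choiceType) (D : set T) (A : T -> set R) : countable D ->
  (mu (\bigcup_(z in D) A z) <= \esum_(z in D) mu (A z))%E.
Proof.
move=> /countable_injP[f finj].
pose F n := \bigcup_(z in [set z | D z /\ f z = n]) A z.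
have -> : \bigcup_(z in D) A z = \bigcup_n F n.
  by apply/seteqP; split => [x [z Dz Az]|x [n _ [z [Dz _] Az]]]; [exists (f z) => //; exists z|exists z].
apply: (le_trans (lebesgue_bigcup F)).
rewrite nneseries_esumT//.
rewrite (_ : (\esum_(z in D) mu (A z) = \esum_(z in D) mu (F (f z)))%E); last first.
  apply: eq_esum => z Dz; congr mu; apply/seteqP; split => [x Ax|x [y [Dy fyz] Ay]]; first by exists z.
  by have <- : y = z by apply: finj => //; exact: mem_set.
rewrite -(esum_image D f (fun n => mu (F n))) ?(esum_mkcond (f @` D)); last first.
  by move=> x y; rewrite !inE => Dx Dy; apply: finj; rewrite inE.
apply: le_esum => n _; case: ifPn => //; rewrite notin_setE => nD.
rewrite (_ : F n = set0) ?measure0//; apply/seteqP; split => // x [z [Dz fz] _].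
by apply: nD; exists z.
Qed.

Lemma lebesgue_sub0 (A : set R) : (forall e : R, 0 < e -> (mu A <= e%:E)%E) -> mu A = 0%E.
Proof.
move=> H; apply/eqP; rewrite eq_le measure_ge0 andbT; apply/lee_addgt0Pr => e e0.
by rewrite add0e; exact: H.
Qed.

Lemma lebesgue_bigcup0 (F : nat -> set R) : (forall n, mu (F n) = 0%E) -> mu (\bigcup_n F n) = 0%E.
Proof.
move=> F0; apply/eqP; rewrite eq_le measure_ge0 andbT (le_trans (lebesgue_bigcup F))//.
by rewrite eseries0.
Qed.

Lemma lebesgue_setU (A B : set R) : (mu (A `|` B) <= mu A + mu B)%E.
Proof. exact: (outer_measureU2 ((wlength idfun)^*)%mu). Qed.

End OuterMeasure.

(** * Hardy means and thick sets *)

Section HardyMeans.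
Variables (R : realType) (p : R).
Hypothesis p0 : 0 < p.
Notation mu := (@lebesgue_measure R).
Implicit Types (f : R[i] -> R[i]) (z w : R[i]) (r t : R).

Lemma powR_le (q x y : R) : 0 <= q -> 0 <= x -> x <= y -> x `^ q <= y `^ q.
Proof.
by move=> q0 x0 xy; apply: (ge0_ler_powR q0); rewrite ?nnegrE// (le_trans x0).
Qed.

Lemma poweR_le (q : R) (x y : \bar R) : 0 <= q -> (0 <= x)%E -> (x <= y)%E -> (x `^ q <= y `^ q)%E.
Proof.
move=> q0 x0 xy; apply: (gt0_ler_poweR q0); rewrite ?in_itv/= ?leey ?andbT//.
exact: le_trans xy.
Qed.

Lemma powR_lt1 (q x : R) : 0 < q -> 0 <= x -> x < 1 -> x `^ q < 1.
Proof.
move=> q0 x0 x1; have <- : (1 : R) `^ q = 1 by rewrite powR1.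
by apply: (gt0_ltr_powR q0); rewrite ?nnegrE.
Qed.

Lemma powR_le1 (q x : R) : 0 <= q -> 0 <= x -> x <= 1 -> x `^ q <= 1.
Proof.
move=> q0 x0 x1; have <- : (1 : R) `^ q = 1 by rewrite powR1.
exact: powR_le.
Qed.

(** For p < 1 the power is not differentiable at 0, so at zeros of [g] continuity is checked
    directly, with tolerance e^(1/p) for [g]. *)
Lemma powR_cont (g : R -> R) : continuous g -> (forall t, 0 <= g t) ->
  continuous (fun t => g t `^ p).
Proof.
move=> cg g0 t; have [gt0|gt0] := eqVneq (g t) 0.
  apply/cvgrPdist_lt => e e0; rewrite gt0 powR0 ?gt_eqF//.
  have /cvgrPdist_lt/(_ (e `^ p^-1)) := cg t; rewrite powR_gt0// => /(_ isT).
  apply: filterS => x; rewrite gt0 !sub0r !normrN !ger0_norm ?powR_ge0// => gx.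
  have := gt0_ltr_powR p0; move=> /(_ (g x) (e `^ p^-1)); rewrite !nnegrE => /(_ (g0 x) (powR_ge0 _ _) gx).
  by rewrite -powRrM mulVf ?gt_eqF// powRr1// ltW.
apply: (@continuous_comp _ _ _ g (fun x => x `^ p)); first exact: cg.
apply: differentiable_continuous; apply/derivable1_diffP; apply: derivable_powR.
by rewrite in_itv/= andbT lt_neqAle eq_sym gt0 g0.
Qed.

Lemma cdiff_derivable f z D : cdiff f z D -> derivable (f : R[i]^o -> R[i]^o) z 1.
Proof.
move=> fD; apply/cvg_ex; exists (D : R[i]^o); apply/cvgrPdist_le => e e0.
have eE : e = (complex.Re e)%:C by move: e0; rewrite ltcE => /andP[/eqP]; case: (e) => a b /= ->.
have e0' : 0 < complex.Re e by rewrite -ltcR -eE.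
have [d d0 Hd] := fD _ e0'.
rewrite /dnbhs /within /=; apply/nbhs_ballP; exists d%:C => /=; first by rewrite ltcR.
move=> h; rewrite /ball /= sub0r normrN -cmodC ltcR => hd h0.
have := Hd (h + z); rewrite addrK => /(_ hd) hh.
rewrite /GRing.scale /= mulr1 eE -cmodC lecR.
have -> : D - h^-1 * (f (h + z) - f z) = - ((f (h + z) - f z - D * h) / h) by field.
by rewrite cmodN cmodM cmodV ler_pdivrMr ?cmod_gt0.
Qed.

Lemma holomorphic_mulX f n : holomorphic_on (disk R) f ->
  holomorphic_on (disk R) (fun z => z ^+ n * f z).
Proof.
move=> hf z zD; have [D fD] := holomorphic_cdiff hf zD.
have idD : cdiff id z 1 by move=> e e0; exists 1 => // w _; rewrite mul1r subrr cmod0 mulr_ge0 ?(ltW e0) ?cmod_ge0.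
have [D' XD] := cdiffX n idD.
exact: cdiff_derivable (cdiffM XD fD).
Qed.

Lemma zero_holomorphic f : zero_on_disk R f -> holomorphic_on (disk R) f.
Proof.
move=> f0 z zD; apply: (@cdiff_derivable _ _ 0) => e e0.
exists (1 - cmod z) => [|w wz]; first by rewrite subr_gt0.
rewrite !f0//; first by rewrite mul0r !subrr cmod0 mulr_ge0 ?(ltW e0) ?cmod_ge0.
by rewrite /disk /=; have := cmod_sub_le w z; lra.
Qed.

Definition hmean f r : R := rint (fun t => cmod (f (r%:C * cis t)) `^ p) 0 (2 * pi).

Lemma hmean_cont f r : holomorphic_on (disk R) f -> 0 <= r < 1 ->
  continuous (fun t => cmod (f (r%:C * cis t)) `^ p).
Proof.
move=> hf /andP[r0 r1]; apply: powR_cont => [|t]; last exact: cmod_ge0.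
by apply: ccont_cmod; exact: ccont_circle.
Qed.

Lemma circle_meanE f r : holomorphic_on (disk R) f -> 0 <= r < 1 ->
  circle_mean p f r = ((2 * pi)^-1 * hmean f r)%:E.
Proof.
move=> hf r01; rewrite /circle_mean EFinM; congr (_ * _)%E.
by rewrite -rint_integral//; exact: hmean_cont.
Qed.

Lemma circle_mean_ge0 f r : (0 <= circle_mean p f r)%E.
Proof.
rewrite /circle_mean mule_ge0 ?lee_fin ?invr_ge0 ?mulr_ge0 ?pi_ge0//.
by apply: integral_ge0 => t _; rewrite lee_fin powR_ge0.
Qed.

Lemma hardy_mean_bound f : hardy_space p f ->
  exists2 S, 0 <= S & forall r, 0 <= r < 1 -> hmean f r <= S.
Proof.
move=> [hf]; rewrite /hardy_norm; set E := [set circle_mean p f r | r in _] => fin.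
have p1 : p^-1 != 0 by rewrite invr_eq0 gt_eqF.
have Efin : (ereal_sup E < +oo)%E by exact: lty_poweRy fin.
have Eub r : 0 <= r < 1 -> (circle_mean p f r <= ereal_sup E)%E.
  by move=> r01; apply: ereal_sup_ubound; exists r.
have E0 : (0 <= ereal_sup E)%E.
  by apply: le_trans (Eub 0 _); [exact: circle_mean_ge0|rewrite lexx ltr01].
have EE : (fine (ereal_sup E))%:E = ereal_sup E by rewrite fineK// ge0_fin_numE.
exists (2 * pi * fine (ereal_sup E)); first by rewrite !mulr_ge0 ?pi_ge0// fine_ge0.
move=> r r01; have := Eub r r01; rewrite circle_meanE// -EE lee_fin.
by rewrite ler_pdivrMl ?mulr_gt0 ?pi_gt0.
Qed.

Lemma zero_hardy_norm f : zero_on_disk R f -> hardy_norm p f = 0%E.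
Proof.
move=> f0; rewrite /hardy_norm (_ : [set circle_mean p f r | r in _] = [set 0%E]).
  by rewrite ereal_sup1 poweR0r// invr_eq0 gt_eqF.
have hm r : 0 <= r < 1 -> circle_mean p f r = 0%E.
  move=> r01; rewrite circle_meanE//; last exact: zero_holomorphic.
  rewrite /hmean (_ : (fun t => _) = (fun=> 0)) ?rint_cst ?mul0r ?mulr0 ?mulr_ge0 ?pi_ge0//.
  apply/funext => t; have /andP[r0 r1] := r01.
  by rewrite f0 ?cmod0 ?powR0 ?gt_eqF//; exact: disk_circle.
apply/seteqP; split => [_ [r r01 <-]|_ ->] /=; first exact: hm.
by exists 0; rewrite ?hm//= lexx ltr01.
Qed.

Lemma zero_sub_hardy_Lp (a : set R[i]) : a `<=` disk R -> zero_on_disk R `<=` hardy_Lp p a.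
Proof.
move=> ad f f0; split; first by split; [exact: zero_holomorphic|rewrite zero_hardy_norm ?ltry].
rewrite /weighted_sum esum1 ?ltry// => z /ad/f0 ->.
by rewrite cmod0 powR0 ?gt_eqF// mulr0.
Qed.

(** Quasi-triangle inequality through u <= 2 * max (v, e), valid for every p > 0, whereas
    Minkowski's inequality requires p >= 1. *)
Lemma powR_le_sum (u v e : R) : 0 <= u -> 0 <= v -> 0 <= e -> u <= v + e ->
  u `^ p <= 2 `^ p * (v `^ p + e `^ p).
Proof.
move=> u0 v0 e0 uve.
have h (x : R) : 0 <= x -> u <= 2 * x -> u `^ p <= 2 `^ p * x `^ p.
  move=> x0 ux; rewrite -powRM//.
  by apply: powR_le => //; exact: ltW.
have [ve|ev] := leP v e.
  apply: (le_trans (h e e0 _)); first lra.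
  by rewrite ler_wpM2l ?powR_ge0// lerDr powR_ge0.
apply: (le_trans (h v v0 _)); first lra.
by rewrite ler_wpM2l ?powR_ge0// lerDl powR_ge0.
Qed.

Lemma ln_le_powR (x : R) : 0 < x -> ln x <= p^-1 * x `^ p.
Proof.
move=> x0; rewrite mulrC ler_pdivlMr// mulrC -ln_powR ltW// ln_sublinear// powR_gt0//.
Qed.

(** The left side is ln^+ x: this is how a mean of |Q|^p enters Jensen's inequality. *)
Lemma ln_lnm_le (x : R) : 0 < x -> ln x + lnm x <= p^-1 * x `^ p.
Proof.
move=> x0; rewrite /lnm; case: (leP 0 (- ln x)) => h.
  by rewrite subrr mulr_ge0 ?powR_ge0// invr_ge0 ltW.
by rewrite addr0; exact: ln_le_powR.
Qed.

Section Polynomial.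
Variables (c : R[i]) (rs : seq R[i]).
Hypotheses (c0 : c != 0) (rs1 : off_circle rs).

Let Q0 t : 0 < cmod (rpoly c rs (cis t)).
Proof. by rewrite cmod_gt0 rpoly_neq0. Qed.

Let Qp_cont : continuous (fun t => cmod (rpoly c rs (cis t)) `^ p).
Proof. by apply: powR_cont => [|t]; [apply: ccont_cmod; exact: rpoly_cont|exact: cmod_ge0]. Qed.

Let lnQ_cont : continuous (fun t => ln (cmod (rpoly c rs (cis t)))).
Proof. by apply: ln_cmod_cont => [|t]; [exact: rpoly_cont|exact: rpoly_neq0]. Qed.

Lemma rpoly_mean f s e m : holomorphic_on (disk R) f -> 0 <= s < 1 -> 0 <= e ->
  (forall z, cmod z <= 1 -> cmod (rpoly c rs z * z ^+ m - f (s%:C * z)) <= e) ->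
  rint (fun t => cmod (rpoly c rs (cis t)) `^ p) 0 (2 * pi) <= 2 `^ p * (hmean f s + 2 * pi * e `^ p).
Proof.
move=> hf s01 e0 H; have pi2 : 0 <= 2 * pi :> R by rewrite mulr_ge0 ?pi_ge0.
have hc := hmean_cont hf s01.
have cc : continuous (cst (e `^ p) : R -> R) by exact: cst_continuous_real.
have -> : 2 `^ p * (hmean f s + 2 * pi * e `^ p) =
    rint (fun t => 2 `^ p * (cmod (f (s%:C * cis t)) `^ p + (cst (e `^ p) : R -> R) t)) 0 (2 * pi).
  rewrite rintZ; last by move=> t; apply: cvgD; [exact: hc|exact: cc].
  by rewrite rintD// rint_cst// subr0 (mulrC (e `^ p)).
apply: rint_le => //.
  by move=> t; apply: cvgM; [exact: cvg_cst|apply: cvgD; [exact: hc|exact: cc]].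
move=> t _; apply: powR_le_sum => //; do ?exact: cmod_ge0.
have := H (cis t); rewrite cmod_cis lexx => /(_ isT).
have := cmod_sub_le (rpoly c rs (cis t) * cis t ^+ m) (f (s%:C * cis t)).
rewrite cmodM cmodX cmod_cis expr1n mulr1; lra.
Qed.

(** Adding the integral of ln^- |Q| to both sides of Jensen's inequality leaves the integral of ln^+
    |Q| on the right, which the mean of |Q|^p controls. A lower bound for |Q(0)| thus bounds the
    root sum and ln^- |Q| at once. *)
Lemma rpoly_mass : rpoly c rs 0 != 0 ->
  2 * pi * (ln (cmod (rpoly c rs 0)) + \sum_(b <- droots rs) (1 - cmod b)) +
  rint (fun t => lnm (cmod (rpoly c rs (cis t)))) 0 (2 * pi) <=
  p^-1 * rint (fun t => cmod (rpoly c rs (cis t)) `^ p) 0 (2 * pi).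
Proof.
move=> r0; have := jensen_rpoly rs1 r0; rewrite -big_filter => J.
have cl : continuous (fun t => lnm (cmod (rpoly c rs (cis t)))).
  by apply: lnm_cont => [|t]; [exact: rpoly_cont|exact: rpoly_neq0].
apply: (le_trans (lerD J (lexx _))); rewrite -rintD// -rintZ//.
apply: rint_le => [t|t|t _]; last exact: ln_lnm_le.
- by apply: cvgD; [exact: lnQ_cont|exact: cl].
- by apply: cvgM; [exact: cvg_cst|exact: Qp_cont].
Qed.

(** Jensen's inequality with ln x <= x^p / p at x = |Q| / eta. Choosing the scale eta below |Q(0)|
    makes the left side positive, so the mean of |Q|^p cannot be small. *)
Lemma rpoly_mean_lower (eta : R) : 0 < eta -> rpoly c rs 0 != 0 ->
  2 * pi * (ln (cmod (rpoly c rs 0)) - ln eta) <=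
  p^-1 * eta^-1 `^ p * rint (fun t => cmod (rpoly c rs (cis t)) `^ p) 0 (2 * pi).
Proof.
move=> e0 r0; have pi2 : 0 <= 2 * pi :> R by rewrite mulr_ge0 ?pi_ge0.
have := jensen_rpoly rs1 r0; have cc : continuous (cst (ln eta) : R -> R) by exact: cst_continuous_real.
have s0 : 0 <= \sum_(b <- rs | cmod b < 1) (1 - cmod b) by apply: sumr_ge0 => b ?; rewrite subr_ge0 ltW.
have c1 : continuous (fun t => p^-1 * eta^-1 `^ p * cmod (rpoly c rs (cis t)) `^ p).
  by move=> t; apply: cvgM; [exact: cvg_cst|exact: Qp_cont].
have : rint (fun t => ln (cmod (rpoly c rs (cis t)))) 0 (2 * pi) <=
    rint (fun t => p^-1 * eta^-1 `^ p * cmod (rpoly c rs (cis t)) `^ p + (cst (ln eta) : R -> R) t) 0 (2 * pi).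
  apply: rint_le => //; first by move=> t; apply: cvgD; [exact: c1|exact: cc].
  move=> t _ /=; have := Q0 t; move: (cmod _) => x x0.
  have := @ln_le_powR (eta^-1 * x); rewrite mulr_gt0 ?invr_gt0// => /(_ isT).
  by rewrite lnM ?posrE ?invr_gt0// lnV ?posrE// powRM ?invr_ge0 ?(ltW e0) ?(ltW x0)// mulrA; lra.
rewrite rintD// rintZ// rint_cst// subr0 => h1 h2; rewrite mulrBr.
have : 2 * pi * ln (cmod (rpoly c rs 0)) <=
   2 * pi * (ln (cmod (rpoly c rs 0)) + \sum_(b <- rs | cmod b < 1) (1 - cmod b)).
  by rewrite ler_wpM2l// lerDl.
by rewrite (mulrC (2 * pi) (ln eta)); lra.
Qed.

End Polynomial.

End HardyMeans.

(** * Equivalence of thickness and triviality *)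

Section Thickness.
Variables (R : realType) (p : R).
Hypothesis p0 : 0 < p.
Variable a : set R[i].
Hypothesis ad : a `<=` disk R.
Implicit Types (f : R[i] -> R[i]) (z w : R[i]) (r t : R).

Lemma esum_scale_le (T : choiceType) (D : set T) (g : T -> R) (k : R) : 0 <= k ->
  (forall x, D x -> 0 <= g x) ->
  (\esum_(x in D) (k * g x)%:E <= k%:E * \esum_(x in D) (g x)%:E)%E.
Proof.
move=> k0 g0; apply: ge_ereal_sup => _ [F [finF FD] <-].
have -> : (\sum_(x \in F) (k * g x)%:E = k%:E * \sum_(x \in F) (g x)%:E)%E.
  by rewrite !fsbig_finite//= !sumEFin -EFinM mulr_sumr.
apply: lee_wpmul2l; first by rewrite lee_fin.
by apply: esum_ge; exists F.
Qed.

Lemma weight_ge0 z f : a z -> 0 <= (1 - cmod z ^+ 2) * cmod (f z) `^ p.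
Proof.
move=> /ad z1; rewrite mulr_ge0 ?powR_ge0// subr_ge0 expr_le1 ?cmod_ge0//; exact: ltW.
Qed.

(** The part |z| > q of the sum is at most e / 2 already for [f], and |z^n| <= 1 does not increase
    it; on |z| <= q each term gains a factor q^(n p). *)
Lemma weighted_sum_mulX_small f e : (weighted_sum p a f < +oo)%E -> 0 < e ->
  exists n, (weighted_sum p a (fun z => z ^+ n * f z)%R <= e%:E)%E.
Proof.
move=> S e0; have e20 : 0 < e / 2 by rewrite divr_gt0.
have [q /andP[q0 q1] tail] := esum_disk_tail ad (fun z => @weight_ge0 z f) S e20.
have S0 : (0 <= weighted_sum p a f)%E by apply: esum_ge0 => z /(weight_ge0 f); rewrite lee_fin.
have SE : weighted_sum p a f = (fine (weighted_sum p a f))%:E by rewrite fineK// ge0_fin_numE.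
have qp : 0 <= q `^ p < 1.
  by rewrite powR_ge0 powR_lt1.
have [n _ hn] := pow_lt_eps 0 (fine (weighted_sum p a f)) qp e20.
have X z : a z -> (1 - cmod z ^+ 2) * cmod (z ^+ n * f z) `^ p =
    (cmod z ^+ n) `^ p * ((1 - cmod z ^+ 2) * cmod (f z) `^ p).
  by move=> az; rewrite cmodM cmodX powRM ?exprn_ge0 ?cmod_ge0//; ring.
exists n; rewrite /weighted_sum (esumID [set z | (q < cmod z)%R]) => [|z /(weight_ge0 (fun z => z ^+ n * f z))]; last by rewrite lee_fin.
have -> : e%:E = ((e / 2)%:E + (e / 2)%:E)%E by rewrite -EFinD -splitr.
apply: leeD.
  apply: le_trans tail; apply: le_esum => z [az _]; rewrite lee_fin X//.
  rewrite -[leRHS]mul1r ler_wpM2r ?weight_ge0//.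
  apply: powR_le1; rewrite ?(ltW p0) ?exprn_ge0 ?cmod_ge0//.
  by rewrite exprn_ile1 ?cmod_ge0//; exact/ltW/ad.
apply: (@le_trans _ _ (\esum_(z in a `&` ~` [set z | (q < cmod z)%R])
    ((q `^ p) ^+ n * ((1 - cmod z ^+ 2) * cmod (f z) `^ p))%:E)).
  apply: le_esum => z [az] /negP; rewrite -leNgt => zq; rewrite lee_fin X// ler_wpM2r ?weight_ge0//.
  rewrite -[leRHS]powR_mulrn ?powR_ge0// -powRrM (mulrC p) powRrM powR_mulrn//.
  apply: powR_le; rewrite ?(ltW p0) ?exprn_ge0 ?cmod_ge0//.
  by rewrite lerXn2r ?nnegrE ?cmod_ge0.
apply: (le_trans (esum_scale_le (exprn_ge0 n (powR_ge0 _ _)) _)) => [z [az _]|]; first exact: weight_ge0.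
apply: (@le_trans _ _ (((q `^ p) ^+ n)%:E * weighted_sum p a f)%E); last first.
  by rewrite SE -EFinM lee_fin mulrC.
apply: lee_wpmul2l; first by rewrite lee_fin exprn_ge0// powR_ge0.
rewrite /weighted_sum [leRHS](esumID [set z | (q < cmod z)%R]) => [|z /(weight_ge0 f)]; last by rewrite lee_fin.
by rewrite leeDr// esum_ge0// => z [/(weight_ge0 f)]; rewrite lee_fin.
Qed.

Lemma hmean_mulX f n r : 0 <= r < 1 -> holomorphic_on (disk R) f ->
  hmean p (fun z => z ^+ n * f z) r = (r ^+ n) `^ p * hmean p f r.
Proof.
move=> r01 hf; rewrite /hmean -rintZ; last exact: hmean_cont.
apply: eq_rint => t _; have /andP[r0 _] := r01.
by rewrite cmodM cmodX cmodM cmod_cis mulr1 cmod_real ger0_norm// powRM ?exprn_ge0 ?cmod_ge0.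
Qed.

Lemma hmean_ge0 f r : 0 <= hmean p f r.
Proof. by apply: rint_ge0 => t _; exact: powR_ge0. Qed.

Lemma hardy_space_mulX f n : hardy_space p f -> hardy_space p (fun z => z ^+ n * f z).
Proof.
move=> [hf ffin]; split; first exact: holomorphic_mulX.
apply: le_lt_trans ffin; rewrite /hardy_norm.
have p1 : (0 <= p^-1)%R by rewrite invr_ge0 ltW.
have E0 (g : R[i] -> R[i]) : (0 <= ereal_sup [set circle_mean p g r | r in [set r : R | (0 <= r < 1)%R]])%E.
  apply: (@le_trans _ _ (circle_mean p g 0)); first exact: circle_mean_ge0.
  by apply: ereal_sup_ubound; exists 0; rewrite //= lexx ltr01.
apply: poweR_le; [exact: p1|exact: E0|]; apply: ge_ereal_sup => _ [r r01 <-].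
apply: (@le_trans _ _ (circle_mean p f r)); last by apply: ereal_sup_ubound; exists r.
rewrite (circle_meanE p0 hf r01) (circle_meanE p0 (holomorphic_mulX hf) r01).
rewrite hmean_mulX// lee_fin ler_wpM2l ?invr_ge0 ?mulr_ge0 ?pi_ge0//.
rewrite -[leRHS]mul1r ler_wpM2r ?hmean_ge0//; have /andP[r0 r1] := r01.
by apply: powR_le1; rewrite ?(ltW p0) ?exprn_ge0// exprn_ile1// ltW.
Qed.

(* Multiplication by [z ^+ n] makes the weighted sum small, but hardly changes
the means over circles of radius close to [1]. *)
Lemma thick_mean f e : thick p a -> hardy_Lp p a f -> 0 < e ->
  exists2 s0 : R, s0 < 1 & forall s, s0 < s < 1 -> 0 < s -> hmean p f s <= e.
Proof.
move=> [C C0 hC] [hf fa] e0; have pi0 : 0 < 2 * pi :> R by rewrite mulr_gt0 ?pi_gt0.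
(* Calibrated so that the thickness inequality for z^n f, with s^n >= 1/2, gives exactly the bound
   [e] for the mean of [f]. *)
pose d := C `^ p * ((2 * pi)^-1 * ((2^-1) `^ p * e)).
have d0 : 0 < d by rewrite !mulr_gt0 ?powR_gt0 ?invr_gt0.
have [n hn] := weighted_sum_mulX_small fa d0.
have := hC _ (@hardy_space_mulX f n hf); set g := (fun z => z ^+ n * f z) => hg.
have [hol _] := hf; have holg : holomorphic_on (disk R) g by exact: holomorphic_mulX.
(* For larger s this makes s^(n+1), hence s^n, at least 1/2; the exponent n + 1 also covers n =
   0. *)
exists (2^-1 `^ (n.+1%:R^-1)).
  by apply: powR_lt1; rewrite ?invr_gt0 ?ltr0n//; lra.
move=> s /andP[s0 s1] sp; have s01 : 0 <= s < 1 by rewrite (ltW sp).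
have sn : 2^-1 <= s ^+ n.
  apply: (@le_trans _ _ (s ^+ n.+1)); last by rewrite exprS ler_piMl ?exprn_ge0 ?(ltW sp) ?(ltW s1).
  rewrite -powR_mulrn ?(ltW sp)//.
  have -> : 2^-1 = (2^-1 `^ n.+1%:R^-1) `^ n.+1%:R :> R by rewrite -powRrM mulVf ?powRr1// invr_ge0.
  by apply: powR_le; rewrite ?powR_ge0 ?ler0n// ltW.
have E0 : (0 <= ereal_sup [set circle_mean p g r | r in [set r : R | (0 <= r < 1)%R]])%E.
  apply: (@le_trans _ _ (circle_mean p g 0)); first exact: circle_mean_ge0.
  by apply: ereal_sup_ubound; exists 0; rewrite //= lexx ltr01.
have W0 : (0 <= weighted_sum p a g)%E by apply: esum_ge0 => z /(weight_ge0 g); rewrite lee_fin.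
have : ((C%:E * hardy_norm p g) `^ p <= (weighted_sum p a g `^ p^-1) `^ p)%E.
  apply: poweR_le => //; first exact: ltW.
  by rewrite mule_ge0 ?lee_fin ?(ltW C0)// poweR_ge0.
rewrite poweRM ?lee_fin ?(ltW C0) ?poweR_ge0// /hardy_norm -!poweRrM mulVf ?gt_eqF// !poweRe1// poweR_EFin.
move=> /le_trans/(_ hn).
have : (circle_mean p g s <= ereal_sup [set circle_mean p g r | r in [set r : R | (0 <= r < 1)%R]])%E.
  by apply: ereal_sup_ubound; exists s.
have Cp : (0 <= (C `^ p)%:E)%E by rewrite lee_fin powR_ge0.
move=> /(lee_wpmul2l Cp)/le_trans h /h {h}; rewrite circle_meanE// hmean_mulX// -EFinM lee_fin /d.
rewrite ler_pM2l ?powR_gt0// ler_pM2l ?invr_gt0// => h.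
have h2 : (2^-1) `^ p * hmean p f s <= (s ^+ n) `^ p * hmean p f s.
  rewrite ler_wpM2r ?hmean_ge0//.
  by apply: powR_le; rewrite ?(ltW p0) ?invr_ge0.
by have := le_trans h2 h; rewrite ler_pM2l// powR_gt0// invr_gt0.
Qed.

Lemma thick_trivial : thick p a -> hardy_Lp p a `<=` zero_on_disk R.
Proof.
move=> ta f fL; apply: contrapT => fn0; have [[hol _] _] := fL.
have pi0 : 0 < pi :> R := pi_gt0 R.
have [m [k0 [k00 H]]] := polynomial_approx hol fn0.
(* With this scale ln |Q(0)| - ln eta >= 1, so [rpoly_mean_lower] has left side at least 2 * pi. *)
pose eta := k0 / expR 1; have eta0 : 0 < eta by rewrite divr_gt0 ?expR_gt0.
pose K := p^-1 * eta^-1 `^ p * 2 `^ p.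
have K0 : 0 < K by rewrite !mulr_gt0 ?powR_gt0 ?invr_gt0.
(* The mean of [f] and the approximation error (4 * K)^-1 each contribute at most pi / 2, against
   the 2 * pi required. *)
have d0 : 0 < pi / (2 * K) by apply: divr_gt0 => //; apply: mulr_gt0.
have [s0 s01 hs] := thick_mean ta fL d0.
have e0 : 0 < (4 * K)^-1 `^ p^-1 by rewrite powR_gt0// invr_gt0 mulr_gt0.
have [s [c [rs [ss /andP[sp s1] c0 rs1 [approx Q0]]]]] := H s0 _ s01 e0.
have s01' : 0 <= s < 1 by rewrite (ltW sp).
have r0 : rpoly c rs 0 != 0 by rewrite -cmod_gt0 (lt_le_trans k00).
have M := rpoly_mean p0 hol s01' (ltW e0) approx.
have L := rpoly_mean_lower p0 c0 rs1 eta0 r0.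
have lnQ : 1 <= ln (cmod (rpoly c rs 0)) - ln eta.
  rewrite /eta lnM ?posrE ?invr_gt0 ?expR_gt0// lnV ?posrE ?expR_gt0// expRK.
  by have := ler_ln; move=> /(_ _ k0 (cmod (rpoly c rs 0))); rewrite !posrE k00 (lt_le_trans k00)// Q0 => /(_ isT isT); lra.
have := hs s; rewrite ss s1 => /(_ isT sp) hm.
have K0' : 0 <= p^-1 * eta^-1 `^ p by rewrite mulr_ge0 ?powR_ge0// invr_ge0 ltW.
have : p^-1 * eta^-1 `^ p * rint (fun t => cmod (rpoly c rs (cis t)) `^ p) 0 (2 * pi) <=
    K * (pi / (2 * K) + 2 * pi * (4 * K)^-1).
  apply: (le_trans (ler_wpM2l K0' M)); rewrite mulrA ler_wpM2l ?(ltW K0)// lerD//.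
  by rewrite -powRrM mulVf ?gt_eqF// powRr1// invr_ge0 mulr_ge0// ltW.
have -> : K * (pi / (2 * K) + 2 * pi * (4 * K)^-1) = pi.
  by move: (@pi R) => x; field; rewrite gt_eqF.
have : 2 * pi * 1 <= 2 * pi * (ln (cmod (rpoly c rs 0)) - ln eta).
  by rewrite ler_wpM2l// mulr_ge0// ltW.
move: L; move: (rint _ _ _) (ln _) => x y; lra.
Qed.

(** The constant 1 works: if the inequality failed, the weighted sum would be finite, so [f] would
    vanish on the disk and its norm would be 0. *)
Lemma trivial_thick : hardy_Lp p a `<=` zero_on_disk R -> thick p a.
Proof.
move=> triv; exists 1 => // f hf; rewrite mul1e leNgt; apply/negP => lt.
have [hol ffin] := hf.
have wfin : (weighted_sum p a f < +oo)%E.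
  apply: (@lty_poweRy _ _ p^-1); first by rewrite invr_eq0 gt_eqF.
  exact: lt_trans lt ffin.
have := triv f (conj hf wfin) => /(zero_hardy_norm p0) f0.
by move: lt; rewrite f0 ltNge poweR_ge0.
Qed.

End Thickness.

(** * Nontangential limit points *)

Section NontangentialNull.
Variables (R : realType) (p : R).
Hypothesis p0 : 0 < p.
Notation mu := (@lebesgue_measure R).
Implicit Types (f : R[i] -> R[i]) (z w : R[i]) (r t : R).

(** The point is that [A] is chosen before [s0] and [e]: the means of [f] are bounded by its Hardy
    norm, the error by 1, and |Q(0)| from below by [k0]. *)
Lemma mass_bound f : hardy_space p f -> ~ zero_on_disk R f ->
  exists m A, forall s0 e : R, s0 < 1 -> 0 < e -> e <= 1 -> exists s c rs,
    [/\ s0 < s, 0 < s < 1, c != 0, off_circle rs & [/\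
      forall z, cmod z <= 1 -> cmod (rpoly c rs z * z ^+ m - f (s%:C * z)) <= e,
      rint (fun t => lnm (cmod (rpoly c rs (cis t)))) 0 (2 * pi) <= A &
      \sum_(b <- droots rs) (1 - cmod b) <= A]].
Proof.
move=> hf fn0; have [hol _] := hf; have [S S0 HS] := hardy_mean_bound p0 hf.
have [m [k0 [k00 H]]] := polynomial_approx hol fn0.
have pi2 : 1 <= 2 * pi :> R by have := @pi_ge2 R; lra.
have pi0 : 0 <= 2 * pi :> R by lra.
exists m, (p^-1 * (2 `^ p * (S + 2 * pi)) - 2 * pi * ln k0) => s0 e s01 e0 e1.
have [s [c [rs [ss /andP[sp s1] c0 rs1 [approx Q0]]]]] := H s0 e s01 e0.
exists s, c, rs; rewrite sp s1; split => //.
have s01' : 0 <= s < 1 by rewrite (ltW sp).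
have r0 : rpoly c rs 0 != 0 by rewrite -cmod_gt0 (lt_le_trans k00).
have M := rpoly_mean p0 hol s01' (ltW e0) approx.
have L := rpoly_mass p0 c0 rs1 r0.
have lnQ : ln k0 <= ln (cmod (rpoly c rs 0)) by rewrite ler_ln ?posrE// (lt_le_trans k00).
have M' : p^-1 * rint (fun t => cmod (rpoly c rs (cis t)) `^ p) 0 (2 * pi) <=
    p^-1 * (2 `^ p * (S + 2 * pi)).
  rewrite ler_wpM2l ?invr_ge0 ?(ltW p0)// (le_trans M)// ler_wpM2l ?powR_ge0// lerD ?HS//.
  rewrite -[leRHS]mulr1 ler_wpM2l//; apply: powR_le1 => //; exact: ltW.
have lm0 : 0 <= rint (fun t => lnm (cmod (rpoly c rs (cis t)))) 0 (2 * pi).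
  by apply: rint_ge0 => t _; exact: lnm_ge0.
have b0 : 0 <= \sum_(b <- droots rs) (1 - cmod b).
  by rewrite big_seq; apply: sumr_ge0 => b; rewrite mem_filter subr_ge0 => /andP[/ltW].
have b2 : \sum_(b <- droots rs) (1 - cmod b) <= 2 * pi * \sum_(b <- droots rs) (1 - cmod b).
  by rewrite ler_peMl.
have lnQ2 := ler_wpM2l pi0 lnQ; rewrite [X in X + _ <= _]mulrDr in L.
split => //; lra.
Qed.

Lemma closure_cmod (A : set R[i]) w : closure (A : set R[i]^o) w ->
  forall rho : R, 0 < rho -> exists2 z, A z & cmod (w - z) < rho.
Proof.
move=> cA rho rho0; have rho0' : 0 < rho%:C by rewrite ltcR.
have [z [Az]] := cA _ (nbhsx_ballx (w : R[i]^o) _ rho0').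
by rewrite /ball /= -cmodC ltcR => h; exists z.
Qed.

Lemma esum_subset (T : choiceType) (D E : set T) (g : T -> \bar R) : D `<=` E ->
  (\esum_(x in D) g x <= \esum_(x in E) g x)%E.
Proof.
move=> DE; apply: ge_ereal_sup => _ [F [finF FD] <-]; apply: esum_ge.
by exists F => //; split => //; exact: subset_trans DE.
Qed.

(* Borel-Cantelli: the points of [a] with [delta <= cmod (f z)] have a finite sum of [1 - cmod z]. *)
Lemma heavy_null (a : set R[i]) f (k alpha delta : R) : a `<=` disk R ->
  (weighted_sum p a f < +oo)%E -> 0 < k -> k < 1 -> 0 < alpha -> 0 < delta ->
  mu [set th | k <= th <= 2 * pi - k /\ forall rho : R, 0 < rho -> exists z,
      [/\ a z, stolz alpha (cis th) z, delta <= cmod (f z) & cmod (cis th - z) < rho]] = 0%E.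
Proof.
move=> ad S k0 k1 al0 d0; have [C C0 shadow] := stolz_shadow k0 k1 al0.
pose h z := 1 - cmod z ^+ 2.
have h0 z : a z -> 0 < h z.
  by move=> /ad z1; rewrite subr_gt0 exprn_ilt1 ?cmod_ge0.
pose heavy := a `&` [set z | delta <= cmod (f z)].
have adD : heavy `<=` disk R by move=> z [/ad].
have ad0 z : heavy z -> 0 <= h z by move=> [/h0/ltW].
have adS : (\esum_(z in heavy) (h z)%:E < +oo)%E.
  have dp : 0 < delta `^ p by rewrite powR_gt0.
  have w0 z : heavy z -> 0 <= h z * cmod (f z) `^ p by move=> [az _]; exact: weight_ge0 ad _ _ az.
  apply: (@le_lt_trans _ _ (\esum_(z in heavy) ((delta `^ p)^-1 * (h z * cmod (f z) `^ p))%:E)%E).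
    apply: le_esum => z zd; have [az dz] := zd; rewrite lee_fin mulrCA ler_peMr ?ad0//.
    by rewrite ler_pdivlMl// mulr1; apply: powR_le => //; exact: ltW.
  apply: (le_lt_trans (esum_scale_le _ w0)); first by rewrite invr_ge0 ltW.
  apply: (@le_lt_trans _ _ (((delta `^ p)^-1)%:E * weighted_sum p a f)%E).
    apply: lee_wpmul2l; first by rewrite lee_fin invr_ge0 ltW.
    by apply: esum_subset => z [].
  have W0 : (0 <= weighted_sum p a f)%E by apply: esum_ge0 => z az; rewrite lee_fin; exact: weight_ge0 ad _ _ az.
  have -> : weighted_sum p a f = (fine (weighted_sum p a f))%:E by rewrite fineK// ge0_fin_numE.
  by rewrite -EFinM ltry.
apply: lebesgue_sub0 => e e0; have e20 : 0 < e / (2 * C) by rewrite divr_gt0 ?mulr_gt0.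
have [q /andP[q0 q1]] := esum_disk_tail adD ad0 adS e20.
set B := heavy `&` _ => tail.
have Bc : countable B.
  apply: (@esum_gt0_countable _ _ B h) => [z [[az _] _]|]; first exact: h0.
  exact: le_lt_trans tail (ltry _).
(* A point within 1 - q of the vertex has modulus greater than q, so only the tail [B] is involved;
   each of its points shadows an interval of length 2 * C * (1 - |z|). *)
apply: (@le_trans _ _ (mu (\bigcup_(z in B) ball (carg z) (C * (1 - cmod z))))).
  apply: lebesgue_sub => th [thk /(_ (1 - q))]; rewrite subr_gt0 => /(_ q1)[z [az st dz zq]].
  exists z; last by apply: set_mem; rewrite mem_ballR; exact: shadow.
  split; first by split.
  by have := cmod_sub_le (cis th) z; rewrite /= cmod_cis; lra.
apply: (le_trans (lebesgue_bigcup_esum _ Bc)).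
apply: (@le_trans _ _ (\esum_(z in B) (2 * C * h z)%:E)%E).
  apply: le_esum => z [[az _] _]; have z1 : disk R z := ad z az; rewrite /disk /= in z1.
  rewrite lebesgue_measure_ball; last by rewrite mulr_ge0 ?(ltW C0)// subr_ge0 ltW.
  rewrite lee_fin -[leLHS]mulr_natl [leLHS]mulrA ler_wpM2l ?mulr_ge0 ?(ltW C0)// /h lerD2l lerN2.
  by rewrite expr2 ler_piMr ?cmod_ge0 ?ltW.
apply: (le_trans (esum_scale_le _ _)) => [|z [zd _]|]; [by rewrite mulr_ge0// ltW|exact: ad0|].
apply: (@le_trans _ _ ((2 * C)%:E * (e / (2 * C))%:E)%E).
  by apply: lee_wpmul2l => //; rewrite lee_fin mulr_ge0// ltW.
by rewrite -EFinM lee_fin mulrC divfK// gt_eqF// mulr_gt0.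
Qed.

(** Passage from the polynomials to [f]: the index from which a vertex is bad depends on the vertex,
    so the exceptional set is a lower limit, and continuity from below keeps the uniform bound. *)
Lemma lebesgue_liminf (B : nat -> set R) (M : R) : (forall n, measurable (B n)) ->
  (forall n, (mu (B n) <= M%:E)%E) -> (mu (\bigcup_n \bigcap_(j in [set j | (n <= j)%N]) B j) <= M%:E)%E.
Proof.
move=> mB BM; pose F n := \bigcap_(j in [set j | (n <= j)%N]) B j.
have mF n : measurable (F n) by apply: bigcap_measurable => //; exists n => /=.
have ndF : nondecreasing_seq F.
  move=> m n mn; apply/subsetPset => x Fx j nj; apply: Fx; exact: leq_trans nj.
have cF := @nondecreasing_cvg_mu _ _ _ mu F mF (bigcup_measurable (fun n _ => mF n)) ndF.
rewrite -(cvg_lim _ cF)//; apply: lime_le; first by apply/cvg_ex; exists (mu (\bigcup_n F n)).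
apply: nearW => n; apply: le_trans (BM n); apply: lebesgue_sub => x; apply => /=.
exact: leqnn.
Qed.

(** Near such a vertex there are K separated points with |f| < delta. At these finitely many points
    f(s z) tends to f(z) as s -> 1, so all late polynomials are small there and the vertex lies in
    all late bad sets. *)
Lemma light_small f (k alpha : R) : hardy_space p f -> ~ zero_on_disk R f ->
  0 < k -> k < 1 -> 0 < alpha -> exists D, forall (lam : R) K, 0 < lam -> (0 < K)%N ->
  exists2 delta : R, 0 < delta &
  (mu [set th | (k <= th <= 2 * pi - k)%R /\ forall rho : R, (0 < rho)%R -> exists z,
      [/\ stolz alpha (cis th) z, (cmod (f z) < delta)%R & (cmod (cis th - z) < rho)%R]]
    <= (D * (lam^-1 + K%:R^-1))%:E)%E.
Proof.
move=> hf fn0 k0 k1 al0; have [m [A HA]] := mass_bound hf fn0; have [hol _] := hf.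
have [C C0 HC] := bad_set k0 k1 al0.
(* The factor 2^-m absorbs z^m, which is at least 2^-m in modulus at the points used, all with |z|
   >= 1/2. *)
exists (C * A) => lam K lam0 K0; pose delta := expR (- lam) * (2 ^- m).
have delta0 : 0 < delta by rewrite mulr_gt0 ?expR_gt0// invr_gt0 exprn_gt0.
exists delta => //.
pose e j : R := j.+1%:R^-1.
have e0 j : 0 < e j by rewrite invr_gt0 ltr0n.
have e1 j : e j <= 1 by rewrite invf_le1 ?ler1n ?ltr0n.
have : forall j, exists sB : R * set R, [/\ 1 - e j < sB.1 < 1, measurable sB.2,
    (mu sB.2 <= (C * A * (lam^-1 + K%:R^-1))%:E)%E &
    forall th (zs : nat -> R[i]), k <= th <= 2 * pi - k ->
      (forall i, (i < K)%N -> stolz alpha (cis th) (zs i)) ->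
      (forall i j, (i < j)%N -> (j < K)%N -> 3 * (1 - cmod (zs j)) <= 1 - cmod (zs i)) ->
      (forall i, (i < K)%N -> 2^-1 <= cmod (zs i)) ->
      (forall i, (i < K)%N -> cmod (f (sB.1%:C * zs i)) + e j < delta) -> sB.2 th].
  move=> j; have [|s [c [rs [ss /andP[_ s1] c0 rs1 [approx lA bA]]]]] := HA (1 - e j) (e j) _ (e0 j) (e1 j).
    by rewrite ltrBlDr ltrDl.
  have [B [mB muB HB]] := HC c rs A lam K c0 rs1 lA bA lam0 K0.
  exists (s, B); split => //=; first by rewrite ss.
  move=> th zs thk zst sep zhalf small; apply: (HB th zs thk zst sep) => i iK.
  have [zi1 _] := zst i iK; rewrite /disk /= in zi1.
  have := approx (zs i) (ltW zi1).
  have := cmod_sub_le (rpoly c rs (zs i) * zs i ^+ m) (f (s%:C * zs i)).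
  rewrite cmodM cmodX => h1 h2; have h3 := small i iK.
  have h4 : 2 ^- m <= cmod (zs i) ^+ m.
    by rewrite -exprVn lerXn2r ?nnegrE ?cmod_ge0 ?invr_ge0// zhalf.
  have m0 : 0 < 2 ^- m :> R by rewrite invr_gt0 exprn_gt0.
  rewrite -(ltr_pM2r m0); apply: (@le_lt_trans _ _ (cmod (rpoly c rs (zs i)) * cmod (zs i) ^+ m)).
    by rewrite ler_wpM2l ?cmod_ge0.
  by rewrite -/delta; lra.
move=> /choice[sB HsB].
apply: le_trans (@lebesgue_liminf (fun j => (sB j).2) _ _ _); last 2 first.
- by move=> j; have [] := HsB j.
- by move=> j; have [] := HsB j.
apply: lebesgue_sub => th [thk Hth].
have : forall rho : R, exists z, 0 < rho ->
    [/\ stolz alpha (cis th) z, cmod (f z) < delta & cmod (cis th - z) < rho].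
  move=> rho; have [r0|r0] := ltP 0 rho; last by exists 0.
  by have [z Hz] := Hth rho r0; exists z.
move=> /choice[g Hg].
(* Each point is taken within (1 - |z|) / 3 of the vertex, z being the previous one, which yields
   the ratio 3 of [bad_set]; starting within 1/2 gives |z| >= 1/2 throughout. *)
pose zs i := iter i (fun z => g ((1 - cmod z) / 3)) (g 2^-1).
have gap rho : 0 < rho -> 1 - cmod (g rho) < rho.
  move=> r0; have [_ _] := Hg rho r0; have := cmod_sub_le (cis th) (g rho); rewrite cmod_cis; lra.
have P i : [/\ stolz alpha (cis th) (zs i), cmod (f (zs i)) < delta & 2^-1 <= cmod (zs i)].
  elim: i => [|i [[zd zst] fz zh]] /=.
    by have [//|s1 s2 s3] := Hg 2^-1; split => //; have := gap 2^-1; lra.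
  have h : 0 < (1 - cmod (zs i)) / 3 by rewrite divr_gt0// subr_gt0.
  by have [s1 s2 s3] := Hg _ h; split => //; have := gap _ h; lra.
have d i : 0 < 1 - cmod (zs i) by have [[zd _] _ _] := P i; rewrite subr_gt0.
have step i : 3 * (1 - cmod (zs i.+1)) <= 1 - cmod (zs i).
  have := gap ((1 - cmod (zs i)) / 3); rewrite divr_gt0// => /(_ isT); rewrite -/(zs i.+1); lra.
have sep i j : (i < j)%N -> 3 * (1 - cmod (zs j)) <= 1 - cmod (zs i).
  elim: j => // j IH; rewrite ltnS leq_eqVlt => /orP[/eqP ->//|/IH].
  by have := step j; have := d j; have := d j.+1; lra.
have ev i : exists J, forall j, (J <= j)%N -> cmod (f ((sB j).1%:C * zs i)) + e j < delta.
  have [[zd _] fz _] := P i; have [D' fD] := holomorphic_cdiff hol zd.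
  have x0 : 0 < (delta - cmod (f (zs i))) / 2 by rewrite divr_gt0// subr_gt0.
  have [r r0 Hr] := cdiff_cont fD x0.
  have y0 : 0 < Num.min r ((delta - cmod (f (zs i))) / 2) by rewrite lt_min r0.
  have [J _ HJ] := near_infty_natSinv_lt (PosNum y0); exists J => j Jj.
  have := HJ j Jj; rewrite /= lt_min -/(e j) => /andP[er ed].
  have [/andP[s1 s2] _ _ _] := HsB j.
  have /Hr h : cmod ((sB j).1%:C * zs i - zs i) < r.
    rewrite -{2}[zs i]mul1r -mulrBl cmodM -(rmorph1 (real_complex R)) -rmorphB cmod_real.
    rewrite ltr0_norm ?subr_lt0// (@le_lt_trans _ _ (- ((sB j).1 - 1)))//; last lra.
    by rewrite ler_piMr ?oppr_ge0 ?subr_le0 ?(ltW s2)//; have := d i; lra.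
  by have := cmod_sub_le (f ((sB j).1%:C * zs i)) (f (zs i)); lra.
have [J HJ] := choice ev.
exists (\max_(i < K) J i)%N => // j /= Jj; have [_ _ _ HB] := HsB j; apply: (HB th zs) => //.
- by move=> i _; have [] := P i.
- by move=> i i' ii' _; exact: sep.
- by move=> i _; have [] := P i.
- move=> i iK; apply: HJ; apply: leq_trans Jj.
  exact: (@leq_bigmax _ (fun i : 'I_K => J i) (Ordinal iK)).
Qed.

Lemma cluster_null (a : set R[i]) f (k alpha : R) : a `<=` disk R ->
  hardy_Lp p a f -> ~ zero_on_disk R f -> 0 < k -> k < 1 -> 0 < alpha ->
  mu [set th | k <= th <= 2 * pi - k /\ forall rho : R, 0 < rho -> exists z,
      [/\ a z, stolz alpha (cis th) z & cmod (cis th - z) < rho]] = 0%E.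
Proof.
move=> ad [hf S] fn0 k0 k1 al0; have [D HD] := light_small hf fn0 k0 k1 al0.
apply: lebesgue_sub0 => e e0.
(* With lam = K the light vertices have measure at most 2 |D| / K <= e; the absolute value is taken
   because the sign of [D] is unknown here. *)
pose K := (Num.truncn (2 * `|D| / e)).+1.
have K0 : 0 < K%:R :> R by rewrite ltr0n.
have [//|//|delta d0 light] := HD K%:R K.
have heavy := heavy_null ad S k0 k1 al0 d0.
set H := [set th | _] in heavy; set L := [set th | _] in light.
apply: (@le_trans _ _ (mu (H `|` L))).
  apply: lebesgue_sub => th [thk Hth].
  (* If no point with |f| >= delta comes within rho0 of the vertex, all points of [a] in its Stolz
     angle closer than rho0 are light. *)
  have [h|/existsNP[rho0 nh]] := pselect (forall rho : R, 0 < rho -> exists z,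
      [/\ a z, stolz alpha (cis th) z, delta <= cmod (f z) & cmod (cis th - z) < rho]).
    by left.
  right; split => // rho rho_gt0.
  have /not_implyP[r0 {}nh] := nh.
  have m0 : 0 < Num.min rho rho0 by rewrite lt_min rho_gt0.
  have [z [az zst]] := Hth _ m0; rewrite lt_min => /andP[z1 z2].
  exists z; split => //; rewrite ltNge; apply/negP => dz; apply: nh.
  by exists z.
apply: (le_trans (lebesgue_setU H L)); rewrite heavy add0e (le_trans light)// lee_fin.
rewrite (@le_trans _ _ (`|D| * (K%:R^-1 + K%:R^-1)))//.
  by rewrite ler_wpM2r ?ler_norm// addr_ge0// invr_ge0 ltW.
rewrite -mulr2n -[X in _ * X]mulr_natl mulrA ler_pdivrMr// mulrC (mulrC e) -ler_pdivrMr//.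
exact/ltW/truncnS_gt.
Qed.

(** Stolz angles grow with the aperture, so integer apertures n + 1 and margins 1 / (n + 2), always
    below 1, exhaust all limit points except the angle 0, which is a null set. *)
Lemma NT_null (a : set R[i]) f : a `<=` disk R -> hardy_Lp p a f -> ~ zero_on_disk R f ->
  circle_measure (NT a) = 0%E.
Proof.
move=> ad fL fn0; pose T n := [set th : R | n.+2%:R^-1 <= th <= 2 * pi - n.+2%:R^-1 /\
  forall rho : R, 0 < rho -> exists z,
    [/\ a z, stolz n.+1%:R (cis th) z & cmod (cis th - z) < rho]].
have T0 n : mu (T n) = 0%E.
  by apply: (cluster_null ad fL fn0); rewrite ?invr_gt0 ?ltr0n// invf_lt1 ?ltr1n ?ltr0n.
apply/eqP; rewrite eq_le measure_ge0 andbT.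
apply: (@le_trans _ _ (mu ([set 0] `|` \bigcup_n T n))); last first.
  apply: (le_trans (lebesgue_setU _ _)).
  by rewrite lebesgue_measure_set1 (lebesgue_bigcup0 T0) add0e.
apply: lebesgue_sub => th [/=]; rewrite in_itv/= => /andP[th0 th2] [_ [al al0 cl]].
have [->|thn0] := eqVneq th 0; first by left.
right; have th0' : 0 < th by rewrite lt_neqAle eq_sym thn0.
have u0 : 0 < 2 * pi - th by rewrite subr_gt0.
have [N1 _ H1] := near_infty_natSinv_lt (PosNum th0').
have [N2 _ H2] := near_infty_natSinv_lt (PosNum u0).
pose n := (N1 + N2 + Num.truncn al)%N.
have nn : n.+2%:R^-1 <= n.+1%:R^-1 :> R by rewrite lef_pV2 ?posrE ?ltr0n// ler_nat.
exists n => //; split.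
  have := H1 n; rewrite /= /n -addnA leq_addr => /(_ isT); rewrite addnA -/n.
  have := H2 n; rewrite /= /n addnAC leq_addl => /(_ isT); rewrite addnAC -/n.
  by move=> x2 x1; apply/andP; split; move: nn x1 x2; move: (n.+2%:R^-1) (n.+1%:R^-1) => x y; lra.
move=> rho r0; have [z [[zd zst] az] zr] := closure_cmod cl r0.
exists z; split => //; split => //; apply: lt_le_trans zst _.
rewrite lerD2l ltW// (lt_le_trans (truncnS_gt _))// ler_nat ltnS.
exact: leq_addl.
Qed.

End NontangentialNull.

Theorem theorem2 (R : realType) (p : R) (hp : 0 < p) (a : set R[i])
    (ha : a `<=` disk R) :
  ((0 < circle_measure (NT a))%E -> hardy_Lp p a = zero_on_disk R) /\
  (thick p a <-> hardy_Lp p a = zero_on_disk R).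
Proof.
split=> [NTpos|].
  apply/seteqP; split; last exact: zero_sub_hardy_Lp.
  move=> f fL; apply: contrapT => fn0.
  by move: NTpos; rewrite (NT_null hp ha fL fn0) ltxx.
split=> [ta|triv].
  by apply/seteqP; split; [exact: thick_trivial|exact: zero_sub_hardy_Lp].
by apply: trivial_thick => //; rewrite triv.
Qed.
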